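(* Let $d\in\mathbb{N}$, $\beta>1/2$, and let $\lambda\in\ell_1(\mathbb{Z}^d)$ be given by $$\lambda_k=\prod_{j=1}^d(1+|k_j|)^{-1}\log^{-2\beta}(e+|k_j|),\qquad k=(k_1,\dots,k_d)\in\mathbb{Z}^d.$$ Then $$g_n(H_\lambda)\asymp e_n(H_\lambda)\asymp n^{-1/2}\log^{-\beta+1/2}n.$$
   Context: For a non-negative $\lambda\in\ell_1(\mathbb{Z}^d)$, $H_\lambda$ is the reproducing kernel Hilbert space of all continuous $f\colon[0,1]^d\to\mathbb{C}$ with $\hat f(k)=0$ whenever $\lambda_k=0$ and $\|f\|_{H_\lambda}^2=\sum_{k:\lambda_k\ne0}|\hat f(k)|^2/\lambda_k<\infty$, where $\hat f(k)=\int_{[0,1]^d}f(x)e^{-2\pi i\langle k,x\rangle}dx$. Set $$e_n(H_\lambda)=\inf_{\substack{x_1,\dots,x_n\in[0,1]^d\\ a_1,\dots,a_n\in\mathbb{C}}}\ \sup_{\|f\|_{H_\lambda}\le1}\Big|\sum_{k=1}^na_kf(x_k)-\int_{[0,1]^d}f(x)\,dx\Big|,$$ $$g_n(H_\lambda)=\inf_{\substack{x_1,\dots,x_n\in[0,1]^d\\ g_1,\dots,g_n\in L_2([0,1]^d)}}\ \sup_{\|f\|_{H_\lambda}\le1}\Big\|f-\sum_{i=1}^nf(x_i)g_i\Big\|_2,$$ where $\|\cdot\|_2$ is the norm of $L_2([0,1]^d)$. For sequences, $a_n\lesssim b_n$ means that there is a constant $c>0$ with $a_n\le c\,b_n$ for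 all but finitely many $n$, and $a_n\asymp b_n$ means $a_n\lesssim b_n$ and $b_n\lesssim a_n$ (constants may depend on $d$ and $\beta$). *)

(* Defs.v *)
From HB Require Import structures.
From mathcomp Require Import all_boot all_order all_algebra.
From mathcomp Require Import all_classical all_reals all_analysis.
From mathcomp Require Import complex ring lra.

Set Implicit Arguments.
Unset Strict Implicit.
Unset Printing Implicit Defensive.

Import Order.TTheory GRing.Theory Num.Theory.
Import numFieldNormedType.Exports.
Import ComplexField.Normc.

Local Open Scope classical_set_scope.
Local Open Scope ring_scope.
Local Open Scope complex_scope.

Section lebesgue_tuple.
Context {R : realType}.

Definition tcons n (p : measurableTypeR R * n.-tuple (measurableTypeR R)) :
  n.+1.-tuple (measurableTypeR R) := [the n.+1.-tuple _ of p.1 :: p.2].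

Section step.
Context (n : nat)
  (mu : {sigma_finite_measure set n.-tuple (measurableTypeR R) -> \bar R}).

Definition lebesgue_tupleS : set (n.+1.-tuple (measurableTypeR R)) -> \bar R :=
  pushforward (@lebesgue_measure R \x mu)%E (@tcons n).

Let measurable_tcons : measurable_fun setT (@tcons n).
Proof. by apply: measurable_cons. Qed.

Let tupleS0 : lebesgue_tupleS set0 = 0%E.
Proof. by rewrite /lebesgue_tupleS /pushforward preimage_set0 measure0. Qed.

Let tupleS_ge0 A : (0 <= lebesgue_tupleS A)%E.
Proof. exact: measure_ge0. Qed.

Let tupleS_sigma_additive : semi_sigma_additive lebesgue_tupleS.
Proof.
move=> F mF tF mUF; rewrite /lebesgue_tupleS /pushforward preimage_bigcup.
apply: measure_semi_sigma_additive.
- by move=> k; rewrite -[X in measurable X]setTI; exact: measurable_tcons.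
- apply/trivIsetP => i j _ _ ij; rewrite -preimage_setI.
  by move/trivIsetP : tF => /(_ _ _ Logic.I Logic.I ij) ->; rewrite preimage_set0.
- by rewrite -preimage_bigcup -[X in measurable X]setTI; exact: measurable_tcons.
Qed.

HB.instance Definition _ := isMeasure.Build _ _ _ lebesgue_tupleS
  tupleS0 tupleS_ge0 tupleS_sigma_additive.

Let sigma_finite_tupleS : sigma_finite setT lebesgue_tupleS.
Proof.
have [F UF mF] : sigma_finite setT (@lebesgue_measure R \x mu)%E.
  have /sigma_finiteP[F [TF ndF Foo]] := sigma_finiteT (@lebesgue_measure R).
  have /sigma_finiteP[G [TG ndG Goo]] := sigma_finiteT mu.
  exists (fun k => F k `*` G k).
    rewrite -setXTT TF TG predeqE => -[x y]; split.
      move=> [/= [i _ Fix] [j _ Gjy]]; exists (maxn i j) => //; split.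
      - by move: x Fix; exact/subsetPset/ndF/leq_maxl.
      - by move: y Gjy; exact/subsetPset/ndG/leq_maxr.
    by move=> [i _ []/= ? ?]; split; exists i.
  move=> k; have [? ?] := Foo k; have [? ?] := Goo k.
  split; first exact: measurableX.
  by rewrite product_measure1E// lte_mul_pinfty// ge0_fin_numE.
pose tun (t : n.+1.-tuple (measurableTypeR R)) := (thead t, [tuple of behead t]).
have tunK : cancel tun (@tcons n).
  by move=> t; rewrite /tun /tcons /= [RHS]tuple_eta; exact/val_inj.
have tconsK : cancel (@tcons n) tun.
  by move=> [a t]; rewrite /tun /tcons /=; congr pair; exact/val_inj.
have mtun : measurable_fun setT tun.
  apply/measurable_fun_pairP; split; first exact: measurable_tnth.
  exact: measurable_behead.
exists (fun k => tun @^-1` F k).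
  by rewrite -preimage_bigcup -UF preimage_setT.
move=> k; have [mFk Fkoo] := mF k; split.
  by rewrite -[X in measurable X]setTI; exact: mtun.
rewrite /lebesgue_tupleS /pushforward -comp_preimage.
by rewrite (_ : tun \o _ = id)//; apply/funext => x /=; rewrite tconsK.
Qed.

HB.instance Definition _ := Measure_isSigmaFinite.Build _ _ _ lebesgue_tupleS
  sigma_finite_tupleS.

End step.

(* Lebesgue measure on R^n, as the n-fold product of lebesgue_measure; n.-tuple
   carries the product sigma-algebra. *)
Fixpoint lebesgue_tuple (n : nat) :
    {sigma_finite_measure set n.-tuple (measurableTypeR R) -> \bar R} :=
  match n with
  | 0 => \d_ [tuple]
  | m.+1 => lebesgue_tupleS (lebesgue_tuple m)
  end.

End lebesgue_tuple.

(* A nonnegative element of ell_1(Z^d). *)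
Record ell1_weight (R : realType) (d : nat) := Ell1Weight {
  weight :> 'rV[int]_d -> R;
  weight_ge0 : forall k, 0 <= weight k;
  weight_summable : summable [set: 'rV[int]_d] (EFin \o weight)
}.

Definition log_weight_fun (R : realType) (d : nat) (beta : R) (k : 'rV[int]_d) : R :=
  \prod_(j < d) ((1 + `|k ord0 j|%:~R)^-1 *
                 ln (expR 1 + `|k ord0 j|%:~R) `^ (- 2 * beta)).

Section log_weight.
Context {R : realType} (beta : R) (hb : 2^-1 < beta).
Let u (n : nat) : R := (1 + n%:R)^-1 * ln (expR 1 + n%:R) `^ (- 2 * beta).
Let s : R := 2 * beta - 1.
Let g (n : nat) : R := ln (expR 1 + n%:R) `^ (- s).

Let s_gt0 : 0 < s. Proof. rewrite /s; move: hb; lra. Qed.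

Let e_ge2 : 2 <= expR 1 :> R.
Proof. by have := @expR_ge1Dx R 1; lra. Qed.

Let L_ge1 n : 1 <= ln (expR 1 + n%:R) :> R.
Proof.
rewrite -[leLHS](@expRK R) ler_ln ?posrE ?expR_gt0//; rewrite ?lerDl//.
Qed.

Let u_ge0 n : 0 <= u n.
Proof. by rewrite /u mulr_ge0 ?invr_ge0 ?powR_ge0// addr_ge0. Qed.

Let u_le n : u n.+1 <= expR 1 / s * (g n - g n.+1).
Proof.
rewrite /u /g.
set e := expR 1; set L := ln (e + n.+1%:R); set L' := ln (e + n%:R).
have L1 : 1 <= L by exact: L_ge1.
have L'1 : 1 <= L' by exact: L_ge1.
have L0 : 0 < L by lra.
have L'0 : 0 < L' by lra.
have e2 : 2 <= e := e_ge2.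
have n0 : 0 <= n%:R :> R by [].
have en0 : 0 < e + n%:R by lra.
have en10 : 0 < e + n.+1%:R by rewrite -natr1; lra.
have lnB1 x : 0 < x -> ln x <= x - 1 :> R.
  move=> x0; have := @le_ln1Dx R (x - 1).
  by rewrite ltrBrDl subrr x0 addrC subrK => /(_ isT).
have LL' : (e + n.+1%:R)^-1 <= L - L'.
  have -> : L - L' = - ln ((e + n%:R) / (e + n.+1%:R)).
    by rewrite ln_div ?posrE// opprB.
  have h := lnB1 _ (divr_gt0 en0 en10).
  rewrite [leLHS](_ : _ = 1 - (e + n%:R) / (e + n.+1%:R)); last first.
    by rewrite -natr1; field; rewrite natr1 gt_eqF.
  by rewrite lerNr opprB.
have lr : (L - L') / L <= ln (L / L').
  have -> : ln (L / L') = - ln (L' / L) by rewrite !ln_div ?posrE// opprB.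
  have h := lnB1 _ (divr_gt0 L'0 L0).
  by rewrite mulrBl divff ?gt_eqF// lerNr opprB.
have E : g n - g n.+1 = L `^ (- s) * ((L / L') `^ s - 1).
  rewrite /g -/L -/L' mulrBr mulr1; congr (_ - _).
  rewrite /powR !gt_eqF ?divr_gt0// -expRD ln_div ?posrE//; congr expR.
  by ring.
have p : s * ((e + n.+1%:R)^-1 / L) <= (L / L') `^ s - 1.
  rewrite /powR gt_eqF ?divr_gt0//.
  apply: (@le_trans _ _ (s * ln (L / L'))); last first.
    by rewrite lerBrDl expR_ge1Dx.
  rewrite ler_pM2l//; apply: le_trans lr; rewrite ler_pM2r ?invr_gt0//.
have -> : L `^ (- 2 * beta) = L `^ (- s) / L.
  rewrite -powR_inv1 ?ltW// -powRD; last by rewrite (gt_eqF L0) implybT.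
  by congr powR; rewrite /s; lra.
have step : L `^ (- s) * (s * ((e + n.+1%:R)^-1 / L)) <= L' `^ (- s) - L `^ (- s).
  by move: E; rewrite /g -/L -/L' => ->; rewrite ler_wpM2l ?powR_ge0.
apply: (@le_trans _ _ (e / s * (L `^ (- s) * (s * ((e + n.+1%:R)^-1 / L))))); last first.
  by rewrite ler_wpM2l// divr_ge0 ?ltW// expR_gt0.
have -> : e / s * (L `^ (- s) * (s * ((e + n.+1%:R)^-1 / L)))
   = e / (e + n.+1%:R) * (L `^ (- s) / L).
  have alg (a b c f x : R) : b != 0 -> a / b * (c * (b * (f * x))) = a * f * (c * x).
    by move=> b0; field.
  by rewrite alg// gt_eqF.
apply: ler_wpM2r; first by rewrite divr_ge0 ?powR_ge0// ltW.
have n1 : 0 < 1 + n.+1%:R :> R by rewrite -natr1; lra.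
rewrite ler_pdivlMr// mulrC ler_pdivrMr// mulrDr mulr1 lerD2l.
by rewrite ler_peMl//; lra.
Qed.

Let T : R := u 0 + expR 1 / s * g 0.

Let sum_u_le n : \sum_(0 <= i < n) u i <= T.
Proof.
suff H m : \sum_(0 <= i < m.+1) u i <= T - expR 1 / s * g m.
  apply: (@le_trans _ _ (\sum_(0 <= i < n.+1) u i)).
    by rewrite big_nat_recr//= lerDl.
  apply: (le_trans (H n)); rewrite gerBl mulr_ge0 ?powR_ge0//.
  by rewrite divr_ge0 ?expR_ge0// ltW.
elim: m => [|m IH]; first by rewrite big_nat1 /T addrK.
rewrite big_nat_recr//=.
apply: (le_trans (lerD IH (u_le m))).
by rewrite mulrBr addrA subrK.
Qed.

Let v (z : int) : R := u `|z|%N.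

Let sub_sum (T1 : eqType) (f : T1 -> R) (s1 s2 : seq T1) :
  (forall x, 0 <= f x) -> uniq s1 -> {subset s1 <= s2} ->
  \sum_(x <- s1) f x <= \sum_(x <- s2) f x.
Proof.
move=> f0; elim: s1 s2 => [|x s1 IH] s2 /= => [_ _|/andP[xs1 us1] sub].
  by rewrite big_nil sumr_ge0.
have xs2 : x \in s2 by apply: sub; rewrite inE eqxx.
rewrite (perm_big _ (perm_to_rem xs2)) !big_cons lerD2l IH// => y ys1.
have : y \in s2 by apply: sub; rewrite inE ys1 orbT.
rewrite (perm_mem (perm_to_rem xs2)) inE => /orP[/eqP yx|//].
by rewrite -yx ys1 in xs1.
Qed.

Let sum_v_le (B : seq int) : uniq B -> \sum_(z <- B) v z <= T + T.
Proof.
move=> uB.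
pose N := (\max_(z <- B) `|z|%N).+1.
pose B2 := map Posz (iota 0 N) ++ map (fun n => - Posz n) (iota 0 N).
apply: (@le_trans _ _ (\sum_(z <- B2) v z)).
  apply: sub_sum => // [z|z zB]; first exact: u_ge0.
  have zN : `|z|%N \in iota 0 N.
    rewrite mem_iota /= add0n ltnS.
    exact: (@leq_bigmax_seq _ B xpredT (fun z : int => `|z|%N)).
  rewrite mem_cat; apply/orP.
  have [z0|z0] := leP 0 z; [left|right]; apply/mapP; exists `|z|%N => //.
    by rewrite gez0_abs.
  by rewrite ltz0_abs// opprK.
rewrite big_cat !big_map/= lerD//.
  by have := sum_u_le N; rewrite /index_iota subn0.
rewrite (eq_bigr u); last by move=> i _; rewrite /v abszN.
by have := sum_u_le N; rewrite /index_iota subn0.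
Qed.

Lemma log_weight_fun_ge0 d (k : 'rV[int]_d) : 0 <= log_weight_fun beta k.
Proof. by apply: prodr_ge0 => j _; rewrite mulr_ge0 ?powR_ge0// invr_ge0 addr_ge0. Qed.

Lemma summable_log_weight_fun d :
  summable [set: 'rV[int]_d] (EFin \o log_weight_fun beta).
Proof.
pose w : 'rV[int]_d -> R := log_weight_fun beta.
have wE k : w k = \prod_j v (k ord0 j).
  by apply: eq_bigr => j _; rewrite /v /u natr_absz.
have w0 k : 0 <= w k by rewrite wE prodr_ge0// => j _; exact: u_ge0.
apply: (@le_lt_trans _ _ ((T + T) ^+ d)%:E); last by rewrite ltry.
apply: ge_ereal_sup => _ [A [finA _] <-].
rewrite fsbig_finite//=.
rewrite (eq_bigr (fun k => (w k)%:E)); last first.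
  by move=> k _ /=; rewrite ger0_norm// w0.
rewrite sumEFin lee_fin.
set X := finmap.enum_fset _.
have uX : uniq X by exact: finmap.fset_uniq.
pose B : seq int := undup (flatten [seq [seq k ord0 j | j <- enum 'I_d] | k : 'rV[int]_d <- X]).
have BP k j : k \in X -> k ord0 j \in B.
  move=> kX; rewrite mem_undup; apply/flattenP.
  exists [seq k ord0 j | j <- enum 'I_d]; first exact: (map_f (fun k : 'rV[int]_d => _)).
  by apply: map_f; rewrite mem_enum.
pose h (f : {ffun 'I_d -> seq_sub B}) : 'rV[int]_d := \row_j val (f j).
apply: (@le_trans _ _ (\sum_(k <- map h (index_enum {ffun 'I_d -> seq_sub B})) w k)).
  apply: sub_sum => // k kX; apply/mapP.
  exists [ffun j => SeqSub (BP k j kX)]; first exact: mem_index_enum.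
  by apply/rowP => j; rewrite mxE ffunE.
rewrite big_map.
under eq_bigr do (rewrite wE; under eq_bigr do rewrite mxE).
rewrite -(bigA_distr_bigA (fun (j : 'I_d) (b : seq_sub B) => v (val b))).
rewrite prodr_const card_ord.
apply: lerXn2r; rewrite ?nnegrE.
- by apply: sumr_ge0 => b _; exact: u_ge0.
- by have := @sum_v_le [::] isT; rewrite big_nil.
apply: le_trans (sum_v_le (undup_uniq _ : uniq B)).
rewrite -(big_map (fun b : seq_sub B => val b) xpredT v) /=.
apply: sub_sum => [z||z /mapP[b _ ->]]; first exact: u_ge0.
- by rewrite map_inj_uniq ?index_enum_uniq//; exact: val_inj.
- exact: valP.
Qed.

Definition log_weight d : ell1_weight R d :=
  Ell1Weight (@log_weight_fun_ge0 d) (@summable_log_weight_fun d).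

End log_weight.

(* A function on [0,1]^d is represented by a function on all of 'rV[R]_d, and an
   element of L_2([0,1]^d) by any measurable representative: nothing below
   depends on the values outside unit_cube. Row vectors carry the topology,
   tuples the measure, and row_of links the two. Norms, errors and infima are
   taken in \bar R. *)
Section function_space.
Context {R : realType} {d : nat}.
Implicit Types f g : 'rV[R]_d -> R[i].

Definition unit_cube : set 'rV[R]_d := [set x | forall j, 0 <= x ord0 j <= 1].

Definition row_of (t : d.-tuple (measurableTypeR R)) : 'rV[R]_d :=
  \row_j tnth t j.

Definition cube_integral f : R[i] :=
  (\int[lebesgue_tuple d]_(t in row_of @^-1` unit_cube) complex.Re (f (row_of t)))
  +i*
  (\int[lebesgue_tuple d]_(t in row_of @^-1` unit_cube) complex.Im (f (row_of t))).

Definition L2_norm f : \bar R :=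
  ((\int[lebesgue_tuple d]_(t in row_of @^-1` unit_cube)
     (normc (f (row_of t)) ^+ 2)%:E) `^ 2^-1)%E.

Definition in_L2 g : Prop :=
  [/\ measurable_fun (row_of @^-1` unit_cube) (fun t => complex.Re (g (row_of t))),
      measurable_fun (row_of @^-1` unit_cube) (fun t => complex.Im (g (row_of t)))
    & (L2_norm g < +oo)%E].

(* e^(i t) *)
Definition expi (t : R) : R[i] := cos t +i* sin t.

Definition fourier_coef f (k : 'rV[int]_d) : R[i] :=
  cube_integral (fun x =>
    f x * expi (- (2 * pi * \sum_(j < d) (k ord0 j)%:~R * x ord0 j))).

Definition H_norm (lambda : ell1_weight R d) f : \bar R :=
  ((\esum_(k in [set k | lambda k != 0%R])
     (normc (fourier_coef f k) ^+ 2 / lambda k)%:E) `^ 2^-1)%E.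

(* R[i]^o is R[i] with the topology given by the modulus. *)
Definition in_H (lambda : ell1_weight R d) f : Prop :=
  [/\ {within unit_cube, continuous (f : 'rV[R]_d -> R[i]^o)},
      forall k, lambda k = 0 -> fourier_coef f k = 0
    & (H_norm lambda f < +oo)%E].

Definition H_ball (lambda : ell1_weight R d) : set ('rV[R]_d -> R[i]) :=
  [set f | in_H lambda f /\ (H_norm lambda f <= 1)%E].

Definition e_n (lambda : ell1_weight R d) (n : nat) : \bar R :=
  ereal_inf
    [set ereal_sup
           [set (normc
                   (\sum_(k < n) a k * f (x k) - cube_integral f))%:E
           | f in H_ball lambda]
    | x in [set x : 'I_n -> 'rV[R]_d | forall k, unit_cube (x k)]
    & a in [set: 'I_n -> R[i]]].

Definition g_n (lambda : ell1_weight R d) (n : nat) : \bar R :=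
  ereal_inf
    [set ereal_sup
           [set L2_norm (fun y => f y - \sum_(i < n) f (x i) * g i y)
           | f in H_ball lambda]
    | x in [set x : 'I_n -> 'rV[R]_d | forall i, unit_cube (x i)]
    & g in [set g : 'I_n -> 'rV[R]_d -> R[i] | forall i, in_L2 (g i)]].

End function_space.

Definition lesssim (R : realType) (a b : nat -> \bar R) : Prop :=
  exists2 c : R, 0 < c & \forall n \near \oo, (a n <= c%:E * b n)%E.

Definition asymp (R : realType) (a b : nat -> \bar R) : Prop :=
  lesssim a b /\ lesssim b a.

(* Main.v *)
Require Import Defs.
From mathcomp Require Import all_boot all_order all_algebra.
From mathcomp Require Import all_classical all_reals all_analysis.
From mathcomp Require Import measurable_realfun complex ring lra zify.
Set Implicit Arguments.
Unset Strict Implicit.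
Unset Printing Implicit Defensive.
Import Order.TTheory GRing.Theory Num.Theory.
Local Open Scope ring_scope.

(* Upper bound. For T of order n log^(2 beta - 1) n one has
   \sum_k min(1, T lambda_k) <= n / 8. Nodes and weights are chosen one after
   the other, in the manner of Batson, Spielman and Srivastava: a lower barrier
   makes the weighted discrete norm dominate the L_2 norm on the span of the
   frequencies with T lambda_k >= 1, while an upper barrier, whose potential is
   weighted by min(1, T lambda_k), bounds the discrete norm of the remaining
   frequencies. Weighted least squares then has squared error O(1 / T). A complex
   f is treated through its real and imaginary parts, expanded in the real
   orthonormal system cos + sin (Hartley basis).

   Lower bound. With kappa ranging over n < kappa <= n^2 and mu_kappa = 1 / kappa,
   let P be an orthogonal projection whose range contains the 2n vectors
   (sqrt mu_kappa cos(2 pi kappa x_i))_kappa and the same with sin (x_i denotes one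
   coordinate of the i-th node), and let Q = 1 - P. The function
     f(x) = \sum_(k, l) sqrt(mu_k mu_l) Q_kl cos(2 pi (k - l) x)
   vanishes at the nodes. As the trace of P is at most 2n and mu <= 1 / n, its mean
   \sum_k mu_k Q_kk is at least ln n - 3, and the nonconstant part of its squared
   norm is O(n log^(2 beta + 1) n).

   In between, e_n <= g_n because one may integrate a recovery formula. *)

(** * Positive definite forms and barrier potentials *)

Section quadratic_forms.
Context {R : realFieldType} {m : nat}.
Implicit Types (A B P X Y : 'M[R]_m) (x y v : 'cV[R]_m).

(** What decides the rate is the tail of the weights rather than a single weight: in one variable,
    the sum of [lambda k] over |k| > n, divided by n, has order log^(1 - 2 beta) n / n, a factor log
    n above the weight at n itself. This tail decays only logarithmically, so up to constants it
    does not change when n is replaced by a power of n. Hence a box of side about N^(1 / (2 d)),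
    with only O(sqrt N) frequencies, can be counted trivially, the dimension affects constants
    alone, and the lower bound may live on one coordinate axis. The choice mu_kappa = 1 / kappa is
    adapted to the weights: mu_k mu_l |k - l| <= mu_k + mu_l, so pairs of difference z carry total
    mass O(log n / |z|), and this |z| cancels the one in 1 / lambda. Two obstacles shape the upper
    bound. Infinitely many frequencies carry the tail, so the upper potential must not depend on how
    many of them are kept. And a member of the space is just a continuous function with given
    coefficients, not assumed periodic, so its far tail must be bounded pointwise from the
    coefficients; this requires a proof that the Hartley system is complete. *)

Definition bform A x y : R := (x^T *m A *m y) 0 0.

Lemma bformD A B x y : bform (A + B) x y = bform A x y + bform B x y.
Proof. by rewrite /bform mulmxDr mulmxDl mxE. Qed.

Lemma bformZ c A x y : bform (c *: A) x y = c * bform A x y.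
Proof. by rewrite /bform -scalemxAr -scalemxAl mxE. Qed.

Lemma bformN A x y : bform (- A) x y = - bform A x y.
Proof. by rewrite -scaleN1r bformZ mulN1r. Qed.

Lemma bformDl A x y z : bform A (x + y) z = bform A x z + bform A y z.
Proof. by rewrite /bform linearD/= !mulmxDl mxE. Qed.

Lemma bformDr A x y z : bform A x (y + z) = bform A x y + bform A x z.
Proof. by rewrite /bform mulmxDr mxE. Qed.

Lemma bformZl A c x y : bform A (c *: x) y = c * bform A x y.
Proof. by rewrite /bform linearZ/= -!scalemxAl mxE. Qed.

Lemma bformZr A c x y : bform A x (c *: y) = c * bform A x y.
Proof. by rewrite /bform -scalemxAr mxE. Qed.

Lemma bformE A x y : bform A x y = \sum_i \sum_j x i 0 * A i j * y j 0.
Proof.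
rewrite /bform -mulmxA mxE; apply: eq_bigr => i _.
rewrite !mxE mulr_sumr; apply: eq_bigr => j _; by rewrite mulrA.
Qed.

Lemma bformC A x y : A^T = A -> bform A x y = bform A y x.
Proof.
move=> sA; rewrite !bformE exchange_big/=; apply: eq_bigr => i _.
apply: eq_bigr => j _; rewrite -[in LHS]sA mxE; ring.
Qed.

Lemma bform_conj A (C : 'M[R]_m) x y :
  bform (C^T *m A *m C) x y = bform A (C *m x) (C *m y).
Proof. by rewrite /bform trmx_mul !mulmxA. Qed.

Lemma bform_rank1 v x y :
  bform (v *m v^T) x y = (v^T *m x) 0 0 * (v^T *m y) 0 0.
Proof.
rewrite /bform mulmxA -mulmxA mxE big_ord1; congr (_ * _).
by rewrite -[x^T *m v]trmxK trmx_mul trmxK mxE.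
Qed.

Lemma bform1 x : bform 1%:M x x = \sum_i x i 0 ^+ 2.
Proof. by rewrite /bform mulmx1 mxE; apply: eq_bigr => i _; rewrite mxE expr2. Qed.

Lemma bform1_gt0 x : x != 0 -> 0 < bform 1%:M x x.
Proof.
move=> x0; rewrite bform1 lt0r sumr_ge0 ?andbT; last by move=> i _; exact: sqr_ge0.
apply: contra x0 => /eqP /psumr_eq0P s0; apply/eqP/colP => i; rewrite mxE.
have /eqP := s0 (fun i _ => sqr_ge0 (x i 0)) i isT.
by rewrite sqrf_eq0 => /eqP.
Qed.

Definition psd A := A^T = A /\ forall x, 0 <= bform A x x.
Definition posdef A := A^T = A /\ forall x, x != 0 -> 0 < bform A x x.

Lemma posdef_psd A : posdef A -> psd A.
Proof.
case=> sA pA; split=> // x; have [->|/pA/ltW//] := eqVneq x 0.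
by rewrite /bform mulmx0 mxE.
Qed.

Lemma posdefD A B : posdef A -> psd B -> posdef (A + B).
Proof.
case=> sA pA [sB pB]; split=> [|x x0]; first by rewrite linearD/= sA sB.
by rewrite bformD ltr_wpDr ?pA.
Qed.

Lemma posdef_scalar c : 0 < c -> posdef c%:M.
Proof.
move=> c0; split=> [|x x0]; first by rewrite tr_scalar_mx.
by rewrite -scalemx1 bformZ mulr_gt0 ?bform1_gt0.
Qed.

Lemma psdZ c A : 0 <= c -> psd A -> psd (c *: A).
Proof.
move=> c0 [sA pA]; split=> [|x]; first by rewrite linearZ/= sA.
by rewrite bformZ mulr_ge0.
Qed.

Lemma psd_rank1 v : psd (v *m v^T).
Proof.
split=> [|x]; first by rewrite trmx_mul trmxK.
by rewrite bform_rank1 -expr2 sqr_ge0.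
Qed.

Lemma posdef_unit A : posdef A -> A \in unitmx.
Proof.
case=> sA pA; rewrite unitmxE unitfE; apply/det0P => -[v v0 vA].
have vT0 : v^T != 0 by rewrite -trmx0 (inj_eq trmx_inj).
by have := pA _ vT0; rewrite /bform trmxK vA mul0mx mxE ltxx.
Qed.

Lemma psd_CS A x y : psd A -> bform A x y ^+ 2 <= bform A x x * bform A y y.
Proof.
move=> [sA pA]; set a := bform A x x; set b := bform A x y; set c := bform A y y.
have H t : 0 <= a + 2 * t * b + t ^+ 2 * c.
  have := pA (x + t *: y); rewrite bformDl !bformDr !bformZl !bformZr.
  by rewrite (bformC y x sA) -/a -/b -/c; nra.
have a0 : 0 <= a := pA x.
have [c0|c0] := eqVneq c 0.
  have [->|b0] := eqVneq b 0; first by rewrite c0 expr0n/= mulr0.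
  (* With [c] zero the quadratic is affine in [t], and this [t] makes it equal to -1. *)
  have := H (- (a + 1) / (2 * b)); rewrite c0 mulr0 addr0.
  have -> : 2 * (- (a + 1) / (2 * b)) * b = - (a + 1) by field.
  by lra.
have cp : 0 < c by rewrite lt0r c0 pA.
have := H (- b / c).
have -> : a + 2 * (- b / c) * b + (- b / c) ^+ 2 * c = (a * c - b ^+ 2) / c by field.
by rewrite pmulr_lge0 ?invr_gt0// subr_ge0.
Qed.

Lemma posdef_conj A C : posdef A -> C \in unitmx -> posdef (C^T *m A *m C).
Proof.
move=> [sA pA] uC; split=> [|x x0]; first by rewrite !trmx_mul trmxK sA mulmxA.
rewrite bform_conj pA//; apply: contra x0 => /eqP Cx.
by rewrite -[x]mul1mx -(mulVmx uC) -mulmxA Cx mulmx0.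
Qed.

Lemma psd_conj A C : psd A -> psd (C^T *m A *m C).
Proof.
move=> [sA pA]; split=> [|x]; first by rewrite !trmx_mul trmxK sA mulmxA.
by rewrite bform_conj.
Qed.

Lemma trmx_invmx A : A^T = A -> (invmx A)^T = invmx A.
Proof. by move=> sA; rewrite trmx_inv sA. Qed.

Lemma posdef_inv A : posdef A -> posdef (invmx A).
Proof.
move=> pA; have uA := posdef_unit pA.
have uAi : invmx A \in unitmx by rewrite unitmx_inv.
by have := posdef_conj pA uAi; rewrite (trmx_invmx pA.1) mulVmx// mul1mx.
Qed.

Lemma psd_diag_ge0 A i : psd A -> 0 <= A i i.
Proof.
case=> _ /(_ (delta_mx i 0)); rewrite /bform trmx_delta -rowE -colE !mxE.
by [].
Qed.

Lemma posdef_diag_gt0 A i : posdef A -> 0 < A i i.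
Proof.
case=> _ /(_ (delta_mx i 0)); rewrite /bform trmx_delta -rowE -colE !mxE.
apply; apply/eqP => /matrixP/(_ i 0); rewrite !mxE !eqxx => /eqP.
by rewrite oner_eq0.
Qed.

(** Replaces the bound of the largest eigenvalue by the trace. The form is nonnegative at x_j e_i -
    x_i e_j; summing this over all pairs (i, j) gives twice the claim. *)
Lemma psd_le_trace A x : psd A -> bform A x x <= \tr A * bform 1%:M x x.
Proof.
move=> [sA pA].
have H i j : 0 <= A i i * x j 0 ^+ 2 - 2 * (x i 0 * A i j * x j 0) + A j j * x i 0 ^+ 2.
  have := pA (x j 0 *: delta_mx i 0 - x i 0 *: delta_mx j 0).
  have E k l : bform A (delta_mx k 0) (delta_mx l 0) = A k l.
    by rewrite /bform trmx_delta -rowE -colE !mxE.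
  have Aji : A j i = A i j by rewrite -{1}sA mxE.
  rewrite bformDl !bformDr -!scaleNr !bformZl !bformZr !E Aji.
  by move=> h; apply: (le_trans h); lra.
have : 0 <= \sum_i \sum_j
    (A i i * x j 0 ^+ 2 - 2 * (x i 0 * A i j * x j 0) + A j j * x i 0 ^+ 2).
  by apply: sumr_ge0 => i _; apply: sumr_ge0 => j _; exact: H.
under eq_bigr do rewrite big_split sumrB/=.
rewrite big_split sumrB/= bformE bform1 /mxtrace.
have -> : \sum_i \sum_j A i i * x j 0 ^+ 2 = (\sum_i A i i) * \sum_i x i 0 ^+ 2.
  by rewrite mulr_suml; apply: eq_bigr => i _; rewrite mulr_sumr.
have -> : \sum_i \sum_j A j j * x i 0 ^+ 2 = (\sum_i A i i) * \sum_i x i 0 ^+ 2.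
  by rewrite exchange_big mulr_suml; apply: eq_bigr => i _; rewrite mulr_sumr.
have -> : \sum_i \sum_j 2 * (x i 0 * A i j * x j 0) =
    2 * \sum_i \sum_j x i 0 * A i j * x j 0.
  by rewrite mulr_sumr; apply: eq_bigr => i _; rewrite mulr_sumr.
lra.
Qed.

Lemma psd_trace_ge0 A : psd A -> 0 <= \tr A.
Proof. by move=> pA; apply: sumr_ge0 => i _; exact: psd_diag_ge0. Qed.

Lemma posdef_trace_gt0 A : (0 < m)%N -> posdef A -> 0 < \tr A.
Proof.
move=> m0 pA; rewrite /mxtrace (bigD1 (Ordinal m0))//= ltr_wpDr ?posdef_diag_gt0//.
by apply: sumr_ge0 => i _; apply/ltW/posdef_diag_gt0.
Qed.

Lemma resolvent_identity A c : posdef A -> posdef (A + c%:M) ->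
  invmx A - invmx (A + c%:M) = c *: (invmx A *m invmx (A + c%:M)).
Proof.
move=> /posdef_unit uA /posdef_unit uB.
have -> : invmx A - invmx (A + c%:M) =
    invmx A *m ((A + c%:M) - A) *m invmx (A + c%:M).
  by rewrite mulmxBr mulmxBl mulVmx// mul1mx -mulmxA mulmxV// mulmx1.
by rewrite addrC addKr -scalemx1 -scalemxAr mulmx1 scalemxAl.
Qed.

Lemma resolvent_comm A c : posdef A -> posdef (A + c%:M) ->
  invmx A *m invmx (A + c%:M) = invmx (A + c%:M) *m invmx A.
Proof.
move=> pA pB; have [uA uB] := (posdef_unit pA, posdef_unit pB).
have E : A *m (A + c%:M) = (A + c%:M) *m A.
  by rewrite mulmxDl mulmxDr scalar_mxC.
have u1 : A *m (A + c%:M) \in unitmx by rewrite unitmx_mul uA uB.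
apply: (can_inj (mulKmx u1)); rewrite {1}E -!mulmxA.
rewrite (mulmxA A) mulmxV// mul1mx mulmxV//.
by rewrite (mulmxA (A + c%:M)) mulmxV// mul1mx mulmxV.
Qed.

Lemma sherman_morrison X v c : posdef X -> 1 + c * bform (invmx X) v v != 0 ->
  X + c *: (v *m v^T) \in unitmx ->
  invmx (X + c *: (v *m v^T)) = invmx X -
   (c / (1 + c * bform (invmx X) v v)) *: (invmx X *m v *m v^T *m invmx X).
Proof.
move=> pX; set P := invmx X; set s := bform P v v => s0 uX.
have uX0 := posdef_unit pX.
apply: (can_inj (mulKmx uX)); rewrite mulmxV//.
have vPv : v^T *m P *m v = s%:M.
  by rewrite [LHS]mx11_scalar.
rewrite mulmxBr !mulmxDl mulmxV// -!scalemxAr -!scalemxAl.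
have -> : X *m (P *m v *m v^T *m P) = v *m v^T *m P.
  by rewrite !mulmxA mulmxV// mul1mx.
have -> : v *m v^T *m (P *m v *m v^T *m P) = s *: (v *m v^T *m P).
  rewrite -(mulmxA v) !(mulmxA v^T) vPv -!mulmxA mul_scalar_mx -scalemxAr.
  by rewrite mulmxA.
rewrite !scalerA -addrA -scalerDl -scalerBl.
set k := (X in X *: _); have -> : k = 0 by rewrite /k; field.
by rewrite scale0r addr0.
Qed.
End quadratic_forms.

(** * One rank-one update against a shifted barrier *)

Section barrier_steps.
Context {R : realFieldType}.

Lemma trace_mul_rank1 m (P : 'M[R]_m) (v : 'cV[R]_m) :
  \tr (P *m (v *m v^T)) = bform P v v.
Proof. by rewrite mulmxA mxtrace_mulC mulmxA /mxtrace big_ord1. Qed.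

(** Lowering [X] by [delta] raises the potential [\tr (invmx X)]; the value of [L] at [a] tells how
    heavy an update along [a] must be to undo this. The trace of [L] is the average of that value
    over an isotropic [a], so a lower bound on the trace is what the selection needs. *)
Lemma lower_barrier_step m (X : 'M[R]_m) (alpha delta : R) :
  (0 < m)%N -> posdef X -> \tr (invmx X) <= alpha -> 0 < delta ->
  delta * alpha < 1 ->
  exists2 L : 'M[R]_m, delta^-1 - alpha <= \tr L &
    forall a w, 0 < w -> w^-1 <= bform L a a ->
      posdef (X - delta%:M + w *: (a *m a^T)) /\
      \tr (invmx (X - delta%:M + w *: (a *m a^T))) <= alpha.
Proof.
move=> m0 pX trX d0 da; set Y := X - delta%:M; set P := invmx X.
have pP : posdef P := posdef_inv pX.
have trP0 : 0 < \tr P := posdef_trace_gt0 m0 pP.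
have uX := posdef_unit pX.
have dP1 : delta * \tr P < 1 by apply: le_lt_trans da; rewrite ler_pM2l.
have XE : X = Y + delta%:M by rewrite /Y subrK.
(* Cauchy-Schwarz for [X] at [x] and [P *m x], with P <= (tr P) 1, gives |x|^2 <= tr P X(x, x); as
   delta tr P < 1, the shift by [delta] stays below [X]. *)
have pY : posdef Y.
  split=> [|x x0]; first by rewrite /Y linearB/= pX.1 tr_scalar_mx.
  have n0 := bform1_gt0 x0.
  have : bform 1%:M x x <= \tr P * bform X x x.
    have h1 := psd_CS x (P *m x) (posdef_psd pX).
    have e1 : bform X x (P *m x) = bform 1%:M x x.
      by rewrite /bform -!mulmxA (mulmxA X) mulmxV// !mul1mx.
    have e2 : bform X (P *m x) (P *m x) = bform P x x.
      by rewrite -bform_conj pP.1 /P mulVmx// mul1mx.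
    rewrite e1 e2 in h1.
    have h2 := psd_le_trace x (posdef_psd pP).
    have Xx := pX.2 x x0.
    set n := bform 1%:M x x in n0 h1 h2 *.
    have : n * n <= n * (\tr P * bform X x x).
      rewrite -expr2 (le_trans h1)// [leRHS]mulrA [leRHS]mulrC ler_pM2l//.
      by rewrite mulrC.
    by rewrite ler_pM2l.
  rewrite /Y bformD bformN -(scalemx1 _ delta) bformZ subr_gt0 => h.
  rewrite -(ltr_pM2l trP0) (lt_le_trans _ h)// mulrCA mulrA.
  by rewrite gtr_pMl.
have uY := posdef_unit pY.
set Q := invmx Y; have pQ : posdef Q := posdef_inv pY.
have pX' : posdef (Y + delta%:M) by rewrite -XE.
have res : Q - P = delta *: (Q *m P).
  by have := resolvent_identity pY pX'; rewrite -XE.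
have QP : Q *m P = P *m Q by have := resolvent_comm pY pX'; rewrite -XE.
pose s := \tr (P *m Q); pose z := \tr (Q *m P *m Q).
pose kappa := \tr Q - \tr P.
have kE : kappa = delta * s.
  by rewrite /kappa -linearB/= res linearZ/= QP.
have PQE : P *m Q = P^T *m 1%:M *m P + delta *: (P^T *m Q *m P).
  have QE : Q = P + delta *: (Q *m P) by rewrite -res addrC subrK.
  by rewrite {1}QE pP.1 mulmx1 mulmxDr -scalemxAr mulmxA.
have s0 : 0 < s.
  rewrite /s PQE; apply: (posdef_trace_gt0 m0); apply: posdefD.
    apply: posdef_conj; first exact: posdef_scalar.
    exact: posdef_unit pP.
  by apply/psdZ/psd_conj/posdef_psd => //; exact: ltW.
have k0 : 0 < kappa by rewrite kE mulr_gt0.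
(* Cauchy-Schwarz for the form (Y, Z) |-> tr (Y^T P Z), applied to 1 and Q *)
have zs : delta * s ^+ 2 <= z.
  pose t := delta * s.
  have pt := psd_trace_ge0 (psd_conj (t%:M - Q) (posdef_psd pP)).
  have : \tr ((t%:M - Q)^T *m P *m (t%:M - Q)) = t ^+ 2 * \tr P - 2 * t * s + z.
    have -> : (t%:M - Q)^T = t%:M - Q by rewrite linearB/= tr_scalar_mx pQ.1.
    have -> : (t%:M - Q) *m P *m (t%:M - Q) =
        t ^+ 2 *: P - t *: (P *m Q) - t *: (P *m Q) + Q *m P *m Q.
      rewrite mulmxBl !mulmxBr !mulmxBl !mul_scalar_mx !mul_mx_scalar QP.
      by rewrite -scalemxAl scalerA -expr2 opprB addrA addrAC.
    by rewrite !(linearD, linearN, linearZ)/= -/s -/z; ring.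
  move=> E; rewrite E in pt.
  have : t ^+ 2 * \tr P <= delta * s ^+ 2.
    rewrite (_ : t ^+ 2 * \tr P = (delta * \tr P) * (delta * s ^+ 2)).
      by rewrite ler_piMl ?ltW// mulr_gt0// exprn_gt0.
    by rewrite /t; ring.
  move: pt; rewrite /t; lra.
(* By Sherman-Morrison the update lowers the potential by w S / (1 + w r), with S = Q^2(a, a) and r
   = Q(a, a). This makes up for the increase [kappa] exactly when S / kappa - r >= 1 / w. The bound
   on the trace reduces to [zs]. *)
exists (kappa^-1 *: (Q *m Q) - Q).
  rewrite linearB linearZ/=.
  have -> : \tr (Q *m Q) = s + delta * z.
    have QE : Q = P + delta *: (Q *m P) by rewrite -res addrC subrK.
    by rewrite {1}QE mulmxDl -scalemxAl linearD linearZ.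
  have -> : \tr Q = \tr P + kappa by rewrite /kappa addrC subrK.
  have : delta^-1 + kappa <= kappa^-1 * (s + delta * z).
    rewrite ler_pdivlMl// kE.
    have -> : delta * s * (delta^-1 + delta * s) = s + delta * (delta * s ^+ 2).
      by field; rewrite gt_eqF.
    by rewrite lerD2l ler_pM2l.
  lra.
move=> a w w0; rewrite bformD bformN bformZ => hw.
have pYw : posdef (Y + w *: (a *m a^T)).
  by apply: posdefD => //; apply: psdZ; [exact: ltW|exact: psd_rank1].
split=> //.
have q0 : 0 <= bform Q a a := (posdef_psd pQ).2 a.
have sm0 : 0 < 1 + w * bform Q a a by rewrite ltr_wpDr// mulr_ge0// ltW.
rewrite sherman_morrison ?gt_eqF//; last exact: posdef_unit.
rewrite linearB linearZ/= -/Q.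
have -> : \tr (Q *m a *m a^T *m Q) = bform (Q *m Q) a a.
  by rewrite mxtrace_mulC !mulmxA -(mulmxA (Q *m Q)) trace_mul_rank1.
set S := bform (Q *m Q) a a in hw *; set r := bform Q a a in hw q0 sm0 *.
apply: le_trans trX; rewrite -/P.
have -> : \tr P = \tr Q - kappa by rewrite /kappa opprB addrC subrK.
rewrite lerD2l lerN2 mulrAC ler_pdivlMr//.
have : (w^-1 + r) * kappa <= S by rewrite -ler_pdivlMr// mulrC; lra.
rewrite -(ler_pM2l w0); apply: le_trans; rewrite le_eqVlt; apply/orP; left.
by apply/eqP; field; rewrite gt_eqF.
Qed.

(** The trace of [X] against the diagonal matrix of [d], that is, the mean of the form at a random
    vector with covariance diag(d). The sum of [d] stays under control where the dimension [M] does
    not. *)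
Definition wtrace M (d : 'I_M -> R) (X : 'M[R]_M) : R := \sum_i d i * X i i.

Lemma wtraceD M (d : 'I_M -> R) X Y : wtrace d (X + Y) = wtrace d X + wtrace d Y.
Proof. by rewrite -big_split/=; apply: eq_bigr => i _; rewrite mxE mulrDr. Qed.

Lemma wtraceZ M (d : 'I_M -> R) c X : wtrace d (c *: X) = c * wtrace d X.
Proof. by rewrite mulr_sumr; apply: eq_bigr => i _; rewrite mxE mulrCA. Qed.

Lemma wtrace_ge0 M (d : 'I_M -> R) X :
  (forall i, 0 <= d i) -> psd X -> 0 <= wtrace d X.
Proof. by move=> d0 pX; apply: sumr_ge0 => i _; rewrite mulr_ge0// psd_diag_ge0. Qed.

Lemma wtrace_tr M (d : 'I_M -> R) X :
  wtrace d X = \tr (X *m diag_mx (\row_i d i)).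
Proof.
apply: eq_bigr => i _; rewrite mul_mx_diag mxE mulrC mxE.
by [].
Qed.

(** Mirror image of the lower step: raising [X] by [delta] lowers the weighted potential, which
    leaves room to subtract w v v^T as long as 1 / w exceeds the value of [U] at [v]. The bound on
    [wtrace d U] is free of the dimension [M]. *)
Lemma upper_barrier_step M (d : 'I_M -> R) (X : 'M[R]_M) (gamma delta : R) :
  (forall i, 0 <= d i <= 1) -> (exists i, 0 < d i) ->
  posdef X -> wtrace d (invmx X) <= gamma -> 0 < delta ->
  exists U : 'M[R]_M, [/\ wtrace d U <= delta^-1 + gamma, psd U &
    forall v w, 0 < w -> bform U v v < w^-1 ->
      posdef (X + delta%:M - w *: (v *m v^T)) /\
      wtrace d (invmx (X + delta%:M - w *: (v *m v^T))) <= gamma].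
Proof.
move=> d01 [i0 di0] pX trX de0.
have d0 i : 0 <= d i by case/andP: (d01 i).
have d1 i : d i <= 1 by case/andP: (d01 i).
set Y := X + delta%:M; set P := invmx X; set Q := invmx Y.
have pY : posdef Y by apply: posdefD => //; exact/posdef_psd/posdef_scalar.
have pP : posdef P := posdef_inv pX; have pQ : posdef Q := posdef_inv pY.
have uQ := posdef_unit pQ.
have res : P - Q = delta *: (P *m Q) := resolvent_identity pX pY.
have QP : P *m Q = Q *m P := resolvent_comm pX pY.
pose D := diag_mx (\row_i d i).
have pD : psd D.
  split=> [|x]; first by rewrite tr_diag_mx.
  rewrite bformE sumr_ge0// => i _; rewrite sumr_ge0// => j _.
  rewrite !mxE; have [->|] := eqVneq i j; last by rewrite mulr0n mulr0 mul0r.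
  by rewrite mulr1n mulrC mulrA -expr2 mulr_ge0// sqr_ge0.
pose eta := wtrace d P - wtrace d Q.
have PQE : P *m Q = Q^T *m 1%:M *m Q + delta *: (Q^T *m P *m Q).
  have PE : P = Q + delta *: (P *m Q) by rewrite -res addrC subrK.
  by rewrite {1}PE pQ.1 mulmx1 mulmxDl -scalemxAl QP.
have etaE : eta = delta * wtrace d (P *m Q).
  by rewrite /eta -wtraceZ -res wtraceD -[- Q]scaleN1r wtraceZ mulN1r.
have pPQ : posdef (P *m Q).
  rewrite PQE; apply: posdefD; first exact/posdef_conj/uQ/posdef_scalar.
  by apply/psdZ/psd_conj/posdef_psd => //; exact: ltW.
have eta0 : 0 < eta.
  rewrite etaE mulr_gt0// /wtrace (bigD1 i0)//= ltr_wpDr//.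
    by apply: sumr_ge0 => i _; rewrite mulr_ge0// psd_diag_ge0//; exact: posdef_psd.
  by rewrite mulr_gt0// posdef_diag_gt0.
pose W := Q^T *m D *m Q; have pW : psd W := psd_conj Q pD.
(* tr(D Q D Q) <= tr(D Q^2) because d <= 1, and Q^2 <= P Q. The right side is eta / delta, so the
   first summand of [U] has weighted trace at most 1 / delta. *)
have WQ : wtrace d W <= wtrace d (P *m Q).
  rewrite PQE wtraceD ler_wpDr//.
    rewrite wtraceZ; apply: mulr_ge0; first exact: ltW.
    apply: wtrace_ge0 => //.
    exact/psd_conj/posdef_psd.
  apply: ler_sum => i _; rewrite ler_wpM2l// /W mulmx1 -[Q^T *m D]/(mulmx _ _).
  rewrite mul_mx_diag !mxE; apply: ler_sum => j _; rewrite !mxE mulrAC.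
  by rewrite ler_piMr// -expr2 sqr_ge0.
have QPw : wtrace d Q <= wtrace d P by rewrite -subr_ge0 ltW.
(* The subtraction raises the potential by w S / (1 - w r), with S = W(v, v) and r = Q(v, v); this
   stays within the gain [eta] as soon as S / eta + r <= 1 / w. *)
exists (eta^-1 *: W + Q); split.
- rewrite wtraceD wtraceZ lerD//; last exact: le_trans QPw trX.
  by rewrite ler_pdivrMl// etaE mulrAC mulfV ?gt_eqF// mul1r.
- apply: posdef_psd; rewrite addrC; apply: posdefD => //.
  by apply: psdZ => //; rewrite invr_ge0 ltW.
move=> v w w0; rewrite bformD bformZ => hw.
set r := bform Q v v in hw *; set S := bform W v v in hw.
have S0 : 0 <= S := pW.2 v.
have r0 : 0 <= r := (posdef_psd pQ).2 v.
have eS : 0 <= eta^-1 * S by rewrite mulr_ge0// invr_ge0 ltW.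
have wr : w * r < 1.
  by rewrite mulrC -ltr_pdivlMr// div1r; apply: le_lt_trans hw; rewrite lerDr.
(* Cauchy-Schwarz for [Y] at [x] and [Q *m v] gives (v^T x)^2 <= r Y(x, x), so w r < 1 keeps the
   form positive. *)
have pYw : posdef (Y - w *: (v *m v^T)).
  split=> [|x x0].
    by rewrite linearB linearZ/= trmx_mul trmxK pY.1.
  rewrite bformD bformN bformZ bform_rank1 subr_gt0 -expr2.
  have uY := posdef_unit pY.
  have := psd_CS x (Q *m v) (posdef_psd pY).
  have -> : bform Y (Q *m v) (Q *m v) = r.
    by rewrite -bform_conj pQ.1 /Q mulVmx// mul1mx.
  have -> : bform Y x (Q *m v) = (v^T *m x) 0 0.
    rewrite /bform -!mulmxA (mulmxA Y) mulmxV// !mul1mx.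
    by rewrite -[x^T *m v]trmxK trmx_mul trmxK mxE.
  move=> h; have Yx := pY.2 x x0.
  apply: (@le_lt_trans _ _ (w * (bform Y x x * r))); first by rewrite ler_pM2l.
  by rewrite mulrCA gtr_pMr.
split=> //.
rewrite -scaleNr sherman_morrison//; last 2 first.
- by rewrite mulNr gt_eqF// subr_gt0.
- by rewrite scaleNr posdef_unit.
rewrite -/Q -/r mulNr wtraceD -scaleNr wtraceZ.
have -> : wtrace d (Q *m v *m v^T *m Q) = S.
  rewrite wtrace_tr -/D -(mulmxA _ Q D) mxtrace_mulC -(mulmxA Q v).
  by rewrite (mulmxA (Q *m D)) trace_mul_rank1 /S /W pQ.1.
apply: le_trans trX; rewrite -/P -[wtrace d P](subrK (wtrace d Q)) -/eta.
rewrite opprK mulNr addrC lerD2r mulrAC ler_pdivrMr ?subr_gt0//.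
have : S <= eta * (w^-1 - r).
  by rewrite -ler_pdivrMl//; lra.
rewrite -(ler_pM2l w0) => /le_trans; apply; rewrite le_eqVlt; apply/orP; left.
by apply/eqP; field; rewrite gt_eqF.
Qed.

End barrier_steps.

(** * Selecting nodes and weights one at a time *)

Section barrier_selection.
Context {R : realFieldType} {T : Type} {m M : nat}.
Variables (a : T -> 'cV[R]_m) (v : T -> 'cV[R]_M) (d : 'I_M -> R) (N : nat).
Hypotheses (d01 : forall i, 0 <= d i <= 1) (d_gt0 : exists i, 0 < d i).
Hypotheses (m_gt0 : (0 < m)%N) (mN : m%:R <= N%:R / 8 :> R).
Hypothesis dN : \sum_i d i <= N%:R / 8.
(** Abstracts averaging over a probability measure under which [a] has covariance 1 and [v] has
    covariance diag(d): the two forms then have means [\tr P] and [wtrace d Q]. *)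
Hypothesis mean : forall (P : 'M[R]_m) (Q : 'M[R]_M),
  wtrace d Q < \tr P -> exists t, bform Q (v t) (v t) < bform P (a t) (a t).

Let N_gt0 : 0 < N%:R :> R.
Proof. by have m0 : 0 < m%:R :> R; [rewrite ltr0n|move: mN m0; lra]. Qed.

Let A (s : seq (T * R)) : 'M[R]_m := \sum_(p <- s) p.2 *: (a p.1 *m (a p.1)^T).
Let B (s : seq (T * R)) : 'M[R]_M := \sum_(p <- s) p.2 *: (v p.1 *m (v p.1)^T).

(** The lower barrier starts at -1 and moves by 2 / N, the upper one starts at 8 with 8 - B positive
    and moves by 8 / N, so that after [N] steps they stand at 1 and 16. The potentials stay within
    the budgets [m] and N / 8. *)
Let iterate n : exists s : seq (T * R), [/\ size s = n, all (fun p => 0 <= p.2) s,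
  let X := A s + (1 - n%:R * (2 / N%:R))%:M in
  posdef X /\ \tr (invmx X) <= m%:R &
  let Y := (8 + n%:R * (8 / N%:R))%:M - B s in
  posdef Y /\ wtrace d (invmx Y) <= N%:R / 8].
Proof.
elim: n => [|n [s [sz s0 [pX trX] [pY trY]]]].
  exists [::]; split=> //; rewrite /A /B !big_nil !mul0r.
    rewrite add0r subr0; split; first exact: posdef_scalar.
    by rewrite invmx1 mxtrace1.
  rewrite subr0 addr0; split; first exact: posdef_scalar.
  rewrite invmx_scalar wtrace_tr mul_scalar_mx linearZ/= mxtrace_diag.
  rewrite (eq_bigr d); last by move=> i _; rewrite mxE.
  rewrite ler_pdivrMl//; have := dN; have n0 := N_gt0; lra.
have dl : 0 < 2 / N%:R :> R by rewrite divr_gt0.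
have du : 0 < 8 / N%:R :> R by rewrite divr_gt0.
have dlm : 2 / N%:R * m%:R < 1 :> R.
  by rewrite mulrAC ltr_pdivrMr//; move: mN N_gt0; lra.
have [L trL HL] := lower_barrier_step m_gt0 pX trX dl dlm.
have [U [trU pU HU]] := upper_barrier_step d01 d_gt0 pY trY du.
(* Here wtrace U <= N / 8 + N / 8, whereas tr L >= N / 2 - m >= 3 N / 8, so averaging yields [t]. *)
have [t ht] : exists t, bform U (v t) (v t) < bform L (a t) (a t).
  apply: mean; apply: le_lt_trans trU _; apply: lt_le_trans trL.
  by rewrite !invf_div; move: mN N_gt0; lra.
have w0 : 0 < bform L (a t) (a t) by apply: le_lt_trans ht; exact: pU.2.
(* The lightest weight that the lower barrier accepts; the strict inequality at [t] makes it
   admissible for the upper barrier. *)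
pose w := (bform L (a t) (a t))^-1.
have wp : 0 < w by rewrite invr_gt0.
have [pX' trX'] := HL (a t) w wp (eq_ind_r (fun z => z <= _) (lexx _) (invrK _)).
have [pY' trY'] := HU (v t) w wp (eq_ind_r (fun z => _ < z) ht (invrK _)).
exists ((t, w) :: s); split=> /=; first by rewrite sz.
- by rewrite s0 ltW.
- rewrite /A big_cons/= -/(A s).
  have -> : w *: (a t *m (a t)^T) + A s + (1 - n.+1%:R * (2 / N%:R))%:M =
     A s + (1 - n%:R * (2 / N%:R))%:M - (2 / N%:R)%:M + w *: (a t *m (a t)^T).
    rewrite -addrA addrC -!addrA; congr (_ + _); rewrite addrA; congr (_ + _).
    by rewrite -raddfB/=; congr _%:M; rewrite -natr1; ring.
  by [].
rewrite /B big_cons/= -/(B s).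
have -> : (8 + n.+1%:R * (8 / N%:R))%:M - (w *: (v t *m (v t)^T) + B s) =
   (8 + n%:R * (8 / N%:R))%:M - B s + (8 / N%:R)%:M - w *: (v t *m (v t)^T).
  have -> : (8 + n.+1%:R * (8 / N%:R))%:M =
      (8 + n%:R * (8 / N%:R))%:M + (8 / N%:R)%:M :> 'M[R]_M.
    by rewrite -raddfD/=; congr _%:M; rewrite -natr1; ring.
  by rewrite opprD [- _ - _]addrC !addrA; congr (_ - _); rewrite addrAC.
by [].
Qed.

Theorem weighted_selection : exists (x : 'I_N -> T) (w : 'I_N -> R),
  [/\ forall i, 0 <= w i,
      forall c : 'cV[R]_m,
        \sum_k c k 0 ^+ 2 <= \sum_i w i * ((a (x i))^T *m c) 0 0 ^+ 2 &
      forall b : 'cV[R]_M,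
        \sum_i w i * ((v (x i))^T *m b) 0 0 ^+ 2 <= 16 * \sum_k b k 0 ^+ 2].
Proof.
have [s [/eqP sz s0 [pX _] [pY _]]] := iterate N.
pose S := Tuple sz.
have N0 : N%:R != 0 :> R by rewrite gt_eqF.
have e1 : 1 - N%:R * (2 / N%:R) = -1 :> R by field.
have e2 : 8 + N%:R * (8 / N%:R) = 16 :> R by field.
rewrite e1 in pX; rewrite e2 in pY.
have sE (F : T * R -> R) : \sum_(p <- s) F p = \sum_i F (tnth S i).
  exact: (big_tuple _ _ S xpredT F).
exists (fun i => (tnth S i).1), (fun i => (tnth S i).2); split.
- by move=> i; move/(all_tnthP (t := S)): s0; exact.
- move=> c; have := (posdef_psd pX).2 c.
  rewrite bformD -scalemx1 bformZ mulN1r subr_ge0 bform1 => /le_trans; apply.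
  rewrite -(sE (fun p => p.2 * ((a p.1)^T *m c) 0 0 ^+ 2)).
  rewrite le_eqVlt; apply/orP; left; apply/eqP.
  rewrite /A /bform mulmx_sumr mulmx_suml summxE; apply: eq_bigr => p _.
  by rewrite -[LHS]/(bform _ c c) bformZ bform_rank1 -expr2.
move=> b; have := (posdef_psd pY).2 b.
rewrite bformD -scalemx1 bformZ bformN subr_ge0 bform1; apply: le_trans.
rewrite -(sE (fun p => p.2 * ((v p.1)^T *m b) 0 0 ^+ 2)).
rewrite le_eqVlt; apply/orP; left; apply/eqP.
rewrite /B /bform mulmx_sumr mulmx_suml summxE; apply: eq_bigr => p _.
by rewrite -[RHS]/(bform _ b b) bformZ bform_rank1 -expr2.
Qed.
End barrier_selection.

(** [Z] solves the weighted normal equations. Since E Z y is the weighted projection of y, its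
    weighted norm is at most that of y, and by hypothesis it dominates the norm of the coefficients
    Z y. *)
Lemma least_squares (R : realFieldType) (N m : nat) (E : 'M[R]_(N, m)) (w : 'I_N -> R) :
  (forall i, 0 <= w i) ->
  (forall c : 'cV[R]_m, \sum_k c k 0 ^+ 2 <= \sum_i w i * (E *m c) i 0 ^+ 2) ->
  exists2 Z : 'M[R]_(m, N), Z *m E = 1%:M &
    forall y : 'cV[R]_N, \sum_k (Z *m y) k 0 ^+ 2 <= \sum_i w i * y i 0 ^+ 2.
Proof.
move=> w0 hE; pose W := diag_mx (\row_i w i); pose G := E^T *m W *m E.
have WE (x y : 'cV[R]_N) : (x^T *m W *m y) 0 0 = \sum_i w i * (x i 0 * y i 0).
  rewrite -mulmxA mxE; apply: eq_bigr => i _.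
  by rewrite mul_diag_mx !mxE mulrCA.
have GE c : bform G c c = \sum_i w i * (E *m c) i 0 ^+ 2.
  rewrite /bform /G !mulmxA -trmx_mul -(mulmxA _ E c) WE.
  by apply: eq_bigr => i _; rewrite expr2.
have pG : posdef G.
  split=> [|c c0]; first by rewrite !trmx_mul trmxK tr_diag_mx mulmxA.
  by rewrite GE (lt_le_trans (bform1_gt0 c0))// bform1.
have uG := posdef_unit pG.
exists (invmx G *m E^T *m W).
  by rewrite -!mulmxA (mulmxA E^T) mulVmx.
move=> y; set c := _ *m y; apply: (le_trans (hE c)).
have : \sum_i w i * (E *m c) i 0 ^+ 2 = \sum_i w i * ((E *m c) i 0 * y i 0).
  have Gc : G *m c = E^T *m W *m y.
    by rewrite /c !mulmxA mulmxV// mul1mx.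
  have cGc : c^T *m G *m c = (E *m c)^T *m W *m y.
    by rewrite -[LHS]mulmxA Gc (trmx_mul E c) !mulmxA.
  by rewrite -GE -WE /bform cGc.
have : 0 <= \sum_i w i * ((E *m c) i 0 - y i 0) ^+ 2.
  by apply: sumr_ge0 => i _; rewrite mulr_ge0// sqr_ge0.
have -> : \sum_i w i * ((E *m c) i 0 - y i 0) ^+ 2 =
    \sum_i w i * (E *m c) i 0 ^+ 2 - 2 * (\sum_i w i * ((E *m c) i 0 * y i 0)) +
    \sum_i w i * y i 0 ^+ 2.
  rewrite mulr_sumr -sumrB -big_split/=; apply: eq_bigr => i _; ring.
lra.
Qed.

Import numFieldNormedType.Exports.
Local Open Scope classical_set_scope.
Local Open Scope ring_scope.

(** * Sums of the logarithmic weights *)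

Section finite_sums.
Context {R : realFieldType}.

Lemma ler_sum_subset (T : eqType) (f : T -> R) (s1 s2 : seq T) :
  (forall x, 0 <= f x) -> uniq s1 -> {subset s1 <= s2} ->
  \sum_(x <- s1) f x <= \sum_(x <- s2) f x.
Proof.
move=> f0 u1 s12; apply: (@le_trans _ _ (\sum_(x <- undup s2) f x)).
  rewrite [leRHS](bigID (mem s1))/= -[leLHS]addr0 lerD ?sumr_ge0//.
  have P : perm_eq s1 [seq x <- undup s2 | x \in s1].
    apply: uniq_perm; rewrite ?filter_uniq ?undup_uniq// => x.
    by rewrite mem_filter mem_undup; have [/s12 ->|] := boolP (x \in s1).
  by rewrite (perm_big _ P)/= big_filter.
elim: s2 {s12} => //= x s IH; case: ifP => _; rewrite !big_cons ?lerD2l//.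
by apply: (le_trans IH); rewrite lerDr.
Qed.

(** All entries that occur in [J] form one finite set [B], so [J] sits inside the grid B^d, over
    which the sum of products factorises. *)
Lemma sum_prod_le (d : nat) (v : 'I_d -> int -> R) (V : 'I_d -> R)
    (J : seq 'rV[int]_d) : uniq J ->
  (forall j z, 0 <= v j z) ->
  (forall j (B : seq int), uniq B -> \sum_(z <- B) v j z <= V j) ->
  \sum_(k <- J) \prod_j v j (k ord0 j) <= \prod_j V j.
Proof.
move=> uJ v0 vV.
pose B : seq int := undup (flatten [seq [seq k ord0 j | j <- enum 'I_d] | k : 'rV[int]_d <- J]).
have BP k j : k \in J -> k ord0 j \in B.
  move=> kJ; rewrite mem_undup; apply/flattenP.
  exists [seq k ord0 j | j <- enum 'I_d]; last by apply: map_f; rewrite mem_enum.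
  by apply/mapP; exists k.
pose h (f : {ffun 'I_d -> seq_sub B}) : 'rV[int]_d := \row_j val (f j).
apply: (@le_trans _ _ (\sum_(k <- map h (index_enum {ffun 'I_d -> seq_sub B}))
    \prod_j v j (k ord0 j))).
  apply: ler_sum_subset => // [k|k kJ]; first exact: prodr_ge0.
  apply/mapP; exists [ffun j => SeqSub (BP k j kJ)]; first exact: mem_index_enum.
  by apply/rowP => j; rewrite mxE ffunE.
rewrite big_map.
under eq_bigr do under eq_bigr do rewrite mxE.
rewrite -(bigA_distr_bigA (fun j (b : seq_sub B) => v j (val b))).
apply: ler_prod => j _; rewrite sumr_ge0//=.
apply: le_trans (vV j B (undup_uniq _)).
rewrite -(big_map (fun b : seq_sub B => val b) xpredT (v j))/=.
apply: ler_sum_subset => // [|z /mapP[b _ ->]]; last exact: valP.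
by rewrite map_inj_uniq ?index_enum_uniq//; exact: val_inj.
Qed.

(** Splitting by sign counts zero in both halves, which only enlarges the bound. *)
Lemma int_sum_le (f : nat -> R) (V : R) (B : seq int) : uniq B ->
  (forall n, 0 <= f n) -> (forall n, \sum_(0 <= i < n) f i <= V) ->
  \sum_(z <- B) f `|z|%N <= V + V.
Proof.
move=> uB f0 fV; pose N := (\max_(z <- B) `|z|%N).+1.
pose B2 := map Posz (iota 0 N) ++ map (fun n => - Posz n) (iota 0 N).
apply: (@le_trans _ _ (\sum_(z <- B2) f `|z|%N)).
  apply: ler_sum_subset => // z zB.
  have zN : `|z|%N \in iota 0 N.
    rewrite mem_iota /= add0n ltnS.
    exact: (@leq_bigmax_seq _ B xpredT (fun z : int => `|z|%N)).
  rewrite mem_cat; apply/orP.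
  have [z0|z0] := leP 0 z; [left|right]; apply/mapP; exists `|z|%N => //.
    by rewrite gez0_abs.
  by rewrite ltz0_abs// opprK.
have fN : \sum_(i <- iota 0 N) f i <= V by have := fV N; rewrite /index_iota subn0.
by rewrite big_cat !big_map/= lerD//; under eq_bigr do rewrite abszN.
Qed.

End finite_sums.

Section log_weight_sums.
Context {R : realType} (beta : R).
Hypothesis hb : 2^-1 < beta.

Definition log_weight1 (n : nat) : R :=
  (1 + n%:R)^-1 * ln (expR 1 + n%:R) `^ (- 2 * beta).
Local Notation u := log_weight1.

Lemma log_weightE d (k : 'rV[int]_d) :
  log_weight hb d k = \prod_j u `|k ord0 j|%N.
Proof. by apply: eq_bigr => j _; rewrite /u natr_absz. Qed.

Let s : R := 2 * beta - 1.
Let g (n : nat) : R := ln (expR 1 + n%:R) `^ (- s).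

Let s_gt0 : 0 < s. Proof. rewrite /s; move: hb; lra. Qed.

Lemma expR1_ge2 : 2 <= expR 1 :> R.
Proof. by have := @expR_ge1Dx R 1; lra. Qed.

Lemma ln_expR1D_ge1 (n : nat) : 1 <= ln (expR 1 + n%:R) :> R.
Proof.
by rewrite -[leLHS](@expRK R) ler_ln ?posrE ?expR_gt0 ?lerDl// ltr_wpDr ?expR_gt0.
Qed.

Lemma log_weight1_gt0 n : 0 < u n.
Proof.
rewrite /u mulr_gt0 ?invr_gt0 ?ltr_wpDr// powR_gt0//.
exact: lt_le_trans (ln_expR1D_ge1 n).
Qed.

Lemma log_weight1_0 : u 0 = 1.
Proof. by rewrite /u !addr0 expRK powR1 invr1 mulr1. Qed.

Lemma log_weight_gt0 d (k : 'rV[int]_d) : 0 < log_weight hb d k.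
Proof. by rewrite log_weightE prodr_gt0// => j _; exact: log_weight1_gt0. Qed.

Lemma log_weight0 d : log_weight hb d 0 = 1.
Proof. by rewrite log_weightE big1// => j _; rewrite mxE log_weight1_0. Qed.

Lemma log_weightN d (k : 'rV[int]_d) : log_weight hb d (- k) = log_weight hb d k.
Proof. by rewrite !log_weightE; apply: eq_bigr => j _; rewrite mxE abszN. Qed.

Let ln_lower (x : R) : 0 < x -> 1 - x^-1 <= ln x.
Proof.
move=> x0; have := @le_ln1Dx R (x^-1 - 1).
by rewrite ltrBrDl subrr invr_gt0 x0 addrC subrK lnV ?posrE// => /(_ isT); lra.
Qed.

(* discrete version of [d/dx (ln x) ^ (- s) = - s (ln x) ^ (- 2 beta) / x] *)
Lemma log_weight1_telescope n : u n.+1 <= expR 1 / s * (g n - g n.+1).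
Proof.
rewrite /u /g.
set e := expR 1; set L := ln (e + n.+1%:R); set L' := ln (e + n%:R).
have L1 : 1 <= L := ln_expR1D_ge1 n.+1; have L'1 : 1 <= L' := ln_expR1D_ge1 n.
have L0 : 0 < L by lra.
have L'0 : 0 < L' by lra.
have e2 : 2 <= e := expR1_ge2.
have n0 : 0 <= n%:R :> R by [].
have nS : n.+1%:R = n%:R + 1 :> R by rewrite natr1.
have en0 : 0 < e + n%:R by lra.
have en10 : 0 < e + n.+1%:R by lra.
have LL' : (e + n.+1%:R)^-1 <= L - L'.
  rewrite -ln_div ?posrE//; apply: le_trans (ln_lower (divr_gt0 en10 en0)).
  rewrite invf_div le_eqVlt; apply/orP; left; apply/eqP.
  by rewrite nS; field; rewrite -nS gt_eqF.
have lr : (L - L') / L <= ln (L / L').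
  apply: le_trans (ln_lower (divr_gt0 L0 L'0)).
  by rewrite invf_div mulrBl divff ?gt_eqF.
have E : L' `^ (- s) - L `^ (- s) = L `^ (- s) * ((L / L') `^ s - 1).
  rewrite mulrBr mulr1; congr (_ - _).
  rewrite /powR !gt_eqF ?divr_gt0// -expRD ln_div ?posrE//; congr expR.
  by ring.
have p : s * ((e + n.+1%:R)^-1 / L) <= (L / L') `^ s - 1.
  rewrite /powR gt_eqF ?divr_gt0//.
  apply: (@le_trans _ _ (s * ln (L / L'))); last by rewrite lerBrDl expR_ge1Dx.
  by rewrite ler_pM2l//; apply: le_trans lr; rewrite ler_pM2r ?invr_gt0.
have -> : L `^ (- 2 * beta) = L `^ (- s) / L.
  rewrite -powR_inv1 ?ltW// -powRD; last by rewrite (gt_eqF L0) implybT.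
  by congr powR; rewrite /s; lra.
rewrite E.
apply: (@le_trans _ _ (e / s * (L `^ (- s) * (s * ((e + n.+1%:R)^-1 / L))))); last first.
  by rewrite ler_pM2l ?divr_gt0 ?expR_gt0// ler_wpM2l ?powR_ge0.
have -> : e / s * (L `^ (- s) * (s * ((e + n.+1%:R)^-1 / L)))
   = e / (e + n.+1%:R) * (L `^ (- s) / L).
  move: (e + n.+1%:R)^-1 (L `^ (- s)) L^-1 => p1 p2 p3.
  by field; rewrite gt_eqF.
apply: ler_wpM2r; first by rewrite divr_ge0 ?powR_ge0// ltW.
have n1 : 0 < 1 + n.+1%:R :> R by lra.
rewrite ler_pdivlMr// mulrC ler_pdivrMr//.
have : 0 <= (e - 1) * n.+1%:R by rewrite mulr_ge0//; lra.
lra.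
Qed.

Lemma log_weight1_tail B n :
  \sum_(0 <= i < n) (if (B < i)%N then u i else 0) <= expR 1 / s * g B.
Proof.
have es0 : 0 <= expR 1 / s by rewrite divr_ge0 ?expR_ge0 ?ltW.
(* [maxn B m] keeps the right side zero until the index passes [B]; from then on each term is
   absorbed by one telescoping difference. *)
suff H m : \sum_(0 <= i < m.+1) (if (B < i)%N then u i else 0)
    <= expR 1 / s * (g B - g (maxn B m)).
  apply: (@le_trans _ _ (\sum_(0 <= i < n.+1) (if (B < i)%N then u i else 0))).
    by rewrite big_nat_recr//= lerDl; case: ifP => // _; exact/ltW/log_weight1_gt0.
  by apply: (le_trans (H n)); rewrite mulrBr gerBl mulr_ge0 ?powR_ge0.
elim: m => [|m IH]; first by rewrite big_nat1 maxn0 subrr mulr0.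
rewrite big_nat_recr//= ltnS; have [Bm|mB] := leqP B m; last first.
  by rewrite addr0 (maxn_idPl mB); move: IH; rewrite (maxn_idPl (ltnW mB)).
apply: (le_trans (lerD IH (log_weight1_telescope m))).
by rewrite (maxn_idPr Bm) (maxn_idPr (leqW Bm)) -mulrDr addrA subrK.
Qed.

Let C1 : R := expR 1 / s.
Let C1_gt0 : 0 < C1. Proof. by rewrite divr_gt0 ?expR_gt0. Qed.

Let Vtot : R := 2 * (1 + C1).

Let g_le1 n : g n <= 1.
Proof.
have L1 := ln_expR1D_ge1 n.
have p1 : 1 <= ln (expR 1 + n%:R) `^ s.
  apply: (@le_trans _ _ (1 `^ s)); first by rewrite powR1.
  by rewrite ge0_ler_powR ?nnegrE ?(le_trans _ L1) ?(ltW s_gt0).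
by rewrite /g powRN invf_le1// (lt_le_trans _ p1).
Qed.

Let int_tail B (X : seq int) : uniq X ->
  \sum_(z <- X) (if (B < `|z|)%N then u `|z|%N else 0) <= 2 * (C1 * g B).
Proof.
move=> uX; rewrite mulr2n mulrDl mul1r.
apply: (int_sum_le (f := fun i => if (B < i)%N then u i else 0)) => //.
  by move=> n; case: ifP => // _; exact/ltW/log_weight1_gt0.
exact: log_weight1_tail.
Qed.

Let int_total (X : seq int) : uniq X -> \sum_(z <- X) u `|z|%N <= Vtot.
Proof.
move=> uX; rewrite /Vtot mulr2n mulrDl mul1r.
apply: (int_sum_le (f := u)) => // [n|n]; first exact/ltW/log_weight1_gt0.
apply: (@le_trans _ _ (\sum_(0 <= i < n.+1) u i)).
  by rewrite big_nat_recr//= lerDl; exact/ltW/log_weight1_gt0.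
rewrite big_nat_recl//= log_weight1_0 lerD2l.
have := log_weight1_tail 0 n.+1; rewrite big_nat_recl//= add0r => /le_trans; apply.
by rewrite ger_pMr ?C1_gt0 ?g_le1.
Qed.

Lemma log_weight_total d (J : seq 'rV[int]_d) : uniq J ->
  \sum_(k <- J) log_weight hb d k <= Vtot ^+ d.
Proof.
move=> uJ; under eq_bigr do rewrite log_weightE.
apply: le_trans (sum_prod_le (v := fun _ z => u `|z|%N) (V := fun=> Vtot) uJ _ _) _.
- by move=> _ z; rewrite ltW// log_weight1_gt0.
- by move=> _ X; exact: int_total.
- by rewrite prodr_const card_ord.
Qed.

(** Union bound over the coordinate that leaves the box: it contributes the one-dimensional tail,
    the other d - 1 coordinates the full one-dimensional sum. The decay in [B] is therefore that of
    dimension one. *)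
Lemma log_weight_tail d B (J : seq 'rV[int]_d) : uniq J ->
  \sum_(k <- J | [exists j, (B < `|k ord0 j|)%N]) log_weight hb d k <=
  d%:R * (2 * C1 * Vtot ^+ d.-1) * g B.
Proof.
move=> uJ.
pose v (i j : 'I_d) (z : int) : R :=
  if i == j then (if (B < `|z|)%N then u `|z|%N else 0) else u `|z|%N.
have v0 i j z : 0 <= v i j z.
  by rewrite /v; do ?case: ifP => _ //; rewrite ltW// log_weight1_gt0.
apply: (@le_trans _ _ (\sum_(k <- J) \sum_i \prod_j v i j (k ord0 j))).
  rewrite big_mkcond; apply: ler_sum => k _; case: ifP => [/existsP[i Bi]|_]; last first.
    by apply: sumr_ge0 => i _; exact: prodr_ge0.
  rewrite log_weightE [leRHS](bigD1 i)//= ler_wpDr//.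
    by apply: sumr_ge0 => i' _; exact: prodr_ge0.
  rewrite le_eqVlt; apply/orP; left; apply/eqP; apply: eq_bigr => j _.
  by rewrite /v; case: eqP => // <-; rewrite Bi.
rewrite exchange_big/=.
have H i : \sum_(k <- J) \prod_j v i j (k ord0 j) <= 2 * (C1 * g B) * Vtot ^+ d.-1.
  apply: le_trans (sum_prod_le (V := fun j => if i == j then 2 * (C1 * g B) else Vtot)
    uJ (v0 i) _) _.
    move=> j X uX; rewrite /v; case: ifP => _; first exact: int_tail.
    exact: int_total.
  rewrite (bigD1 i)//= eqxx (eq_bigr (fun=> Vtot)); last first.
    by move=> j; rewrite eq_sym => /negbTE ->.
  by rewrite prodr_const cardC1 card_ord.
apply: le_trans (ler_sum _ (fun i _ => H i)) _.
rewrite sumr_const card_ord -mulr_natl le_eqVlt; apply/orP; left; apply/eqP; ring.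
Qed.

Lemma box_count d B (J : seq 'rV[int]_d) : uniq J ->
  \sum_(k <- J | ~~ [exists j, (B < `|k ord0 j|)%N]) 1 <= (2 * (B.+1)%:R) ^+ d :> R.
Proof.
move=> uJ.
pose v (j : 'I_d) (z : int) : R := (`|z| <= B)%N%:R.
rewrite big_mkcond/=.
apply: le_trans (le_trans (sum_prod_le (v := v) (V := fun=> 2 * B.+1%:R) uJ _ _) _).
- apply: ler_sum => k _; case: ifP => [|_]; last exact: prodr_ge0.
  rewrite negb_exists => /forallP h; rewrite big1// => j _.
  by have := h j; rewrite -leqNgt /v => ->.
- by move=> j z; rewrite /v.
- move=> j X uX; rewrite mulr2n mulrDl mul1r.
  apply: (int_sum_le (f := fun i => (i <= B)%N%:R)) => // n.
  apply: (@le_trans _ _ (\sum_(0 <= i < n + B.+1) (i <= B)%N%:R)).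
    by rewrite [leRHS](big_cat_nat (n := n))//= ?leq_addr// lerDl sumr_ge0.
  rewrite (big_cat_nat (n := B.+1))//= ?leq_addl//.
  rewrite [X in _ + X]big_nat_cond [X in _ + X]big1 ?addr0; last first.
    by move=> i /andP[/andP[Bi _] _]; rewrite leqNgt Bi.
  rewrite big_nat_cond (eq_bigr (fun=> 1)); last first.
    by move=> i /andP[/andP[_ Bi] _]; rewrite -ltnS Bi.
  by rewrite -big_nat_cond sumr_const_nat subn0.
- by rewrite prodr_const card_ord.
Qed.

(** Inside a box each minimum is at most 1, outside it is bounded through the tail. The tail depends
    on ln B only, so the largest B with B^(2 d) <= N is good enough: the box has O(sqrt N) points
    while ln B is still comparable with ln N. *)
Lemma log_weight_count d : (0 < d)%N ->
  exists2 c : R, 0 < c & exists N0 : nat, forall N, (N0 <= N)%N ->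
  forall J : seq 'rV[int]_d, uniq J ->
  \sum_(k <- J) Num.min 1 (c * N%:R * ln N%:R `^ s * log_weight hb d k) <= N%:R / 8.
Proof.
move=> d0; pose K := d%:R * (2 * C1 * Vtot ^+ d.-1) * (2 * d)%:R `^ s.
have V0 : 0 < Vtot by rewrite /Vtot mulr_gt0// ltr_wpDr// ltW.
have K0 : 0 < K.
  have d20 : 0 < (2 * d)%:R :> R by rewrite ltr0n muln_gt0.
  apply: mulr_gt0; last exact: powR_gt0.
  apply: mulr_gt0; first by rewrite ltr0n.
  by apply: mulr_gt0; [exact: mulr_gt0|exact: exprn_gt0].
(* With this constant the estimate outside the box comes out as exactly N / 16. *)
exists (16 * K)^-1; first by rewrite invr_gt0 mulr_gt0.
(* This makes sqrt N at least 16 4^d, so that the box count 4^d B^d <= 4^d sqrt N is at most N /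
   16. *)
exists (maxn 3 ((16 * 4 ^ d) ^ 2)) => N; rewrite geq_max => /andP[N3 N4] J uJ.
have exB : exists B, (B ^ (2 * d) <= N)%N by exists 0%N; rewrite exp0n// muln_gt0.
have ubB B : (B ^ (2 * d) <= N)%N -> (B <= N)%N.
  by apply: leq_trans; rewrite -{1}[B]expn1; case: (B) => // B'; rewrite leq_pexp2l// muln_gt0.
case: (ex_maxnP exB ubB) => B hB maxB.
have B0 : (0 < B)%N by apply: maxB; rewrite exp1n; lia.
have NB : (N < B.+1 ^ (2 * d))%N.
  by rewrite ltnNge; apply/negP => /maxB; rewrite ltnn.
rewrite (bigID (fun k : 'rV[int]_d => [exists j, (B < `|k ord0 j|)%N]))/=.
have -> : N%:R / 8 = N%:R / 16 + N%:R / 16 :> R by field.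
have N0 : 0 < N%:R :> R by rewrite ltr0n; lia.
have lnN : 0 < ln N%:R :> R by rewrite ln_gt0// ltr1n; lia.
set T := _ * _ * _; have T0 : 0 < T by rewrite /T !mulr_gt0 ?powR_gt0// invr_gt0 mulr_gt0.
apply: lerD.
  apply: (@le_trans _ _ (T * \sum_(k <- J | [exists j, (B < `|k ord0 j|)%N]) log_weight hb d k)).
    by rewrite mulr_sumr; apply: ler_sum => k _; rewrite ge_min lexx orbT.
  apply: le_trans (ler_wpM2l (ltW T0) (log_weight_tail B uJ)) _.
  have gB : g B <= (2 * d)%:R `^ s * ln N%:R `^ (- s).
    have lB : ln N%:R <= (2 * d)%:R * ln (expR 1 + B%:R) :> R.
      have eB : 0 < expR 1 + B%:R :> R by rewrite ltr_wpDr ?expR_gt0.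
      rewrite mulr_natl -lnXn// ler_ln ?posrE ?exprn_gt0//.
      apply: (@le_trans _ _ (B.+1 ^ (2 * d))%:R); first by rewrite ler_nat ltnW.
      rewrite natrX lerXn2r ?nnegrE ?(ltW eB)//.
      by rewrite -natr1 addrC lerD2r; have := expR1_ge2; lra.
    have lp : 0 < ln (expR 1 + B%:R) :> R by exact: lt_le_trans (ln_expR1D_ge1 B).
    have key : ln N%:R `^ s <= ln (expR 1 + B%:R) `^ s * (2 * d)%:R `^ s :> R.
      rewrite -powRM ?(ltW lp)// mulrC.
      by apply: ge0_ler_powR => //; rewrite ?nnegrE ?mulr_ge0 ?(ltW lp) ?(ltW lnN) ?(ltW s_gt0).
    rewrite /g powRN [X in _ <= _ * X]powRN ler_pdivlMr ?powR_gt0//.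
    by rewrite ler_pdivrMl ?powR_gt0.
  apply: le_trans (ler_wpM2l (ltW T0) (ler_wpM2l _ gB)) _.
    by apply: mulr_ge0 => //; apply: mulr_ge0; [exact/ltW/mulr_gt0|exact/exprn_ge0/ltW].
  rewrite /T powRN le_eqVlt; apply/orP; left; apply/eqP; rewrite /K.
  field.
  by rewrite !gt_eqF// ?exprn_gt0 ?ltr0n// powR_gt0// ltr0n muln_gt0.
apply: (@le_trans _ _ (\sum_(k <- J | ~~ [exists j, (B < `|k ord0 j|)%N]) 1)).
  by apply: ler_sum => k _; rewrite ge_min lexx.
apply: le_trans (box_count B uJ) _.
rewrite ler_pdivlMr// -!(natrM, natrX) ler_nat.
have h1 : ((2 * B.+1) ^ d <= 4 ^ d * B ^ d)%N.
  by rewrite -expnMn leq_exp2r//; lia.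
have h2 : (16 * 4 ^ d * B ^ d <= N)%N.
  rewrite -leq_sqr expnMn -expnM [(d * 2)%N]mulnC -mulnn.
  exact: leq_mul.
by apply: leq_trans h2; rewrite mulnC -mulnA leq_mul2l.
Qed.

(** Take [J0] whose sum is within [eps] of the supremum of all finite sums; a list disjoint from it
    cannot add more. *)
Lemma log_weight_small_tail d (eps : R) : 0 < eps ->
  exists2 J0 : seq 'rV[int]_d, uniq J0 & forall J, uniq J ->
    (forall k, k \in J -> k \notin J0) -> \sum_(k <- J) log_weight hb d k <= eps.
Proof.
move=> e0; pose F := [set \sum_(k <- J) log_weight hb d k | J in [set J | uniq J]].
have supF : has_sup F.
  split; first by exists (\sum_(k <- [::]) log_weight hb d k), [::].
  by exists (Vtot ^+ d) => _ [J /= uJ <-]; exact: log_weight_total.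
have [_ [J0 /= u0 <-] h0] := sup_adherent e0 supF.
exists J0 => // J uJ JJ0.
have : \sum_(k <- J0 ++ J) log_weight hb d k <= sup F.
  apply: ub_le_sup; first exact: supF.2.
  exists (J0 ++ J) => //=; rewrite cat_uniq u0 uJ andbT.
  by apply/hasPn => k /JJ0.
by rewrite big_cat/=; lra.
Qed.

End log_weight_sums.

(** * Integration over the unit cube *)

Section cube_measure.
Context {R : realType}.

Definition cube (d : nat) : set (d.-tuple (measurableTypeR R)) := row_of @^-1` unit_cube.
Arguments cube : clear implicits.

Lemma cubeP d t : cube d t <-> forall j, 0 <= tnth t j <= 1.
Proof.
by rewrite /cube /unit_cube /=; split=> h j; have := h j; rewrite mxE.
Qed.

Lemma measurable_cube d : measurable (cube d).
Proof.
have -> : cube d = \bigcap_(j in [set: 'I_d]) ((@tnth d R ^~ j) @^-1` `[0, 1]).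
  apply/seteqP; split=> t.
    by move=> /cubeP h j _ /=; rewrite in_itv/=.
  by move=> h; apply/cubeP => j; have := h j Logic.I; rewrite /= in_itv/=.
apply: fin_bigcap_measurable; first exact: finite_finset.
by move=> j _; rewrite -[X in measurable X]setTI; apply: measurable_tnth => //; exact: measurable_itv.
Qed.

Lemma cube_tcons n (x : R) (t : n.-tuple R) :
  cube n.+1 (tcons (x, t)) <-> (x \in `[0, 1]) /\ cube n t.
Proof.
rewrite !cubeP in_itv/=; split.
  move=> h; split; first by have := h ord0.
  by move=> j; have := h (lift ord0 j); rewrite tnthS.
move=> [x01 h] j; case: (unliftP ord0 j) => [i ->|->//].
by rewrite tnthS.
Qed.

Lemma measurable_tcons n : measurable_fun setT (@tcons R n).
Proof. exact: measurable_cons. Qed.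

Lemma lebesgue_tuple_cube d : lebesgue_tuple d (cube d) = 1%E.
Proof.
elim: d => [|n IH].
  rewrite /= /dirac/= indicE mem_set//.
  by apply/cubeP => -[].
rewrite [LHS]/= /lebesgue_tupleS /pushforward.
have -> : @tcons R n @^-1` cube n.+1 = `[0, 1]%classic `*` cube n.
  apply/seteqP; split=> -[x t]; first by move=> /cube_tcons.
  by move=> h; apply/cube_tcons.
rewrite product_measure1E//; [|exact: measurable_cube].
rewrite IH mule1 [LHS](lebesgue_measure_itv `[0, 1]%R)/= lte_fin ltr01.
by rewrite oppr0 adde0.
Qed.

Lemma lebesgue_tuple_cube_fin d : (lebesgue_tuple d (cube d) < +oo)%E.
Proof. by rewrite lebesgue_tuple_cube ltry. Qed.

(** Boundedness makes the class closed under products and, the cube having finite measure, implies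
    integrability; linearity of the integral then needs no further side conditions. *)
Definition bmeas d (f : d.-tuple R -> R) : Prop :=
  measurable_fun (cube d) f /\ exists M, forall t, cube d t -> `|f t| <= M.

Lemma bmeas_integrable d (f : d.-tuple R -> R) : bmeas f ->
  (lebesgue_tuple d).-integrable (cube d) (EFin \o f).
Proof.
move=> [mf [M fM]]; apply: measurable_bounded_integrable => //.
- exact: measurable_cube.
- exact: lebesgue_tuple_cube_fin.
exists M; split; first exact: num_real.
by move=> x Mx t /= ct; apply: le_trans (ltW Mx); exact: fM.
Qed.

Lemma bmeas_cst d c : bmeas (fun _ : d.-tuple R => c).
Proof. by split; [exact: measurable_cst|exists `|c|]. Qed.

Lemma bmeasD d (f g : d.-tuple R -> R) : bmeas f -> bmeas g ->
  bmeas (fun t => f t + g t).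
Proof.
move=> [mf [M fM]] [mg [N gN]]; split; first exact: measurable_funD.
exists (M + N) => t ct; apply: le_trans (ler_normD _ _) _.
by apply: lerD; [exact: fM|exact: gN].
Qed.

Lemma bmeasM d (f g : d.-tuple R -> R) : bmeas f -> bmeas g ->
  bmeas (fun t => f t * g t).
Proof.
move=> [mf [M fM]] [mg [N gN]]; split; first exact: measurable_funM.
exists (M * N) => t ct; rewrite normrM.
by apply: ler_pM => //; [exact: fM|exact: gN].
Qed.

Lemma bmeasZ d c (f : d.-tuple R -> R) : bmeas f -> bmeas (fun t => c * f t).
Proof. by move=> bf; apply: bmeasM => //; exact: bmeas_cst. Qed.

Lemma bmeasN d (f : d.-tuple R -> R) : bmeas f -> bmeas (fun t => - f t).
Proof.
move=> bf; rewrite (_ : (fun _ => _) = fun t => (-1) * f t); first exact: bmeasZ.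
by apply/funext => t; rewrite mulN1r.
Qed.

Lemma bmeasB d (f g : d.-tuple R -> R) : bmeas f -> bmeas g ->
  bmeas (fun t => f t - g t).
Proof. by move=> bf bg; apply: bmeasD => //; exact: bmeasN. Qed.

Lemma bmeas_sum d (I : Type) (s : seq I) (F : I -> d.-tuple R -> R) :
  (forall i, bmeas (F i)) -> bmeas (fun t => \sum_(i <- s) F i t).
Proof.
move=> bF; elim: s => [|i s IH].
  by under eq_fun do rewrite big_nil; exact: bmeas_cst.
by under eq_fun do rewrite big_cons; exact: bmeasD.
Qed.

Lemma bmeas_comp_continuous d (h : R -> R) (f : d.-tuple R -> R) M :
  continuous h -> (forall x, `|h x| <= M) -> measurable_fun (cube d) f ->
  bmeas (h \o f).
Proof.
move=> ch hM mf; split; last by exists M => t _; exact: hM.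
by apply: measurableT_comp => //; exact: continuous_measurable_fun.
Qed.

Definition cint d (f : d.-tuple R -> R) : R := \int[lebesgue_tuple d]_(t in cube d) f t.

Lemma cint_cst d c : cint (fun _ : d.-tuple R => c) = c.
Proof.
rewrite /cint Rintegral_cst; last exact: measurable_cube.
by rewrite [X in _ * fine X](lebesgue_tuple_cube d) mulr1.
Qed.

Lemma cintD d (f g : d.-tuple R -> R) : bmeas f -> bmeas g ->
  cint (fun t => f t + g t) = cint f + cint g.
Proof.
move=> bf bg; apply: RintegralD; [exact: measurable_cube|exact: bmeas_integrable..].
Qed.

Lemma cintZ d c (f : d.-tuple R -> R) : bmeas f -> cint (fun t => c * f t) = c * cint f.
Proof.
by move=> bf; apply: RintegralZl; [exact: measurable_cube|exact: bmeas_integrable].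
Qed.

Lemma cintN d (f : d.-tuple R -> R) : bmeas f -> cint (fun t => - f t) = - cint f.
Proof. by move=> bf; under eq_fun do rewrite -mulN1r; rewrite cintZ// mulN1r. Qed.

Lemma cintB d (f g : d.-tuple R -> R) : bmeas f -> bmeas g ->
  cint (fun t => f t - g t) = cint f - cint g.
Proof. by move=> bf bg; rewrite cintD ?cintN//; exact: bmeasN. Qed.

Lemma cint_sum d (I : Type) (s : seq I) (F : I -> d.-tuple R -> R) :
  (forall i, bmeas (F i)) ->
  cint (fun t => \sum_(i <- s) F i t) = \sum_(i <- s) cint (F i).
Proof.
move=> bF; elim: s => [|i s IH].
  by under eq_fun do rewrite big_nil; rewrite cint_cst big_nil.
under eq_fun do rewrite big_cons.
by rewrite cintD ?IH ?big_cons//; exact: bmeas_sum.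
Qed.

Lemma le_cint d (f g : d.-tuple R -> R) : bmeas f -> bmeas g ->
  (forall t, cube d t -> f t <= g t) -> cint f <= cint g.
Proof.
move=> bf bg fg; apply: le_Rintegral => //; first exact: measurable_cube.
- exact: bmeas_integrable.
- exact: bmeas_integrable.
Qed.

Lemma cint_ge0 d (f : d.-tuple R -> R) : (forall t, cube d t -> 0 <= f t) -> 0 <= cint f.
Proof. by move=> f0; exact: Rintegral_ge0. Qed.

(** Fubini for the first coordinate. The measure is a pushforward of a product along [tcons], so the
    integrand is first cut off to the cube and then treated as a function on the whole space. *)
Lemma integral_lebesgue_tupleS n (f : n.+1.-tuple R -> R) M :
  measurable_fun setT f -> (forall t, `|f t| <= M) ->
  (\int[lebesgue_tuple n.+1]_(t in cube n.+1) (f t)%:E =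
   \int[lebesgue_measure]_(x in `[0%R, 1%R]) \int[lebesgue_tuple n]_(t in cube n) (f (tcons (x, t)))%:E)%E.
Proof.
move=> mf fM.
pose h := (EFin \o f) \_ (cube n.+1).
have mh : measurable_fun setT h.
  apply/(measurable_restrictT _ _).1; first exact: measurable_cube.
  by apply/measurable_EFinP; exact: measurable_funTS.
rewrite integral_mkcond -/h.
have inth : (lebesgue_tuple n.+1).-integrable setT h.
  rewrite /h; apply/(integrable_mkcond _ _).1; first exact: measurable_cube.

  apply: bmeas_integrable; split; first exact: measurable_funTS.
  by exists M.
have mt := @measurable_tcons n.
have inth2 : (lebesgue_measure \x lebesgue_tuple n)%E.-integrable setT (h \o @tcons R n).
  apply/integrableP; split; first exact: measurableT_comp.
  move/integrableP : inth => [_].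
  rewrite [X in (X < _)%E -> _](ge0_integral_pushforward mt)//.
  exact: measurableT_comp.
rewrite [LHS](integral_pushforward mt)// preimage_setT.
rewrite -(integral12_prod_meas1 inth2) [RHS]integral_mkcond.
apply: eq_integral => x _; rewrite patchE/=.
rewrite integral_mkcond/=.
have E t : h (tcons (x, t)) = if x \in `[0, 1]%classic then
    ((fun t => (f (tcons (x, t)))%:E) \_ (cube n)) t else 0%E.
  rewrite /h !patchE; have [|xI] := ifPn.
    case/set_mem/cube_tcons => xI ct; rewrite mem_set//.
    by rewrite mem_set.
  case: ifPn => // xin; case: ifPn => // ct; case/negP: xI.
  by apply/mem_set/cube_tcons; split; [move/set_mem: xin|exact/set_mem].
rewrite /fubini_F; under eq_integral do rewrite /= E.
by case: ifPn => // _; rewrite integral0.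
Qed.

Lemma cos_sin_2pi_int (k : int) : cos (2 * pi * k%:~R) = 1 :> R /\ sin (2 * pi * k%:~R) = 0 :> R.
Proof.
have H (n : nat) : cos (2 * pi * n%:R) = 1 :> R /\ sin (2 * pi * n%:R) = 0 :> R.
  elim: n => [|n [c s]]; first by rewrite mulr0 cos0 sin0.
  have -> : 2 * pi * n.+1%:R = 2 * pi * n%:R + pi *+ 2 :> R.
    by rewrite -natr1 mulr2n; ring.
  by rewrite (sinD (2 * pi * n%:R)) cosD c s cos2pi sin2pi; split; ring.
case: k => n; first exact: H.
rewrite NegzE mulrNz mulrN cosN sinN; have [-> ->] := H n.+1.
by rewrite oppr0.
Qed.

Lemma cosD_2pi_int (x : R) (k : int) : cos (x + 2 * pi * k%:~R) = cos x.
Proof. by rewrite cosD; have [-> ->] := cos_sin_2pi_int k; ring. Qed.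

Lemma sinD_2pi_int (x : R) (k : int) : sin (x + 2 * pi * k%:~R) = sin x.
Proof. by rewrite sinD; have [-> ->] := cos_sin_2pi_int k; ring. Qed.

Lemma integral_cos_period (phi : R) (k : int) : k != 0 ->
  (\int[lebesgue_measure]_(x in `[0%R, 1%R]) (cos (phi + 2 * pi * k%:~R * x))%:E = 0)%E.
Proof.
move=> k0; set a := 2 * pi * k%:~R.
have a0 : a != 0 by rewrite !mulf_neq0 ?intr_eq0 ?pnatr_eq0 ?(gt_eqF (@pi_gt0 R)).
pose F (x : R) := a^-1 * sin (phi + a * x).
have dF (x : R) : is_derive x 1 F (cos (phi + a * x)).
  rewrite /F; apply: is_derive_eq.
  by rewrite add0r mul1r /GRing.scale/= mulr1; field.
have cf : continuous (fun x : R => cos (phi + a * x)).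
  move=> x; apply: (@continuous_comp _ _ _ (fun x => phi + a * x) cos); last exact: continuous_cos.
  apply: continuousD; first exact: cst_continuous.
  by apply: continuousM; [exact: cst_continuous|exact: cvg_id].
rewrite (@continuous_FTC2 _ _ F)//.
- rewrite /F mulr1 mulr0 addr0 sinD_2pi_int.
  by rewrite subee.
- by apply: continuous_subspaceT.
- split.
  + by move=> x _; case: (dF x).
  + by apply: cvg_at_right_filter; apply: differentiable_continuous; apply/derivable1_diffP; case: (dF 0).
  + by apply: cvg_at_left_filter; apply: differentiable_continuous; apply/derivable1_diffP; case: (dF 1).
- by move=> x _; rewrite derive1E; case: (dF x).
Qed.

Definition phase d (k : 'rV[int]_d) (x : 'rV[R]_d) : R :=
  2 * pi * \sum_(j < d) (k ord0 j)%:~R * x ord0 j.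

Lemma phase_row_of d (k : 'rV[int]_d) (t : d.-tuple R) :
  phase k (row_of t) = 2 * pi * \sum_(j < d) (k ord0 j)%:~R * tnth t j.
Proof. by rewrite /phase; under eq_bigr do rewrite mxE. Qed.

Lemma phase0 d (x : 'rV[R]_d) : phase 0 x = 0.
Proof. by rewrite /phase big1 ?mulr0// => j _; rewrite mxE mul0r. Qed.

Lemma phaseD d (k l : 'rV[int]_d) (x : 'rV[R]_d) : phase (k + l) x = phase k x + phase l x.
Proof.
rewrite /phase -mulrDr -big_split/=; congr (_ * _); apply: eq_bigr => j _.
by rewrite mxE intrD mulrDl.
Qed.

Lemma phaseN d (k : 'rV[int]_d) (x : 'rV[R]_d) : phase (- k) x = - phase k x.
Proof.
rewrite /phase -mulrN -sumrN; congr (_ * _); apply: eq_bigr => j _.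
by rewrite mxE mulrNz mulNr.
Qed.

Lemma phaseB d (k l : 'rV[int]_d) (x : 'rV[R]_d) : phase (k - l) x = phase k x - phase l x.
Proof. by rewrite phaseD phaseN. Qed.

Lemma measurable_phase d (k : 'rV[int]_d) (D : set (d.-tuple R)) :
  measurable_fun D (fun t : d.-tuple (measurableTypeR R) => phase k (row_of t)).
Proof.
apply: measurable_funTS; under eq_fun do rewrite phase_row_of.
apply: measurable_funM; first exact: measurable_cst.
apply: measurable_sum => j.
by apply: measurable_funM; [exact: measurable_cst|exact: measurable_tnth].
Qed.

Lemma bmeas_cos d phi (k : 'rV[int]_d) :
  bmeas (fun t : d.-tuple R => cos (phi + phase k (row_of t))).
Proof.
apply: (@bmeas_comp_continuous _ cos _ 1); first exact: continuous_cos.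
  by move=> x; rewrite ler_norml cos_geN1 cos_le1.
by apply: measurable_funD; [exact: measurable_cst|exact: measurable_phase].
Qed.

Lemma EFin_cint d (f : d.-tuple R -> R) : bmeas f ->
  (\int[lebesgue_tuple d]_(t in cube d) (f t)%:E)%E = (cint f)%:E.
Proof.
move=> bf; rewrite /cint /Rintegral fineK//.
by apply: integrable_fin_num; [exact: measurable_cube|exact: bmeas_integrable].
Qed.

(** The free shift [phi] makes the induction on [d] run: with the first coordinate frozen, its phase
    is absorbed into [phi]. The shift pi / 2 covers the sine, up to sign, by the same formula. *)
Lemma cint_cos d phi (k : 'rV[int]_d) :
  cint (fun t : d.-tuple R => cos (phi + phase k (row_of t))) =
  if k == 0 then cos phi else 0.
Proof.
elim: d phi k => [|n IH] phi k.
  have -> : k = 0 by apply/rowP => -[].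
  by under eq_fun do rewrite phase0 addr0; rewrite eqxx cint_cst.
pose k' : 'rV[int]_n := \row_j k ord0 (lift ord0 j).
have k'E : (k == 0) = (k ord0 ord0 == 0) && (k' == 0).
  apply/eqP/andP => [k0|[/eqP k0 /eqP k'0]].
    by split; [rewrite k0 mxE|apply/eqP/rowP => j; rewrite mxE k0 !mxE].
  apply/rowP => j; rewrite mxE; case: (unliftP ord0 j) => [i ->|->//].
  by move/rowP : k'0 => /(_ i); rewrite !mxE.
apply: EFin_inj; rewrite -EFin_cint; last exact: bmeas_cos.
have [mf _] := bmeas_cos phi k.
rewrite (@integral_lebesgue_tupleS _ _ 1); last 2 first.
- apply: (@measurableT_comp _ _ _ _ _ _ cos).
    by apply: continuous_measurable_fun; exact: continuous_cos.
  by apply: measurable_funD; [exact: measurable_cst|exact: measurable_phase].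
- by move=> t; rewrite ler_norml cos_geN1 cos_le1.
transitivity (\int[lebesgue_measure]_(x in `[0%R, 1%R])
   (if k' == 0 then cos (phi + 2 * pi * (k ord0 ord0)%:~R * x) else 0)%:E)%E.
  apply: eq_integral => x _.
  have E t : cos (phi + phase k (row_of (tcons (x, t)))) =
     cos ((phi + 2 * pi * (k ord0 ord0)%:~R * x) + phase k' (row_of t)).
    congr cos; rewrite !phase_row_of big_ord_recl mulrDr !addrA mulrA.
    congr (_ + _ * _); apply: eq_bigr => j _.
    by rewrite tnthS mxE.
  by under eq_integral do rewrite E; rewrite EFin_cint ?IH//; exact: bmeas_cos.
rewrite k'E; case: (k' == 0); last by rewrite andbF integral0.
have [->|k0] := eqVneq (k ord0 ord0) 0; last by rewrite integral_cos_period.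
under eq_integral do rewrite mulr0 mul0r addr0.
rewrite integral_cst//= lebesgue_measure_itv/= lte_fin ltr01 oppr0 adde0 mule1.
by [].
Qed.

End cube_measure.
Arguments cube {R} d _.

(** * Continuity on the cube and measurability *)

Section continuity.
Context {R : realType} {d : nat}.
Implicit Types (h : 'rV[R]_d -> R).

(** Continuity relative to the cube, written in coordinates so that it can be used on rows built
    from tuples, where the measure lives. *)
Definition cube_continuous h := forall x, unit_cube x -> forall e, 0 < e ->
  exists2 r, 0 < r & forall y, unit_cube y ->
    (forall j, `|x ord0 j - y ord0 j| < r) -> `|h x - h y| < e.

Lemma near_rowP (x : 'rV[R]_d) (P : 'rV[R]_d -> Prop) :
  (\forall y \near within unit_cube (nbhs x), P y) <->
  exists2 r, 0 < r & forall y, unit_cube y ->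
    (forall j, `|x ord0 j - y ord0 j| < r) -> P y.
Proof.
rewrite /within/= /prop_near1; split.
  move=> /nbhs_ballP[r /= r0 H]; exists r => // y cy xy.
  apply: H => //; split=> // i j; rewrite ord1 /ball/=; exact: xy.
move=> [r r0 H]; apply/nbhs_ballP; exists r => //= y [_ xy] cy.
by apply: H => // j; have := xy ord0 j.
Qed.

Lemma cube_continuousP h : {within unit_cube, continuous h} <-> cube_continuous h.
Proof.
split.
  move=> /subspace_continuousP ch x cx e e0; apply/near_rowP.
  by have /cvgrPdist_lt/(_ _ e0) := ch x cx.
move=> ch; apply/subspace_continuousP => x cx; apply/cvgrPdist_lt => e e0.
exact/near_rowP/ch.
Qed.

Lemma cube_continuous_bounded h : cube_continuous h ->
  exists M, forall x, unit_cube x -> `|h x| <= M.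
Proof.
move=> /cube_continuousP ch.
have cc : compact (@unit_cube R d).
  rewrite (_ : unit_cube = [set v : 'rV[R]_d | forall i, `[0, 1]%classic (v ord0 i)]).
    by apply: (@rV_compact R d (fun=> `[0, 1]%classic)) => _; exact: segment_compact.
  by apply/seteqP; split=> x /= cx j; have := cx j; rewrite in_itv.
have /compact_bounded[M [_ HM]] := continuous_compact ch cc.
exists (M + 1) => x cx; apply: (HM (M + 1)); first by rewrite ltrDl.
by exists x.
Qed.

(** Topology and sigma-algebra are carried by different types; the link is made by step functions,
    constant on the cells of a grid of mesh 1 / N, which converge pointwise on the cube. *)
Lemma cube_continuous_measurable h : cube_continuous h ->
  measurable_fun (cube d) (fun t => h (row_of t)).
Proof.
move=> ch.
pose gp N (p : {ffun 'I_d -> 'I_N.+1}) : 'rV[R]_d := \row_j ((p j)%:R / N%:R).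
pose A N (p : {ffun 'I_d -> 'I_N.+1}) : set (d.-tuple (measurableTypeR R)) :=
  \bigcap_(j in [set: 'I_d]) ((@tnth d (measurableTypeR R))^~ j @^-1`
     [set y | (p j)%:R <= N%:R * y < (p j).+1%:R]).
have mA N p : measurable (A N p).
  apply: fin_bigcap_measurable; first exact: finite_finset.
  move=> j _; rewrite -[X in measurable X]setTI.
  apply: measurable_tnth => //.
  rewrite -[X in measurable X]setTI.
  have mf : measurable_fun setT (fun y : measurableTypeR R => N%:R * y).
    by apply: measurable_funM; [exact: measurable_cst|exact: measurable_id].
  rewrite (_ : [set y | _] = (fun y : measurableTypeR R => N%:R * y) @^-1` `[(p j)%:R, (p j).+1%:R[%classic).
    by apply: mf => //; exact: measurable_itv.
  by apply/seteqP; split=> y /=; rewrite in_itv.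
pose s N (t : d.-tuple (measurableTypeR R)) : R := \sum_p h (gp N p) * \1_(A N p) t.
apply: (@measurable_fun_cvg _ _ _ (cube d) s).
  move=> N; apply: measurable_sum => p; apply: measurable_funM; first exact: measurable_cst.
  exact: measurable_indic.
move=> t ct; have cx : unit_cube (row_of t) by [].
apply/cvgrPdist_lt => e e0; have [r r0 H] := ch _ cx e e0.
near=> N.
have N0 : 0 < N%:R :> R by rewrite ltr0n; near: N; exact: nbhs_infty_gt.
have t01 j : 0 <= tnth t j <= 1 by have := (cubeP t).1 ct.
(* A coordinate equal to 1 gets the index N, hence N + 1 cells in each direction. *)
have Nt j : (Num.truncn (N%:R * tnth t j) < N.+1)%N.
  rewrite ltnS -(ler_nat R); have /andP[t0 t1] := t01 j.
  apply: (@le_trans _ _ (N%:R * tnth t j)); last by rewrite ger_pMr.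
  by rewrite truncn_le// mulr_ge0.
pose p0 : {ffun 'I_d -> 'I_N.+1} := [ffun j => Ordinal (Nt j)].
have p0t j : (p0 j)%:R <= N%:R * tnth t j < (p0 j).+1%:R.
  rewrite ffunE /=; apply: truncn_itv; have /andP[? _] := t01 j.
  by rewrite mulr_ge0.
have sE : s N t = h (gp N p0).
  rewrite /s (bigD1 p0)//= indicE mem_set ?mulr1 ?big1 ?addr0//; last by move=> j _; exact: p0t.
  move=> p pp0; rewrite indicE memNset ?mulr0// => Ap.
  case/eqP: pp0; apply/ffunP => j; apply/val_inj => /=.
  have := Ap j Logic.I => /= /andP[a1 a2]; have /andP[b1 b2] := p0t j.
  apply/eqP; rewrite eqn_leq; apply/andP.
  by split; rewrite -ltnS -(ltr_nat R); [exact: le_lt_trans b2|exact: le_lt_trans a2].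
rewrite sE; apply: H.
  move=> j; rewrite mxE divr_ge0//= ler_pdivrMr// mul1r ler_nat.
  by rewrite -ltnS.
move=> j; rewrite !mxE; have /andP[b1 b2] := p0t j.
have -> : tnth t j - (p0 j)%:R / N%:R = (N%:R * tnth t j - (p0 j)%:R) / N%:R.
  by field; rewrite gt_eqF.
rewrite normrM [`|N%:R^-1|]ger0_norm ?invr_ge0// ger0_norm ?subr_ge0//.
rewrite ltr_pdivrMr//; apply: (@lt_le_trans _ _ 1).
  by move: b2; rewrite -natr1; lra.
rewrite mulrC -ler_pdivrMr// div1r ltW//.
near: N; exact: nbhs_infty_gtr.
Unshelve. all: by end_near.
Qed.

Lemma cube_continuous_bmeas h : cube_continuous h ->
  bmeas (fun t : d.-tuple R => h (row_of t)).
Proof.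
move=> ch; split; first exact: cube_continuous_measurable.
by have [M HM] := cube_continuous_bounded ch; exists M => t /HM.
Qed.

Lemma cube_continuousB h g : cube_continuous h -> cube_continuous g ->
  cube_continuous (fun x => h x - g x).
Proof.
move=> ch cg x cx e e0; have e2 : 0 < e / 2 by rewrite divr_gt0.
have [r1 r10 H1] := ch x cx _ e2; have [r2 r20 H2] := cg x cx _ e2.
exists (Num.min r1 r2); first by rewrite lt_min r10.
move=> y cy xy.
have h1 : `|h x - h y| < e / 2.
  by apply: H1 => // j; apply: lt_le_trans (xy j) _; rewrite ge_min lexx.
have h2 : `|g x - g y| < e / 2.
  by apply: H2 => // j; apply: lt_le_trans (xy j) _; rewrite ge_min lexx orbT.
have -> : h x - g x - (h y - g y) = (h x - h y) - (g x - g y) by ring.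
by apply: (le_lt_trans (ler_normB _ _)); lra.
Qed.

Lemma continuous_sum_seq (T : topologicalType) (I : Type) (s : seq I) (F : I -> T -> R) :
  (forall i, continuous (F i)) -> continuous (fun x => \sum_(i <- s) F i x).
Proof.
move=> cF; elim: s => [|i s IH].
  by under eq_fun do rewrite big_nil; move=> x; exact: cst_continuous.
under eq_fun do rewrite big_cons.
by move=> x; apply: continuousD; [exact: cF|exact: IH].
Qed.

Lemma continuous_phase (k : 'rV[int]_d) : continuous (phase k : 'rV[R]_d -> R).
Proof.
move=> x; apply: (@continuousM R _ (fun=> 2 * pi)
  (fun x : 'rV[R]_d => \sum_(j < d) (k ord0 j)%:~R * x ord0 j)); first exact: cst_continuous.
apply: continuous_sum_seq => j {}x.
by apply: continuousM; [exact: cst_continuous|exact: coord_continuous].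
Qed.

Definition cas (k : 'rV[int]_d) (x : 'rV[R]_d) : R := cos (phase k x) + sin (phase k x).

Lemma continuous_cas (k : 'rV[int]_d) : continuous (cas k).
Proof.
rewrite /cas => x; apply: continuousD.
  by apply: continuous_comp; [exact: continuous_phase|exact: continuous_cos].
by apply: continuous_comp; [exact: continuous_phase|exact: continuous_sin].
Qed.

Lemma cube_continuous_caspoly (J : seq 'rV[int]_d) (c : 'rV[int]_d -> R) :
  cube_continuous (fun x => \sum_(k <- J) c k * cas k x).
Proof.
apply/cube_continuousP/continuous_subspaceT/continuous_sum_seq => k x.
by apply: continuousM; [exact: cst_continuous|exact: continuous_cas].
Qed.

End continuity.

(** Exponential decay beats a power of degree [d]. The only analytic input is that (N + 1) q^N is
    bounded, which follows by a Bernoulli-type induction. *)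
Lemma geometric_poly_small (R : realType) (q C eta : R) d : 0 <= q < 1 -> 0 <= C -> 0 < eta ->
  exists m, q ^+ m * (2 * m.+1%:R) ^+ d * C <= eta.
Proof.
move=> /andP[q0 q1] C0 eta0.
have [->|qn0] := eqVneq q 0.
  by exists 1%N; rewrite expr1 !mul0r ltW.
have qp : 0 < q by rewrite lt0r qn0.
pose a := Num.min 1 (q^-1 - 1).
have a0 : 0 < a by rewrite lt_min ltr01 subr_gt0 invf_gt1.
have H N : N.+1%:R * q ^+ N <= a^-1.
  have : N.+1%:R * a <= (q^-1) ^+ N.
    elim: N => [|N IH]; first by rewrite mul1r expr0 ge_min lexx.
    rewrite exprS; apply: (@le_trans _ _ ((1 + a) * (q^-1) ^+ N)); last first.
      rewrite ler_wpM2r ?exprn_ge0 ?invr_ge0//.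
      have : a <= q^-1 - 1 by rewrite ge_min lexx orbT.
      lra.
    apply: (@le_trans _ _ (N.+1%:R * a + a)); first by rewrite -natr1 mulrDl mul1r.
    rewrite mulrDl mul1r lerD// ler_peMr ?(ltW a0)//.
    by rewrite exprn_ege1// invf_ge1// ltW.
  rewrite exprVn => h; rewrite -div1r ler_pdivlMr// mulrAC.
  by rewrite -ler_pdivlMr ?exprn_gt0// div1r.
pose K : R := (2 * d.+1%:R) ^+ d * a^-1 ^+ d.+1.
have K0 : 0 <= K by rewrite mulr_ge0// exprn_ge0// ?mulr_ge0// invr_ge0 ltW.
have [N hN] : exists N : nat, K * C / eta <= N%:R.
  exists (Num.truncn (K * C / eta)).+1; apply: ltW.
  by rewrite truncnS_gt.
(* With this exponent q^m (N + 1)^d equals ((N + 1) q^N)^(d + 1) / (N + 1), a bounded quantity over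
   N + 1; and m + 1 <= (d + 1) (N + 1). *)
exists (N * d.+1)%N.
have mN : ((N * d.+1).+1 <= d.+1 * N.+1)%N by lia.
apply: (@le_trans _ _ ((q ^+ N) ^+ d.+1 * (2 * d.+1%:R * N.+1%:R) ^+ d * C)).
  rewrite exprM ler_wpM2r// ler_wpM2l ?exprn_ge0// lerXn2r ?nnegrE ?mulr_ge0//.
  by rewrite -mulrA ler_pM2l// -natrM ler_nat.
have -> : (q ^+ N) ^+ d.+1 * (2 * d.+1%:R * N.+1%:R) ^+ d * C =
   (2 * d.+1%:R) ^+ d * (N.+1%:R * q ^+ N) ^+ d.+1 * C / N.+1%:R.
  by rewrite !exprMn !exprS; field.
rewrite ler_pdivrMr//; apply: (@le_trans _ _ (K * C)).
  rewrite ler_wpM2r// ler_wpM2l ?exprn_ge0 ?mulr_ge0// lerXn2r ?nnegrE//.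
    by rewrite mulr_ge0 ?exprn_ge0.
  by rewrite invr_ge0 ltW.
move: hN; rewrite ler_pdivrMr// => /le_trans; apply.
by rewrite mulrC ler_pM2l// ler_nat.
Qed.

(** * The Hartley system *)

Section hartley.
Context {R : realType} {d : nat}.
Implicit Types (k l : 'rV[int]_d) (x y : 'rV[R]_d) (f g h : 'rV[R]_d -> R).

(** The sine has mean zero at every frequency, so only the cosine of k - l contributes to inner
    products: the system is orthonormal without normalising factors. *)
Lemma casM k l x : cas k x * cas l x = cos (phase (k - l) x) + sin (phase (k + l) x).
Proof. by rewrite /cas phaseB phaseD cosB sinD; ring. Qed.

Lemma normr_cas_le k x : `|cas k x| <= 2.
Proof.
apply: le_trans (ler_normD _ _) _.
have -> : 2 = 1 + 1 :> R by [].
by rewrite lerD// ler_norml ?cos_geN1 ?cos_le1 ?sin_geN1 ?sin_le1.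
Qed.

Lemma bmeas_cas k : bmeas (fun t : d.-tuple R => cas k (row_of t)).
Proof.
apply: cube_continuous_bmeas; apply/cube_continuousP.
exact/continuous_subspaceT/continuous_cas.
Qed.

Lemma cint_cas_cas k l :
  cint (fun t : d.-tuple R => cas k (row_of t) * cas l (row_of t)) = (k == l)%:R.
Proof.
transitivity (cint (fun t : d.-tuple R => cos (0 + phase (k - l) (row_of t)) +
   (- cos (pi / 2 + phase (k + l) (row_of t))))).
  congr cint; apply/funext => t; rewrite casM add0r; congr (_ + _).
  by rewrite [pi / 2 + _]addrC cosDpihalf opprK.
rewrite cintD; last 2 first.
- exact: bmeas_cos.
- by apply: bmeasN; exact: bmeas_cos.
rewrite cintN ?cint_cos; last exact: bmeas_cos.
rewrite cos_pihalf cos0 if_same oppr0 addr0 subr_eq0.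
by case: eqP.
Qed.

Definition hcoef h k : R := cint (fun t : d.-tuple R => h (row_of t) * cas k (row_of t)).

Lemma bmeas_caspoly (J : seq 'rV[int]_d) c :
  bmeas (fun t : d.-tuple R => \sum_(k <- J) c k * cas k (row_of t)).
Proof.
apply: (cube_continuous_bmeas (h := fun x => \sum_(k <- J) c k * cas k x)).
exact: cube_continuous_caspoly.
Qed.

Lemma cint_mul_caspoly h (J : seq 'rV[int]_d) c : bmeas (fun t : d.-tuple R => h (row_of t)) ->
  cint (fun t : d.-tuple R => h (row_of t) * \sum_(k <- J) c k * cas k (row_of t)) =
  \sum_(k <- J) c k * hcoef h k.
Proof.
move=> bh; under eq_fun do rewrite mulr_sumr.
have bk k : bmeas (fun t : d.-tuple R => h (row_of t) * cas k (row_of t)).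
  by apply: bmeasM => //; exact: bmeas_cas.
rewrite (cint_sum _ (F := fun k t => h (row_of t) * (c k * cas k (row_of t)))).
  apply: eq_bigr => k _; rewrite -cintZ//; congr cint; apply/funext => t.
  by rewrite mulrCA.
move=> k; apply: bmeasM => //; apply: bmeasZ; exact: bmeas_cas.
Qed.

Lemma hcoef_caspoly (J : seq 'rV[int]_d) c l : uniq J ->
  hcoef (fun x => \sum_(k <- J) c k * cas k x) l = if l \in J then c l else 0.
Proof.
move=> uJ; rewrite /hcoef; under eq_fun do rewrite mulrC.
rewrite cint_mul_caspoly; last exact: bmeas_cas.
rewrite /hcoef; under eq_bigr do rewrite cint_cas_cas.
have [lJ|lJ] := ifPn.
  rewrite (big_rem l)//= eqxx mulr1 big_seq big1 ?addr0// => k.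
  by rewrite mem_rem_uniq// inE => /andP[kl _]; rewrite eq_sym (negbTE kl) mulr0.
rewrite big_seq big1// => k kJ; case: eqP => [lk|]; last by rewrite mulr0.
by rewrite lk kJ in lJ.
Qed.

Definition inbox N k : bool := ~~ [exists j, (N < `|k ord0 j|)%N].

(** A list of terms in which frequencies may repeat, so that a sum is a concatenation; [trig_expand]
    collects the terms afterwards. *)
Definition trig N f := exists2 s : seq (R * 'rV[int]_d), all (fun p => inbox N p.2) s &
  forall x, f x = \sum_(p <- s) p.1 * cas p.2 x.

Lemma inboxP N k : reflect (forall j, (`|k ord0 j| <= N)%N) (inbox N k).
Proof.
rewrite /inbox negb_exists; apply: (iffP idP) => [/forallP h j|h]; first by rewrite leqNgt.
by apply/forallP => j; rewrite -leqNgt.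
Qed.

Lemma trig_cas N k : inbox N k -> trig N (cas k).
Proof. by move=> kN; exists [:: (1, k)] => /= [|x]; rewrite ?kN// big_seq1 mul1r. Qed.

Lemma trigD N f g : trig N f -> trig N g -> trig N (fun x => f x + g x).
Proof.
move=> [s sN fs] [r rN gr]; exists (s ++ r); first by rewrite all_cat sN.
by move=> x; rewrite big_cat fs gr.
Qed.

Lemma trigZ N c f : trig N f -> trig N (fun x => c * f x).
Proof.
move=> [s sN fs]; exists [seq (c * p.1, p.2) | p <- s]; first by rewrite all_map.
by move=> x; rewrite big_map fs mulr_sumr; apply: eq_bigr => p _; rewrite mulrA.
Qed.

Lemma trig0 N : trig N (fun _ => 0).
Proof. by exists [::] => // x; rewrite big_nil. Qed.

Lemma trig_sum N (I : Type) (s : seq I) (F : I -> 'rV[R]_d -> R) :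
  (forall i, trig N (F i)) -> trig N (fun x => \sum_(i <- s) F i x).
Proof.
move=> tF; elim: s => [|i s IH].
  by under eq_fun do rewrite big_nil; exact: trig0.
by under eq_fun do rewrite big_cons; exact: trigD.
Qed.

Lemma trig_cos N k : inbox N k -> trig N (fun x => cos (phase k x)).
Proof.
move=> kN; have kN' : inbox N (- k).
  by apply/inboxP => j; rewrite mxE abszN; exact: (inboxP _ _ kN).
have -> : (fun x => cos (phase k x)) = (fun x => 2^-1 * (cas k x + cas (- k) x)).
  by apply/funext => x; rewrite /cas phaseN cosN sinN; field.
by apply: trigZ; apply: trigD; exact: trig_cas.
Qed.

Lemma trig_sin N k : inbox N k -> trig N (fun x => sin (phase k x)).
Proof.
move=> kN; have kN' : inbox N (- k).
  by apply/inboxP => j; rewrite mxE abszN; exact: (inboxP _ _ kN).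
have -> : (fun x => sin (phase k x)) = (fun x => 2^-1 * (cas k x + (-1) * cas (- k) x)).
  by apply/funext => x; rewrite /cas phaseN cosN sinN; field.
by apply: trigZ; apply: trigD; [|apply: trigZ]; exact: trig_cas.
Qed.

Lemma trigM N M f g : trig N f -> trig M g -> trig (N + M) (fun x => f x * g x).
Proof.
move=> [s sN fs] [r rM gr].
have -> : (fun x => f x * g x) = (fun x => \sum_(p <- s) \sum_(q <- r)
    (p.1 * q.1) * (cas p.2 x * cas q.2 x)).
  apply/funext => x; rewrite fs gr mulr_suml; apply: eq_bigr => p _.
  by rewrite mulr_sumr; apply: eq_bigr => q _; ring.
elim: s sN {fs} => [_|p s IH /= /andP[pN sN]].
  by under eq_fun do rewrite big_nil; exact: trig0.
under eq_fun do rewrite big_cons; apply: trigD; last exact: IH.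
elim: r rM {gr IH} => [_|q r IH /= /andP[qM rM]].
  by under eq_fun do rewrite big_nil; exact: trig0.
under eq_fun do rewrite big_cons; apply: trigD; last exact: IH.
apply: trigZ; under eq_fun do rewrite casM.
apply: trigD.
  apply: trig_cos; apply/inboxP => j; rewrite !mxE.
  move: (inboxP _ _ pN j) (inboxP _ _ qM j).
  by move: (p.2 ord0 j) (q.2 ord0 j) => a b; lia.
apply: trig_sin; apply/inboxP => j; rewrite !mxE.
move: (inboxP _ _ pN j) (inboxP _ _ qM j).
by move: (p.2 ord0 j) (q.2 ord0 j) => a b; lia.
Qed.

Lemma inbox0 N : inbox N 0.
Proof. by apply/inboxP => j; rewrite mxE. Qed.

Lemma trig_cst N c : trig N (fun _ => c).
Proof.
have -> : (fun _ : 'rV[R]_d => c) = (fun x => c * cas 0 x).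
  by apply/funext => x; rewrite /cas phase0 cos0 sin0 addr0 mulr1.
by apply: trigZ; apply: trig_cas; exact: inbox0.
Qed.

Lemma trigX N m f : trig N f -> trig (m * N) (fun x => f x ^+ m).
Proof.
move=> tf; elim: m => [|m IH]; first by under eq_fun do rewrite expr0; exact: trig_cst.
by under eq_fun do rewrite exprS; rewrite mulSn; exact: trigM.
Qed.

Lemma trig_expand N f : trig N f ->
  exists K : seq 'rV[int]_d, [/\ uniq K, all (inbox N) K &
    forall x, f x = \sum_(k <- K) hcoef f k * cas k x].
Proof.
move=> [s sN fs]; pose K := undup [seq p.2 | p <- s].
pose c k := \sum_(p <- s | p.2 == k) p.1.
have fc x : f x = \sum_(k <- K) c k * cas k x.
  rewrite fs /c; under [RHS]eq_bigr do rewrite mulr_suml big_mkcond.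
  rewrite exchange_big/= big_seq [RHS]big_seq; apply: eq_bigr => p ps.
  rewrite (big_rem p.2)/=; last by rewrite mem_undup map_f.
  rewrite eqxx big_seq big1 ?addr0// => k.
  rewrite mem_rem_uniq ?undup_uniq// inE => /andP[kp _].
  by rewrite eq_sym (negbTE kp).
exists K; split; first exact: undup_uniq.
  apply/allP => k; rewrite mem_undup => /mapP[p ps ->].
  by have /allP := sN; exact.
move=> x; rewrite {1}fc big_seq [RHS]big_seq; apply: eq_bigr => k kK.
have -> : f = (fun x => \sum_(k <- K) c k * cas k x) by apply/funext.
by rewrite hcoef_caspoly ?undup_uniq// kK.
Qed.

Lemma trig_bmeas N f : trig N f -> bmeas (fun t : d.-tuple R => f (row_of t)).
Proof.
move=> /trig_expand[K [_ _ fK]]; under eq_fun do rewrite fK; exact: bmeas_caspoly.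
Qed.

Lemma normr_hcoef_le f k : bmeas (fun t : d.-tuple R => f (row_of t)) ->
  (forall x, unit_cube x -> 0 <= f x) ->
  `|hcoef f k| <= 2 * cint (fun t : d.-tuple R => f (row_of t)).
Proof.
move=> bf f0.
have bfc : bmeas (fun t : d.-tuple R => f (row_of t) * cas k (row_of t)).
  by apply: bmeasM => //; exact: bmeas_cas.
have H t : cube d t -> `|f (row_of t) * cas k (row_of t)| <= 2 * f (row_of t).
  by move=> ct; rewrite normrM (ger0_norm (f0 _ ct)) mulrC ler_wpM2r ?f0 ?normr_cas_le.
rewrite -cintZ// ler_norml -cintN; last exact: bmeasZ.
apply/andP; split; apply: le_cint => //; try exact: bmeasZ.
- by apply: bmeasN; exact: bmeasZ.
- by move=> t /H; rewrite ler_norml => /andP[].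
- by move=> t /H; rewrite ler_norml => /andP[].
Qed.

(** A Nikolskii-type inequality: there are at most (2 (N + 1))^d coefficients, each at most twice
    the mean because f >= 0, and |cas| <= 2. *)
Lemma trig_value_le N f x : trig N f -> (forall x, unit_cube x -> 0 <= f x) ->
  `|f x| <= 4 * (2 * N.+1%:R) ^+ d * cint (fun t : d.-tuple R => f (row_of t)).
Proof.
move=> tf f0; have bf := trig_bmeas tf; have [K [uK aK fK]] := trig_expand tf.
set I := cint _; rewrite fK; apply: le_trans (ler_norm_sum _ _ _) _.
apply: (@le_trans _ _ (\sum_(k <- K | inbox N k) 4 * I)).
  have -> : \sum_(k <- K | inbox N k) 4 * I = \sum_(k <- K) 4 * I.
    by rewrite big_mkcond; apply: eq_big_seq => k kK; rewrite (allP aK).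
  apply: ler_sum => k _; rewrite normrM (_ : 4 * I = 2 * I * 2); last by ring.
  by apply: ler_pM => //; [exact: normr_hcoef_le|exact: normr_cas_le].
have -> : \sum_(k <- K | inbox N k) 4 * I = (4 * I) * \sum_(k <- K | inbox N k) 1.
  by rewrite mulr_sumr; apply: eq_bigr => k _; rewrite mulr1.
rewrite [leRHS]mulrAC; apply: ler_wpM2l; last exact: box_count.
by rewrite mulr_ge0// cint_ge0// => t; exact: f0.
Qed.

End hartley.

(** * Completeness of the Hartley system by peaking polynomials *)

Section peak.
Context {R : realType} {d : nat}.
Hypothesis d_gt0 : (0 < d)%N.
Implicit Types (k l : 'rV[int]_d) (x y : 'rV[R]_d).

Let dR : 0 < d%:R :> R. Proof. by rewrite ltr0n. Qed.

Lemma phase_delta (j : 'I_d) x : phase (delta_mx ord0 j) x = 2 * pi * x ord0 j.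
Proof.
rewrite /phase (bigD1 j)//= mxE !eqxx mul1r big1 ?addr0// => i ij.
by rewrite mxE eqxx (negbTE ij) mul0r.
Qed.

(* Integrating [h] against powers of [peak x] isolates [h x]; this gives the completeness of the
   Hartley system. *)
Definition peak x y : R := (2 * d%:R)^-1 * \sum_(j < d) (1 + cos (2 * pi * (y ord0 j - x ord0 j))).

Lemma trig_peak x : trig 1 (peak x).
Proof.
apply: trigZ; apply: trig_sum => j; apply: trigD; first exact: trig_cst.
have -> : (fun y : 'rV[R]_d => cos (2 * pi * (y ord0 j - x ord0 j))) =
  (fun y => cos (2 * pi * x ord0 j) * cos (phase (delta_mx ord0 j) y) +
            sin (2 * pi * x ord0 j) * sin (phase (delta_mx ord0 j) y)).
  by apply/funext => y; rewrite !phase_delta mulrBr cosB; ring.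
have db : inbox 1 (delta_mx ord0 j : 'rV[int]_d).
  by apply/inboxP => i; rewrite mxE eqxx; case: (i == j).
by apply: trigD; apply: trigZ; [exact: trig_cos|exact: trig_sin].
Qed.

Lemma peak_ge0 x y : 0 <= peak x y.
Proof.
rewrite mulr_ge0 ?invr_ge0 ?mulr_ge0//; apply: sumr_ge0 => j _.
by have := cos_geN1 (2 * pi * (y ord0 j - x ord0 j)); lra.
Qed.

Lemma peakxx x : peak x x = 1.
Proof.
rewrite /peak (eq_bigr (fun=> 2)) => [|j _]; last by rewrite subrr mulr0 cos0.
by rewrite sumr_const card_ord -[2 *+ d]mulr_natr mulVf// gt_eqF// mulr_gt0.
Qed.

Lemma cos_2pi_le (r t : R) : 0 <= r -> r <= t -> t <= 1 - r ->
  cos (2 * pi * t) <= cos (2 * pi * r).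
Proof.
move=> r0 rt tr; have pi0 := @pi_gt0 R.
have H s : r <= s -> s <= 2^-1 -> cos (2 * pi * s) <= cos (2 * pi * r).
  move=> rs s2; have [<-//|rs'] := eqVneq r s.
  have I0 (z : R) : 0 <= z <= 2^-1 -> 2 * pi * z \in `[0, pi].
    move=> z0; rewrite in_itv/=; apply/andP; split; first by rewrite !mulr_ge0 ?(ltW pi0)//; lra.
    by rewrite mulrAC ger_pMl//; lra.
  have hr : 0 <= r <= 2^-1 by apply/andP; split; lra.
  have hs : 0 <= s <= 2^-1 by apply/andP; split; lra.
  have rs2 : r < s by rewrite lt_neqAle rs'.
  by apply/ltW; rewrite ltr_cos ?I0// ltr_pM2l ?mulr_gt0.
have [t2|t2] := leP t 2^-1; first exact: H.
have -> : cos (2 * pi * t) = cos (2 * pi * (1 - t)).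
  by rewrite mulrBr mulr1 -(cosN (_ - _)) opprB -[in RHS](cosD_2pi_int _ 1) mulr1 subrK.
by apply: H; lra.
Qed.

(** The distance of [x] from the boundary matters because [peak] has period 1 in each coordinate:
    near a face it would be large at the opposite face as well. Here |x_j - y_j| lies in [r, 1 - r]
    for the coordinate in question. *)
Lemma peak_le x y r : 0 < r -> (forall j, r <= x ord0 j <= 1 - r) -> unit_cube y ->
  (exists j, r <= `|x ord0 j - y ord0 j|) ->
  peak x y <= 1 - (1 - cos (2 * pi * r)) / (2 * d%:R).
Proof.
move=> r0 xr cy [j rj].
have cj : cos (2 * pi * (y ord0 j - x ord0 j)) <= cos (2 * pi * r).
  have -> : cos (2 * pi * (y ord0 j - x ord0 j)) = cos (2 * pi * `|x ord0 j - y ord0 j|).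
    have [h|h] := ger0P (x ord0 j - y ord0 j); last by rewrite opprB.
    by rewrite -cosN -mulrN opprB.
  apply: cos_2pi_le => //; first exact: ltW.
  have := xr j; have := cy j; rewrite ler_norml => /andP[? ?] /andP[? ?].
  by apply/andP; split; lra.
rewrite /peak (bigD1 j)//= ler_pdivrMl ?mulr_gt0//.
have : \sum_(i < d | i != j) (1 + cos (2 * pi * (y ord0 i - x ord0 i))) <= 2 * (d%:R - 1).
  apply: (@le_trans _ _ (\sum_(i < d | i != j) 2)).
    by apply: ler_sum => i _; have := cos_le1 (2 * pi * (y ord0 i - x ord0 i)); lra.
  rewrite sumr_const cardC1 card_ord -[2 *+ d.-1]mulr_natr.
  by rewrite -subn1 natrB.
have -> : 2 * d%:R * (1 - (1 - cos (2 * pi * r)) / (2 * d%:R)) =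
  2 * d%:R - (1 - cos (2 * pi * r)).
  by field; rewrite gt_eqF.
by lra.
Qed.

(** Expand [f]: its coefficients are uniformly at most twice its mean, while those of [h] are
    summable with sum at most [eps]. *)
Lemma cint_mul_trig_le N (f h : 'rV[R]_d -> R) eps : trig N f ->
  (forall x, unit_cube x -> 0 <= f x) -> bmeas (fun t : d.-tuple R => h (row_of t)) ->
  (forall J : seq 'rV[int]_d, uniq J -> \sum_(k <- J) `|hcoef h k| <= eps) ->
  `|cint (fun t : d.-tuple R => h (row_of t) * f (row_of t))| <=
  2 * eps * cint (fun t : d.-tuple R => f (row_of t)).
Proof.
move=> tf f0 bh he; have [K [uK _ fK]] := trig_expand tf.
have bf := trig_bmeas tf; set I := cint (fun t : d.-tuple R => f _).
have -> : cint (fun t : d.-tuple R => h (row_of t) * f (row_of t)) =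
    \sum_(k <- K) hcoef f k * hcoef h k.
  by rewrite -cint_mul_caspoly//; congr cint; apply/funext => t; rewrite -fK.
apply: le_trans (ler_norm_sum _ _ _) _.
rewrite (_ : 2 * eps * I = 2 * I * eps); last by ring.
have I0 : 0 <= 2 * I by rewrite mulr_ge0// cint_ge0// => t; exact: f0.
apply: le_trans (ler_wpM2l I0 (he _ uK)).
rewrite mulr_sumr; apply: ler_sum => k _; rewrite normrM.
by apply: ler_wpM2r => //; exact: normr_hcoef_le.
Qed.

(** Average [h] against a power of [peak x]. Near [x] the error is the oscillation of [h], far away
    it is 2 M q^m. The mean of the power is only polynomially small in m, so q^m is negligible
    against it, and the coefficients account for 2 eps. *)
Lemma small_hcoef_interior (h : 'rV[R]_d -> R) eps x r : cube_continuous h ->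
  (forall J : seq 'rV[int]_d, uniq J -> \sum_(k <- J) `|hcoef h k| <= eps) ->
  0 < r -> (forall j, r <= x ord0 j <= 1 - r) -> `|h x| <= 2 * eps.
Proof.
move=> ch he r0 xr.
have cx : unit_cube x by move=> j; have := xr j; move: r0; lra.
have bh := cube_continuous_bmeas ch.
have [M HM] := cube_continuous_bounded ch.
have M0 : 0 <= M by apply: le_trans (HM x cx).
apply/ler_addgt0Pr => eta eta0.
have eta2 : 0 < eta / 2 by rewrite divr_gt0.
have [r1 r10 Hr1] := ch x cx _ eta2.
pose s := Num.min r1 r.
have s0 : 0 < s by rewrite lt_min r10.
have s1 : s <= r1 by rewrite ge_min lexx.
have sr : s <= r by rewrite ge_min lexx orbT.
have xs j : s <= x ord0 j <= 1 - s by have := xr j; lra.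
have [pi0 s2] : 0 < pi :> R /\ s <= 2^-1.
  by split; [exact: pi_gt0|have := xs (Ordinal d_gt0); lra].
have cs : cos (2 * pi * s) < 1.
  have sp0 : 0 < 2 * pi * s by rewrite !mulr_gt0.
  have sp1 : 2 * pi * s <= pi by rewrite mulrAC ger_pMl//; lra.
  suff : cos (2 * pi * s) < cos 0 by rewrite cos0.
  by rewrite ltr_cos ?in_itv/= ?lexx ?(ltW pi0) ?(ltW sp0).
set q := 1 - (1 - cos (2 * pi * s)) / (2 * d%:R).
have d2 : 0 < 2 * d%:R :> R by rewrite mulr_gt0.
have q01 : 0 <= q < 1.
  have d1 : 1 <= d%:R :> R by rewrite ler1n.
  have c1 := cos_geN1 (2 * pi * s).
  apply/andP; split; last by rewrite /q ltrBlDr ltrDl divr_gt0// subr_gt0.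
  by rewrite /q subr_ge0 ler_pdivrMr// mul1r; lra.
have C0 : 0 <= 4 * (2 * M) by rewrite !mulr_ge0.
have [m hm] := geometric_poly_small d q01 C0 eta2.
pose F y := peak x y ^+ m.
have tF : trig m F by have := trigX m (trig_peak x); rewrite muln1.
have F0 y : unit_cube y -> 0 <= F y by move=> _; rewrite exprn_ge0 ?peak_ge0.
have bF := trig_bmeas tF; set I := cint (fun t : d.-tuple R => F (row_of t)).
(* [F] equals 1 at [x], so the inequality between value and mean bounds the mean from below. *)
have K1 : 1 <= 4 * (2 * m.+1%:R) ^+ d * I.
  have := trig_value_le x tF F0; rewrite {1}/F peakxx expr1n normr1.
  exact.
have K0 : 0 < 4 * (2 * m.+1%:R) ^+ d :> R by rewrite mulr_gt0// exprn_gt0// mulr_gt0.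
have I0 : 0 < I by rewrite -(pmulr_rgt0 _ K0) (lt_le_trans _ K1).
have MqI : 2 * M * q ^+ m <= eta / 2 * I.
  rewrite -(ler_pM2l K0); apply: (@le_trans _ _ (eta / 2 * 1)).
    rewrite mulr1; apply: le_trans hm; rewrite le_eqVlt; apply/orP; left; apply/eqP; ring.
  by rewrite [leRHS]mulrCA ler_pM2l.
have bhF : bmeas (fun t : d.-tuple R => h (row_of t) * F (row_of t)) by exact: bmeasM.
have bxF : bmeas (fun t : d.-tuple R => h x * F (row_of t)) by exact: bmeasZ.
have hF := cint_mul_trig_le tF F0 bh he.
have bd : bmeas (fun t : d.-tuple R => h x * F (row_of t) - h (row_of t) * F (row_of t)).
  exact: bmeasB.
have bg : bmeas (fun t : d.-tuple R => eta / 2 * F (row_of t) + 2 * M * q ^+ m).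
  by apply: bmeasD; [exact: bmeasZ|exact: bmeas_cst].
have diff : `|h x * I - cint (fun t : d.-tuple R => h (row_of t) * F (row_of t))| <= eta * I.
  rewrite -cintZ// -cintB//.
  have : cint (fun t : d.-tuple R => eta / 2 * F (row_of t) + 2 * M * q ^+ m) <= eta * I.
    rewrite cintD ?cint_cst ?cintZ//; last 2 first.
    - exact: bmeasZ.
    - exact: bmeas_cst.
    by rewrite -/I; lra.
  apply: le_trans; rewrite ler_norml -cintN//.
  have H t : cube d t -> `|h x * F (row_of t) - h (row_of t) * F (row_of t)| <=
      eta / 2 * F (row_of t) + 2 * M * q ^+ m.
    move=> ct; rewrite -mulrBl normrM (ger0_norm (F0 _ ct)).
    have [near|] := boolP [forall j, `|x ord0 j - row_of t ord0 j| < s].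
      rewrite -[leLHS]addr0 lerD//; last first.
        by rewrite !mulr_ge0// exprn_ge0//; case/andP: q01.
      rewrite ler_wpM2r ?F0// ltW// Hr1// => j.
      by apply: lt_le_trans s1; move/forallP: near.
    rewrite negb_forall => /existsP[j]; rewrite -leNgt => far.
    rewrite -[leLHS]add0r lerD//; first by rewrite mulr_ge0 ?F0// ltW.
    apply: ler_pM => //; first exact: F0.
      apply: (le_trans (ler_normB _ _)); rewrite mulr2n mulrDl mul1r.
      by rewrite lerD ?HM.
    rewrite /F lerXn2r ?nnegrE ?peak_ge0//; first by case/andP: q01.
    by apply: peak_le => //; exists j.
  apply/andP; split; apply: le_cint => //.
  - exact: bmeasN.
  - by move=> t /H; rewrite ler_norml => /andP[].
  - by move=> t /H; rewrite ler_norml => /andP[].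
rewrite -(ler_pM2r I0) -{1}(ger0_norm (ltW I0)) -normrM.
have -> : h x * I = (h x * I - cint (fun t : d.-tuple R => h (row_of t) * F (row_of t))) +
  cint (fun t : d.-tuple R => h (row_of t) * F (row_of t)) by rewrite subrK.
apply: (le_trans (ler_normD _ _)); rewrite mulrDl addrC lerD//.
Qed.

(** A point near the boundary is contracted towards the centre of the cube by the factor 1 - s, and
    continuity controls the change. *)
Lemma small_hcoef (h : 'rV[R]_d -> R) eps x : cube_continuous h ->
  (forall J : seq 'rV[int]_d, uniq J -> \sum_(k <- J) `|hcoef h k| <= eps) ->
  unit_cube x -> `|h x| <= 2 * eps.
Proof.
move=> ch he cx; apply/ler_addgt0Pr => eta eta0.
have [r r0 H] := ch x cx _ eta0.
pose s := Num.min 1 (r / 2).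
have s0 : 0 < s by rewrite lt_min ltr01 divr_gt0.
have s1 : s <= 1 by rewrite ge_min lexx.
have sr : s < r.
  by apply: (@le_lt_trans _ _ (r / 2)); [rewrite ge_min lexx orbT|lra].
pose y : 'rV[R]_d := \row_j ((1 - s) * x ord0 j + s / 2).
have yE j : y ord0 j = (1 - s) * x ord0 j + s / 2 by rewrite mxE.
have ys j : s / 2 <= y ord0 j <= 1 - s / 2.
  have /andP[x0 x1] := cx j; rewrite yE.
  have h1 : 0 <= (1 - s) * x ord0 j by rewrite mulr_ge0//; lra.
  have h2 : (1 - s) * x ord0 j <= 1 - s by rewrite ler_piMr//; lra.
  by apply/andP; split; lra.
have cy : unit_cube y by move=> j; have := ys j; lra.
have s20 : 0 < s / 2 by rewrite divr_gt0.
have hy := small_hcoef_interior ch he s20 ys.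
have hxy : `|h x - h y| < eta.
  apply: H => // j; rewrite yE; have /andP[x0 x1] := cx j.
  have -> : x ord0 j - ((1 - s) * x ord0 j + s / 2) = s * (x ord0 j - 2^-1) by field.
  rewrite normrM gtr0_norm//; apply: le_lt_trans sr; rewrite ger_pMr//.
  by rewrite ler_norml; apply/andP; split; lra.
have -> : h x = h y + (h x - h y) by rewrite addrC subrK.
by apply: (le_trans (ler_normD _ _)); rewrite lerD// ltW.
Qed.

(** Subtracting the partial sum over [J] removes the coefficients in [J] and leaves the others
    untouched, so smallness of the remaining coefficients passes to the values. No periodicity
    enters. *)
Theorem hartley_inversion (h : 'rV[R]_d -> R) (J : seq 'rV[int]_d) eps x :
  cube_continuous h -> uniq J ->
  (forall J', uniq J' -> (forall k, k \in J' -> k \notin J) ->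
     \sum_(k <- J') `|hcoef h k| <= eps) ->
  unit_cube x -> `|h x - \sum_(k <- J) hcoef h k * cas k x| <= 2 * eps.
Proof.
move=> ch uJ he; pose g x := h x - \sum_(k <- J) hcoef h k * cas k x.
have cJ := cube_continuous_caspoly J (hcoef h).
have gc k : hcoef g k = if k \in J then 0 else hcoef h k.
  rewrite /hcoef /g; under eq_fun do rewrite mulrBl.
  rewrite cintB; last 2 first.
  - by apply: bmeasM; [exact: cube_continuous_bmeas|exact: bmeas_cas].
  - by apply: bmeasM; [exact: (cube_continuous_bmeas cJ)|exact: bmeas_cas].
  rewrite -/(hcoef (fun x => \sum_(k <- J) hcoef h k * cas k x) k) hcoef_caspoly//.
  by case: ifP => _; rewrite ?subrr ?subr0.
apply: (small_hcoef (h := g)); first exact: cube_continuousB.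
move=> J' uJ'; rewrite (bigID (mem J))/= big1 => [|k kJ]; last by rewrite gc kJ normr0.
rewrite add0r -big_filter; apply: le_trans (he [seq k <- J' | k \notin J] _ _).
- rewrite le_eqVlt; apply/orP; left; apply/eqP; rewrite !big_filter.
  by apply: eq_bigr => k /negbTE kJ; rewrite gc kJ.
- exact: filter_uniq.
- by move=> k; rewrite mem_filter => /andP[].
Qed.
End peak.

(** * Recovery from samples *)

Lemma sum_CS (R : realFieldType) (I : Type) (s : seq I) (a c : I -> R) :
  (\sum_(k <- s) a k * c k) ^+ 2 <= (\sum_(k <- s) a k ^+ 2) * (\sum_(k <- s) c k ^+ 2).
Proof.
elim: s => [|i s IH]; first by rewrite !big_nil mul0r expr0n.
rewrite !big_cons.
set A := \sum_(k <- s) a k ^+ 2 in IH *; set C := \sum_(k <- s) c k ^+ 2 in IH *.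
set S := \sum_(k <- s) a k * c k in IH *.
have A0 : 0 <= A by apply: sumr_ge0 => k _; exact: sqr_ge0.
have C0 : 0 <= C by apply: sumr_ge0 => k _; exact: sqr_ge0.
have h : 2 * (a i * c i * S) <= a i ^+ 2 * C + c i ^+ 2 * A.
  have [C00|Cn0] := eqVneq C 0.
    have S0 : S = 0 by apply/eqP; rewrite -sqrf_eq0 eq_le sqr_ge0 andbT; move: IH; rewrite C00 mulr0.
    by rewrite S0 C00 !mulr0 add0r mulr_ge0 ?sqr_ge0.
  have Cp : 0 < C by rewrite lt0r Cn0.
  rewrite -(ler_pM2l Cp).
  have := sqr_ge0 (a i * C - c i * S); have := ler_wpM2l (sqr_ge0 (c i)) IH.
  nra.
nra.
Qed.

Section sampling.
Context {R : realType} {d : nat}.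
Hypothesis d_gt0 : (0 < d)%N.
Implicit Types (k l : 'rV[int]_d) (x y : 'rV[R]_d) (J : seq 'rV[int]_d).

(** The vectors have covariance diag(s^2) by orthonormality. For s = 1 the mean of the form is its
    trace, for s^2 = d it is [wtrace d]. *)
Lemma cint_bform_cas J (s : 'I_(size J) -> R) (P : 'M[R]_(size J)) : uniq J ->
  cint (fun t : d.-tuple R => bform P (\col_i (s i * cas (nth 0 J i) (row_of t)))
                                      (\col_i (s i * cas (nth 0 J i) (row_of t)))) =
  \sum_i s i ^+ 2 * P i i.
Proof.
move=> uJ.
have bm i j : bmeas (fun t : d.-tuple R => cas (nth 0 J i) (row_of t) * cas (nth 0 J j) (row_of t)).
  by apply: bmeasM; exact: bmeas_cas.
transitivity (cint (fun t : d.-tuple R => \sum_(i <- index_enum _) \sum_(j <- index_enum _)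
   (s i * s j * P i j) * (cas (nth 0 J i) (row_of t) * cas (nth 0 J j) (row_of t)))).
  congr cint; apply/funext => t; rewrite bformE; apply: eq_bigr => i _.
  by apply: eq_bigr => j _; rewrite !mxE; ring.
rewrite cint_sum; last by move=> i; apply: bmeas_sum => j; exact: bmeasZ.
apply: eq_bigr => i _.
rewrite cint_sum; last by move=> j; exact: bmeasZ.
rewrite (bigD1 i)//= cintZ// cint_cas_cas eqxx mulr1 big1 ?addr0; first by rewrite expr2.
move=> j ij; rewrite cintZ// cint_cas_cas nth_uniq// -(inj_eq val_inj) eq_sym in ij *.
by rewrite (negbTE ij) mulr0.
Qed.

Lemma bmeas_bform_cas J (s : 'I_(size J) -> R) (P : 'M[R]_(size J)) :
  bmeas (fun t : d.-tuple R => bform P (\col_i (s i * cas (nth 0 J i) (row_of t)))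
                                      (\col_i (s i * cas (nth 0 J i) (row_of t)))).
Proof.
under eq_fun do rewrite bformE.
apply: bmeas_sum => i; apply: bmeas_sum => j; under eq_fun do rewrite !mxE.
apply: bmeasM; last by apply: bmeasZ; exact: bmeas_cas.
by apply: bmeasM; [apply: bmeasZ; exact: bmeas_cas|exact: bmeas_cst].
Qed.

Lemma cint_sqr_caspoly J c : uniq J ->
  cint (fun t : d.-tuple R => (\sum_(k <- J) c k * cas k (row_of t)) ^+ 2) = \sum_(k <- J) c k ^+ 2.
Proof.
move=> uJ; under eq_fun do rewrite expr2.
rewrite (cint_mul_caspoly (h := fun x => \sum_(k <- J) c k * cas k x)); last first.
  exact: bmeas_caspoly.
rewrite big_seq [RHS]big_seq; apply: eq_bigr => k kJ.
by rewrite hcoef_caspoly// kJ expr2.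
Qed.

Variables (lam : 'rV[int]_d -> R) (T : R) (N : nat).
Hypotheses (lam_gt0 : forall k, 0 < lam k) (T_gt0 : 0 < T) (lam0 : 1 <= T * lam 0).
Hypothesis lam_count : forall J, uniq J ->
  \sum_(k <- J) Num.min 1 (T * lam k) <= N%:R / 8.
Hypothesis lam_tail : forall eps, 0 < eps -> exists2 J0 : seq 'rV[int]_d, uniq J0 &
  forall J, uniq J -> (forall k, k \in J -> k \notin J0) -> \sum_(k <- J) lam k <= eps.

Let eps0 := (4 * T)^-1.
Let eps0_gt0 : 0 < eps0. Proof. by rewrite invr_gt0 mulr_gt0. Qed.

Definition weight_min k := Num.min 1 (T * lam k).

Let weight_min_gt0 k : 0 < weight_min k.
Proof. by rewrite lt_min ltr01 mulr_gt0. Qed.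

(** [Box] makes the problem finite and [Lam] holds the frequencies to be reproduced exactly. The
    upper barrier acts on all of [Box], with frequency k scaled by the square root of
    [weight_min k]; undoing this scaling gives the weighted bound of the last clause. *)
Lemma sampling_points : exists (Box : seq 'rV[int]_d) (x : 'I_N -> 'rV[R]_d) (w : 'I_N -> R),
  let Lam := [seq k <- Box | 1 <= T * lam k] in
  [/\ uniq Box,
    forall J, uniq J -> (forall k, k \in J -> k \notin Box) -> \sum_(k <- J) lam k <= eps0,
    (forall i, 0 <= w i) /\ (forall i, unit_cube (x i)),
    forall c : 'cV[R]_(size Lam),
      \sum_k c k 0 ^+ 2 <= \sum_i w i * (\sum_k c k 0 * cas (nth 0 Lam k) (x i)) ^+ 2 &
    forall c : 'rV[int]_d -> R,
      \sum_i w i * (\sum_(k <- Box) c k * cas k (x i)) ^+ 2 <=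
      16 * \sum_(k <- Box) c k ^+ 2 / weight_min k].
Proof.
have [Box uB hB] := lam_tail eps0_gt0.
(* A single frequency outside [Box] has weight at most 1 / (4 T), so it cannot satisfy T lam k >=
   1. *)
have bigB k : 1 <= T * lam k -> k \in Box.
  move=> kT; apply/negPn/negP => kB.
  have := hB [:: k] isT; rewrite big_seq1 => /(_ _)/le_lt_trans h.
  have : lam k < T^-1.
    apply: h => [l|]; first by rewrite inE => /eqP ->.
    by rewrite /eps0 ltf_pV2 ?posrE ?mulr_gt0// ltr_pMl// ltr1n.
  by rewrite -(ltr_pM2l T_gt0) divff ?gt_eqF// ltNge kT.
set Lam := [seq k <- Box | 1 <= T * lam k].
have uL : uniq Lam by rewrite filter_uniq.
have L0 : 0 \in Lam by rewrite mem_filter lam0 bigB.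
have m0 : (0 < size Lam)%N by case: (Lam) L0.
have mN : (size Lam)%:R <= N%:R / 8 :> R.
  apply: le_trans (lam_count uL).
  rewrite big_seq (eq_bigr (fun=> 1)) => [|k]; last first.
    by rewrite mem_filter => /andP[kT _]; rewrite (min_idPl kT).
  by rewrite -big_seq big_const_seq count_predT iter_addr_0.
pose dd (i : 'I_(size Box)) := weight_min (nth 0 Box i).
have d01 i : 0 <= dd i <= 1 by rewrite ltW ?weight_min_gt0//= ge_min lexx.
have iB : (index (0%R : 'rV[int]_d) Box < size Box)%N by rewrite index_mem bigB.
have dpos : exists i, 0 < dd i by exists (Ordinal iB); exact: weight_min_gt0.
have dN : \sum_i dd i <= N%:R / 8.
  by have := lam_count uB; rewrite (big_nth 0) big_mkord.
pose a (x : {x : 'rV[R]_d | unit_cube x}) := \col_(i < size Lam) (1 * cas (nth 0 Lam i) (sval x)).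
pose v (x : {x : 'rV[R]_d | unit_cube x}) := \col_(i < size Box) (Num.sqrt (dd i) * cas (nth 0 Box i) (sval x)).
have mean (P : 'M[R]_(size Lam)) (Q : 'M[R]_(size Box)) : wtrace dd Q < \tr P ->
    exists t, bform Q (v t) (v t) < bform P (a t) (a t).
  (* If every point of the cube failed, integrating the reverse inequality would contradict [QP]. *)
  move=> QP; apply/not_existsP => H; move: QP; apply/negP; rewrite -leNgt.
  have := @cint_bform_cas Lam (fun=> 1) P uL.
  rewrite (eq_bigr (fun i => P i i)) => [E1|i _]; last by rewrite expr1n mul1r.
  have := @cint_bform_cas Box (fun i => Num.sqrt (dd i)) Q uB.
  rewrite (eq_bigr (fun i => dd i * Q i i)) => [E2|i _]; last first.
    by rewrite sqr_sqrtr//; case/andP: (d01 i).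
  rewrite /mxtrace /wtrace -E1 -E2; apply: le_cint; try exact: bmeas_bform_cas.
  move=> t ct; rewrite leNgt; apply/negP; exact: (H (exist _ (row_of t) ct)).
have [x [w [w0 h1 h2]]] := weighted_selection d01 dpos m0 mN dN mean.
exists Box, (fun i => sval (x i)), w; split=> //.
- by split=> // i; exact: (svalP (x i)).
- move=> c; apply: le_trans (h1 c) _; rewrite le_eqVlt; apply/orP; left; apply/eqP.
  apply: eq_bigr => i _; congr (_ * _ ^+ 2); rewrite mxE; apply: eq_bigr => k _.
  by rewrite !mxE mul1r mulrC.
move=> c; pose b := \col_(i < size Box) (c (nth 0 Box i) / Num.sqrt (dd i)).
apply: le_trans (le_trans (h2 b) _).
  rewrite le_eqVlt; apply/orP; left; apply/eqP.
  apply: eq_bigr => i _; congr (_ * _ ^+ 2).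
  rewrite (big_nth 0) big_mkord mxE; apply: eq_bigr => k _.
  by rewrite !mxE; field; rewrite gt_eqF// sqrtr_gt0 weight_min_gt0.
rewrite ler_pM2l// (big_nth 0) big_mkord le_eqVlt; apply/orP; left; apply/eqP.
apply: eq_bigr => i _; rewrite mxE expr_div_n sqr_sqrtr//.
by case/andP: (d01 i).
Qed.

(** Write u = p + hM + r with frequencies in [Lam], in the rest of [Box], and outside. Least squares
    reproduces [p] exactly, so the error is q - s, where q = hM + r and [s] is the answer to the
    samples of [q] alone. The term [hM] is controlled by the upper barrier, [r] uniformly. *)
Theorem sampling_recovery : exists (x : 'I_N -> 'rV[R]_d) (g : 'I_N -> 'rV[R]_d -> R),
  [/\ forall i, unit_cube (x i), forall i, cube_continuous (g i) &
    forall (u : 'rV[R]_d -> R) B, cube_continuous u ->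
      (forall J, uniq J -> \sum_(k <- J) hcoef u k ^+ 2 / lam k <= B) ->
      cint (fun t : d.-tuple R =>
        (u (row_of t) - \sum_i u (x i) * g i (row_of t)) ^+ 2) <= 136 * B / T].
Proof.
have [Box [x [w]]] := sampling_points.
set Lam := [seq k <- Box | _] => -[uB hB [w0 cx] hL hBox].
have uL : uniq Lam by rewrite filter_uniq.
pose E : 'M[R]_(N, size Lam) := \matrix_(i, k) cas (nth 0 Lam k) (x i).
have EcE (c : 'cV[R]_(size Lam)) i : (E *m c) i 0 = \sum_k c k 0 * cas (nth 0 Lam k) (x i).
  by rewrite mxE; apply: eq_bigr => k _; rewrite mxE mulrC.
have [Z ZE hZ] : exists2 Z : 'M[R]_(size Lam, N), Z *m E = 1%:M &
    forall y : 'cV[R]_N, \sum_k (Z *m y) k 0 ^+ 2 <= \sum_i w i * y i 0 ^+ 2.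
  apply: least_squares => // c; apply: (le_trans (hL c)).
  by under [leRHS]eq_bigr do rewrite EcE.
pose g i y := \sum_(k < size Lam) Z k i * cas (nth 0 Lam k) y.
exists x, g; split=> //.
  move=> i; apply/cube_continuousP/continuous_subspaceT/continuous_sum_seq => k y.
  by apply: continuousM; [exact: cst_continuous|exact: continuous_cas].
move=> u B cu hu.
have B0 : 0 <= B by have := hu [::] isT; rewrite big_nil.
pose b := hcoef u.
pose M := [seq k <- Box | T * lam k < 1].
have uM : uniq M by rewrite filter_uniq.
pose hM x := \sum_(k <- M) b k * cas k x.
pose p x := \sum_(k <- Lam) b k * cas k x.
pose r x := u x - \sum_(k <- Box) b k * cas k x.
have BoxE (f : 'rV[int]_d -> R) :
    \sum_(k <- Box) f k = \sum_(k <- Lam) f k + \sum_(k <- M) f k.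
  rewrite /Lam /M !big_filter [LHS](bigID (fun k => 1 <= T * lam k))/=; congr (_ + _).
  by apply: eq_bigl => k; rewrite -ltNge.
have bl k : b k ^+ 2 = lam k * (b k ^+ 2 / lam k) by field; rewrite gt_eqF.
(* Cauchy-Schwarz bounds the sum of |b k| outside [Box] by sqrt(B / (4 T)); the 4 in [eps0] pays for
   the factor 2 of the inversion theorem. *)
have rle y : unit_cube y -> `|r y| ^+ 2 <= B / T.
  move=> cy; have tail J' : uniq J' -> (forall k, k \in J' -> k \notin Box) ->
      \sum_(k <- J') `|b k| <= Num.sqrt (B / T) / 2.
    move=> uJ' J'B.
    have sB : 0 <= Num.sqrt (B / T) / 2 by rewrite divr_ge0 ?sqrtr_ge0.
    rewrite -(@ler_pXn2r _ 2)// ?nnegrE ?sumr_ge0//.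
    rewrite expr_div_n sqr_sqrtr ?divr_ge0 ?(ltW T_gt0)//.
    apply: le_trans (_ : _ <= (\sum_(k <- J') lam k) * (\sum_(k <- J') b k ^+ 2 / lam k)) _.
      have CS (a c : 'rV[int]_d -> R) (s : seq 'rV[int]_d) :
         (\sum_(k <- s) a k * c k) ^+ 2 <= (\sum_(k <- s) a k ^+ 2) * (\sum_(k <- s) c k ^+ 2).
        exact: sum_CS.
      have := CS (fun k => Num.sqrt (lam k)) (fun k => `|b k| / Num.sqrt (lam k)) J'.
      rewrite (eq_bigr (fun k => `|b k|)) => [|k _]; last first.
        by field; rewrite gt_eqF// sqrtr_gt0.
      under [X in _ <= X * _]eq_bigr do rewrite sqr_sqrtr ?ltW//.
      by under [X in _ <= _ * X]eq_bigr do rewrite expr_div_n sqr_sqrtr ?(ltW (lam_gt0 _))// real_normK ?num_real//.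
    apply: (@le_trans _ _ (eps0 * B)).
      apply: ler_pM => //.
      - by apply: sumr_ge0 => k _; exact: ltW.
      - by apply: sumr_ge0 => k _; rewrite divr_ge0 ?sqr_ge0 ?ltW.
      - exact: hB.
      - exact: hu.
    by rewrite le_eqVlt /eps0; apply/orP; left; apply/eqP; field; rewrite gt_eqF.
  have := hartley_inversion d_gt0 cu uB tail cy.
  rewrite -/(r y) mulrCA divff// mulr1 => h.
  apply: (@le_trans _ _ (Num.sqrt (B / T) ^+ 2)).
    by rewrite lerXn2r ?nnegrE ?sqrtr_ge0.
  by rewrite sqr_sqrtr// divr_ge0 ?(ltW T_gt0).
have uE y : u y = p y + (hM y + r y) by rewrite /r BoxE /p /hM; ring.
pose q y := hM y + r y.
pose qv : 'cV[R]_N := \col_i q (x i).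
pose z := Z *m qv.
pose s y := \sum_(k < size Lam) z k 0 * cas (nth 0 Lam k) y.
have errE y : u y - \sum_i u (x i) * g i y = q y - s y.
  pose pv : 'cV[R]_(size Lam) := \col_k b (nth 0 Lam k).
  pose uv : 'cV[R]_N := \col_i u (x i).
  have uvE : Z *m uv = pv + z.
    have -> : uv = E *m pv + qv.
      apply/colP => i; rewrite [RHS]mxE EcE !mxE uE; congr (_ + _).
      by rewrite /p (big_nth 0) big_mkord; apply: eq_bigr => k _; rewrite mxE.
    by rewrite mulmxDr mulmxA ZE mul1mx.
  have -> : \sum_i u (x i) * g i y = \sum_(k < size Lam) (Z *m uv) k 0 * cas (nth 0 Lam k) y.
    rewrite /g; under eq_bigr do rewrite mulr_sumr.
    rewrite exchange_big/=; apply: eq_bigr => k _.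
    by rewrite mxE mulr_suml; apply: eq_bigr => i _; rewrite mxE; ring.
  rewrite uvE uE -/(q y) (eq_bigr (fun k : 'I_(size Lam) => b (nth 0 Lam k) * cas (nth 0 Lam k) y +
     z k 0 * cas (nth 0 Lam k) y)); last by move=> k _; rewrite !mxE mulrDl.
  rewrite big_split/= -/(s y) (_ : \sum_i _ = p y); first by ring.
  by rewrite /p (big_nth 0) big_mkord.
have sqrD (a c : R) : (a + c) ^+ 2 <= 2 * a ^+ 2 + 2 * c ^+ 2.
  by have := sqr_ge0 (a - c); nra.
have sumM : \sum_(k <- M) b k ^+ 2 <= B / T.
  rewrite ler_pdivlMr// mulrC; apply: le_trans (hu M uM).
  rewrite mulr_sumr big_seq [leRHS]big_seq; apply: ler_sum => k.
  rewrite mem_filter => /andP[kT _]; rewrite -/(b k) {1}bl [leLHS]mulrA.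
  have b0 : 0 <= b k ^+ 2 / lam k by rewrite divr_ge0 ?sqr_ge0// ltW.
  by have := ler_wpM2r b0 (ltW kT); rewrite mul1r.
(* On [M] the minimum is T lam k, so dividing by it produces the terms of the norm over T. *)
have hMw : \sum_i w i * hM (x i) ^+ 2 <= 16 * (B / T).
  pose c k := if T * lam k < 1 then b k else 0.
  have hME y : hM y = \sum_(k <- Box) c k * cas k y.
    rewrite /hM big_filter big_mkcond; apply: eq_bigr => k _.
    by rewrite /c; case: ifP => //; rewrite mul0r.
  under eq_bigr do rewrite hME.
  apply: le_trans (hBox c) _; rewrite ler_pM2l// ler_pdivlMr//.
  apply: le_trans (hu _ uM).
  rewrite mulr_suml big_filter [leRHS]big_mkcond; apply: ler_sum => k _.
  rewrite /c /weight_min; case: ifP => [kT|_]; last by rewrite expr0n/= !mul0r.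
  rewrite (min_idPr (ltW kT)) le_eqVlt; apply/orP; left; apply/eqP; rewrite /b; field.
  by rewrite !gt_eqF.
(* The discrete bound tested on the constant function, frequency 0 having [weight_min] equal to 1.
   It is needed for the samples of the uniformly small [r]. *)
have W16 : \sum_i w i <= 16.
  pose c k : R := (k == 0)%:R.
  have zB : 0 \in Box.
    apply/negPn/negP => zB; have := hB [:: 0] isT; rewrite big_seq1.
    have h0 : forall k : 'rV[int]_d, k \in [:: 0] -> k \notin Box by move=> k; rewrite inE => /eqP ->.
    move=> /(_ h0); rewrite /eps0 -(ler_pM2l T_gt0) => h.
    have := le_trans lam0 h; rewrite invfM mulrCA divff ?gt_eqF// mulr1.
    by move=> {}h; move: h; lra.
  have cE (f : 'rV[int]_d -> R) : (forall k, k != 0 -> f k = 0) -> \sum_(k <- Box) f k = f 0.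
    move=> f0; rewrite (big_rem 0)//= big_seq big1 ?addr0// => k.
    by rewrite mem_rem_uniq// inE => /andP[k0 _]; exact: f0.
  have := hBox c; rewrite [X in _ <= 16 * X]cE; last first.
    by move=> k /negbTE k0; rewrite /c k0 expr0n/= mul0r.
  rewrite /c eqxx expr1n /weight_min (min_idPl lam0) divr1 mulr1.
  apply: le_trans; rewrite le_eqVlt; apply/orP; left; apply/eqP.
  apply: eq_bigr => i _; rewrite cE; last by move=> k /negbTE ->; rewrite mul0r.
  by rewrite eqxx mul1r /cas phase0 cos0 sin0 addr0 expr1n mulr1.
(* 64 is 2 times 16 for [hM] plus 2 times 16 for [r]. *)
have zle : \sum_k z k 0 ^+ 2 <= 64 * (B / T).
  apply: le_trans (hZ qv) _.
  apply: (@le_trans _ _ (2 * \sum_i w i * hM (x i) ^+ 2 + 2 * ((\sum_i w i) * (B / T)))).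
    rewrite mulr_suml !mulr_sumr -big_split/=; apply: ler_sum => i _.
    have := ler_wpM2l (w0 i) (sqrD (hM (x i)) (r (x i))).
    have := ler_wpM2l (w0 i) (rle _ (cx i)); rewrite real_normK ?num_real//.
    by rewrite !mxE /q; lra.
  have BT0 : 0 <= B / T by rewrite divr_ge0// ltW.
  by have := ler_wpM2r BT0 W16; lra.
have bhM : bmeas (fun t : d.-tuple R => hM (row_of t)) by exact: bmeas_caspoly.
have cr : cube_continuous r by apply: cube_continuousB => //; exact: cube_continuous_caspoly.
have br := cube_continuous_bmeas cr.
have cs : cube_continuous s.
  apply/cube_continuousP/continuous_subspaceT/continuous_sum_seq => k y.
  by apply: continuousM; [exact: cst_continuous|exact: continuous_cas].
have bs := cube_continuous_bmeas cs.
have bM2 : bmeas (fun t : d.-tuple R => hM (row_of t) ^+ 2).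
  by under eq_fun do rewrite expr2; exact: bmeasM.
have bs2 : bmeas (fun t : d.-tuple R => s (row_of t) ^+ 2).
  by under eq_fun do rewrite expr2; exact: bmeasM.
have hM2 : cint (fun t : d.-tuple R => hM (row_of t) ^+ 2) <= B / T.
  by rewrite cint_sqr_caspoly.
have s2 : cint (fun t : d.-tuple R => s (row_of t) ^+ 2) <= 64 * (B / T).
  apply: le_trans zle.
  (* For the all-ones matrix the form is the square of the sum of the entries, here s(y)^2. *)
  have := @cint_bform_cas Lam (fun k : 'I_(size Lam) => z k 0) (const_mx 1) uL.
  rewrite [X in _ = X](eq_bigr (fun k : 'I_(size Lam) => z k 0 ^+ 2)) => [<-|k _]; last by rewrite [const_mx _ _ _]mxE mulr1.
  rewrite le_eqVlt; apply/orP; left; apply/eqP; congr cint; apply/funext => t.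
  rewrite bformE /s expr2 mulr_suml; apply: eq_bigr => k _.
  rewrite mulr_sumr; apply: eq_bigr => j _.
  by rewrite [const_mx _ _ _]mxE mulr1 [(\col__ _) k 0]mxE [(\col__ _) j 0]mxE.
have bq : bmeas (fun t : d.-tuple R => (q (row_of t) - s (row_of t)) ^+ 2).
  under eq_fun do rewrite expr2.
  by apply: bmeasM; (apply: bmeasB => //; exact: bmeasD).
under eq_fun do rewrite errE.
(* The three terms contribute 4, 2 times 64 and 4, whence 136. *)
apply: (@le_trans _ _ (cint (fun t : d.-tuple R => (4 * hM (row_of t) ^+ 2 + 2 * s (row_of t) ^+ 2) + 4 * (B / T)))).
  apply: le_cint => //.
    by apply: bmeasD; [apply: bmeasD; exact: bmeasZ|exact: bmeas_cst].
  move=> t ct; have := rle _ ct; rewrite real_normK ?num_real// => h1.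
  have h2 := sqrD (hM (row_of t)) (r (row_of t)).
  have h3 := sqrD (q (row_of t)) (- s (row_of t)); rewrite sqrrN in h3.
  by rewrite /q in h3 *; lra.
rewrite cintD ?cint_cst; last 2 first.
- by apply: bmeasD; exact: bmeasZ.
- exact: bmeas_cst.
rewrite cintD; [|exact: bmeasZ..].
rewrite !cintZ//; lra.
Qed.
End sampling.

(** * Complex functions and the unit ball of the space *)

Import ComplexField.Normc.
Local Open Scope complex_scope.

Lemma poweR_half_le (R : realType) (x : \bar R) (y : R) : (0 <= x)%E -> 0 <= y ->
  (x `^ 2^-1 <= y%:E)%E = (x <= (y ^+ 2)%:E)%E.
Proof.
case: x => [r| |]//.
  rewrite lee_fin => r0 y0; rewrite poweR_EFin powR12_sqrt// !lee_fin.
  by rewrite -(@ler_pXn2r _ 2) ?nnegrE ?sqrtr_ge0// sqr_sqrtr.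
by move=> _ y0; rewrite poweRyr ?invr_eq0// !leye_eq.
Qed.

Lemma sqr_normc (R : realType) (z : R[i]) :
  normc z ^+ 2 = complex.Re z ^+ 2 + complex.Im z ^+ 2.
Proof. by case: z => a b; rewrite /normc sqr_sqrtr// addr_ge0 ?sqr_ge0. Qed.

Lemma normr_Re_le (R : realType) (z : R[i]) : `|complex.Re z| <= normc z.
Proof.
rewrite -(@ler_pXn2r _ 2) ?nnegrE//; last by case: z => a b; exact: sqrtr_ge0.
by rewrite sqr_normc real_normK ?num_real// lerDl sqr_ge0.
Qed.

Lemma normr_Im_le (R : realType) (z : R[i]) : `|complex.Im z| <= normc z.
Proof.
rewrite -(@ler_pXn2r _ 2) ?nnegrE//; last by case: z => a b; exact: sqrtr_ge0.
by rewrite sqr_normc real_normK ?num_real// lerDr sqr_ge0.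
Qed.

Lemma complex_ext (R : realType) (z w : R[i]) :
  complex.Re z = complex.Re w -> complex.Im z = complex.Im w -> z = w.
Proof. by case: z w => a b [c e] /= -> ->. Qed.

Section Hball.
Context {R : realType} {d : nat}.
Implicit Types (k : 'rV[int]_d) (x y : 'rV[R]_d) (f : 'rV[R]_d -> R[i]).

Lemma within_continuous_normc f :
  {within unit_cube, continuous (f : 'rV[R]_d -> R[i]^o)} <->
  forall x, unit_cube x -> forall e, 0 < e ->
  exists2 r, 0 < r & forall y, unit_cube y ->
    (forall j, `|x ord0 j - y ord0 j| < r) -> normc (f x - f y) < e.
Proof.
split.
  move=> /subspace_continuousP cf x cx e e0; apply/near_rowP.
  have e0' : 0 < e%:C by rewrite ltcR.
  have /cvgrPdist_lt/(_ _ e0') := cf x cx.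
  by apply: filterS => y; rewrite (_ : `|_| = (normc (f x - f y))%:C)// ltcR.
move=> H; apply/subspace_continuousP => x cx; apply/cvgrPdist_lt => e e0.
have eE : e = (complex.Re e)%:C.
  by apply: complex_ext => //=; move: e0; rewrite ltcE => /andP[/eqP ->].
have e0' : 0 < complex.Re e by move: e0; rewrite eE ltcR.
apply/near_rowP; have [r r0 Hr] := H x cx _ e0'; exists r => // y cy xy.
by rewrite (_ : `|_| = (normc (f x - f y))%:C)// eE ltcR; exact: Hr.
Qed.

Lemma Re_cube_continuous f : {within unit_cube, continuous (f : 'rV[R]_d -> R[i]^o)} ->
  cube_continuous (fun x => complex.Re (f x)).
Proof.
move=> /within_continuous_normc H x cx e e0; have [r r0 Hr] := H x cx e e0.
exists r => // y cy xy; apply: le_lt_trans (Hr y cy xy).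
apply: le_trans (normr_Re_le _); by case: (f x) (f y) => a b [].
Qed.

Lemma Im_cube_continuous f : {within unit_cube, continuous (f : 'rV[R]_d -> R[i]^o)} ->
  cube_continuous (fun x => complex.Im (f x)).
Proof.
move=> /within_continuous_normc H x cx e e0; have [r r0 Hr] := H x cx e e0.
exists r => // y cy xy; apply: le_lt_trans (Hr y cy xy).
apply: le_trans (normr_Im_le _); by case: (f x) (f y) => a b [].
Qed.

Lemma cube_integralE f : cube_integral f =
  cint (fun t : d.-tuple R => complex.Re (f (row_of t))) +i*
  cint (fun t : d.-tuple R => complex.Im (f (row_of t))).
Proof. by []. Qed.

Lemma fourier_coefE f k : fourier_coef f k =
  cint (fun t : d.-tuple R => complex.Re (f (row_of t)) * cos (phase k (row_of t)) +
                              complex.Im (f (row_of t)) * sin (phase k (row_of t))) +i*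
  cint (fun t : d.-tuple R => complex.Im (f (row_of t)) * cos (phase k (row_of t)) -
                              complex.Re (f (row_of t)) * sin (phase k (row_of t))).
Proof.
rewrite /fourier_coef cube_integralE; congr (_ +i* _); congr cint; apply/funext => t;
rewrite -/(phase k (row_of t)) /expi cosN sinN; case: (f (row_of t)) => a b /=; ring.
Qed.

(** In terms of the cosine and sine integrals of both parts, the right side is twice the sum of the
    four squares, and each Hartley coefficient is a sum of two of these integrals. *)
Lemma hcoef_Re_Im_le f k : {within unit_cube, continuous (f : 'rV[R]_d -> R[i]^o)} ->
  hcoef (fun x => complex.Re (f x)) k ^+ 2 + hcoef (fun x => complex.Im (f x)) k ^+ 2 <=
  normc (fourier_coef f k) ^+ 2 + normc (fourier_coef f (- k)) ^+ 2.
Proof.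
move=> cf; have bu := cube_continuous_bmeas (Re_cube_continuous cf).
have bv := cube_continuous_bmeas (Im_cube_continuous cf).
pose u t : R := complex.Re (f (row_of t)); pose v t : R := complex.Im (f (row_of t)).
have bc (h : d.-tuple R -> R) : bmeas h -> bmeas (fun t => h t * cos (phase k (row_of t))).
  move=> bh; apply: bmeasM => //.
  rewrite (_ : (fun _ => _) = fun t : d.-tuple R => cos (0 + phase k (row_of t))).
    exact: bmeas_cos.
  by apply/funext => t; rewrite add0r.
have bs (h : d.-tuple R -> R) : bmeas h -> bmeas (fun t => h t * sin (phase k (row_of t))).
  move=> bh; apply: bmeasM => //.
  rewrite (_ : (fun _ => _) = fun t : d.-tuple R => - cos (pi / 2 + phase k (row_of t))).
    by apply: bmeasN; exact: bmeas_cos.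
  by apply/funext => t; rewrite addrC cosDpihalf opprK.
pose uc := cint (fun t : d.-tuple R => u t * cos (phase k (row_of t))).
pose us := cint (fun t : d.-tuple R => u t * sin (phase k (row_of t))).
pose vc := cint (fun t : d.-tuple R => v t * cos (phase k (row_of t))).
pose vs := cint (fun t : d.-tuple R => v t * sin (phase k (row_of t))).
have hu : hcoef (fun x => complex.Re (f x)) k = uc + us.
  rewrite -cintD; [|exact: bc|exact: bs].
  by congr cint; apply/funext => t; rewrite /cas mulrDr.
have hv : hcoef (fun x => complex.Im (f x)) k = vc + vs.
  rewrite -cintD; [|exact: bc|exact: bs].
  by congr cint; apply/funext => t; rewrite /cas mulrDr.
have fk : fourier_coef f k = (uc + vs) +i* (vc - us).
  rewrite fourier_coefE; congr (_ +i* _).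
    by rewrite -cintD//; [exact: bc|exact: bs].
  by rewrite -cintB//; [exact: bc|exact: bs].
have fNk : fourier_coef f (- k) = (uc - vs) +i* (vc + us).
  rewrite fourier_coefE; congr (_ +i* _).
    rewrite -cintB//; [|exact: bc|exact: bs].
    by congr cint; apply/funext => t; rewrite !phaseN cosN sinN mulrN.
  rewrite -cintD//; [|exact: bc|exact: bs].
  by congr cint; apply/funext => t; rewrite !phaseN cosN sinN mulrN opprK.
rewrite !sqr_normc hu hv fk fNk /=.
by have := sqr_ge0 (uc - us); have := sqr_ge0 (vc - vs); nra.
Qed.

Lemma L2_normE f : bmeas (fun t : d.-tuple R => complex.Re (f (row_of t))) ->
  bmeas (fun t : d.-tuple R => complex.Im (f (row_of t))) ->
  L2_norm f = (Num.sqrt (cint (fun t : d.-tuple R => complex.Re (f (row_of t)) ^+ 2) +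
                         cint (fun t : d.-tuple R => complex.Im (f (row_of t)) ^+ 2)))%:E.
Proof.
move=> bu bv.
have bu2 : bmeas (fun t : d.-tuple R => complex.Re (f (row_of t)) ^+ 2).
  by under eq_fun do rewrite expr2; exact: bmeasM.
have bv2 : bmeas (fun t : d.-tuple R => complex.Im (f (row_of t)) ^+ 2).
  by under eq_fun do rewrite expr2; exact: bmeasM.
rewrite /L2_norm.
under eq_integral do rewrite sqr_normc.
rewrite [X in (X `^ _)%E]EFin_cint; last exact: bmeasD.
rewrite cintD// poweR_EFin powR12_sqrt// addr_ge0//.
- by apply: cint_ge0 => t _; exact: sqr_ge0.
- by apply: cint_ge0 => t _; exact: sqr_ge0.
Qed.

Section ball.
Variable (lambda : ell1_weight R d).
Hypothesis lambda_gt0 : forall k, 0 < lambda k.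

Let support_lambda : [set k | lambda k != 0] = setT.
Proof. by apply/seteqP; split=> k //= _; rewrite gt_eqF. Qed.

Lemma H_norm_le f (B : R) : 0 <= B ->
  (forall J : seq 'rV[int]_d, uniq J ->
     \sum_(k <- J) normc (fourier_coef f k) ^+ 2 / lambda k <= B ^+ 2) <->
  (H_norm lambda f <= B%:E)%E.
Proof.
move=> B0; rewrite /H_norm support_lambda.
have t0 k : 0 <= normc (fourier_coef f k) ^+ 2 / lambda k.
  by rewrite divr_ge0 ?sqr_ge0// ltW.
have e0 : (0 <= \esum_(k in [set: 'rV[int]_d]) (normc (fourier_coef f k) ^+ 2 / lambda k)%:E)%E.
  by apply: esum_ge0 => k _; rewrite lee_fin.
rewrite poweR_half_le//; split.
  move=> H; apply: ge_ereal_sup => _ [A [finA _] <-].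
  rewrite fsbig_finite//= sumEFin lee_fin; apply: H.
  exact: finmap.fset_uniq.
move=> H J uJ; rewrite -lee_fin; apply: le_trans H.
apply: esum_ge; exists [set` J]; first by split; [exact: finite_seq|exact: subsetT].
by rewrite -fsbig_seq// sumEFin.
Qed.

Hypothesis lambdaN : forall k, lambda (- k) = lambda k.

(** [J] and its mirror image each carry at most 1 of the squared norm, hence the 2; evenness of
    [lambda] lets k and -k share a weight. *)
Lemma H_ball_hcoef f J : H_ball lambda f -> uniq J ->
  \sum_(k <- J) hcoef (fun x => complex.Re (f x)) k ^+ 2 / lambda k <= 2 /\
  \sum_(k <- J) hcoef (fun x => complex.Im (f x)) k ^+ 2 / lambda k <= 2.
Proof.
move=> [[cf _ _] nf] uJ.
have Hf := (H_norm_le f ler01).2 nf.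
have uNJ : uniq [seq - k | k <- J] by rewrite map_inj_uniq//; exact: oppr_inj.
have : \sum_(k <- J) (hcoef (fun x => complex.Re (f x)) k ^+ 2 / lambda k +
                      hcoef (fun x => complex.Im (f x)) k ^+ 2 / lambda k) <= 2.
  apply: (@le_trans _ _ (\sum_(k <- J) normc (fourier_coef f k) ^+ 2 / lambda k +
     \sum_(k <- [seq - k | k <- J]) normc (fourier_coef f k) ^+ 2 / lambda k)); last first.
    have := Hf _ uJ; have := Hf _ uNJ; rewrite expr1n; lra.
  rewrite big_map -big_split/=; apply: ler_sum => k _.
  rewrite lambdaN -!mulrDl ler_wpM2r ?invr_ge0 ?(ltW (lambda_gt0 _))//.
  exact: hcoef_Re_Im_le.
rewrite big_split/=.
have p1 : 0 <= \sum_(k <- J) hcoef (fun x => complex.Re (f x)) k ^+ 2 / lambda k.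
  by apply: sumr_ge0 => k _; rewrite divr_ge0 ?sqr_ge0 ?ltW.
have p2 : 0 <= \sum_(k <- J) hcoef (fun x => complex.Im (f x)) k ^+ 2 / lambda k.
  by apply: sumr_ge0 => k _; rewrite divr_ge0 ?sqr_ge0 ?ltW.
by move=> h; split; lra.
Qed.

(** Real recovery functions act on real and imaginary part separately. Each part has B = 2 and
    squared error at most 136 times 2 / T, and 544 is twice 272. *)
Theorem g_n_le (T : R) (N : nat) : (0 < d)%N -> 0 < T -> 1 <= T * lambda 0 ->
  (forall J, uniq J -> \sum_(k <- J) Num.min 1 (T * lambda k) <= N%:R / 8) ->
  (forall eps, 0 < eps -> exists2 J0 : seq 'rV[int]_d, uniq J0 &
     forall J, uniq J -> (forall k, k \in J -> k \notin J0) ->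
     \sum_(k <- J) lambda k <= eps) ->
  (g_n lambda N <= (Num.sqrt (544 / T))%:E)%E.
Proof.
move=> d0 T0 T1 hcount htail.
have [x [g [cx cg H]]] := sampling_recovery d0 lambda_gt0 T0 T1 hcount htail.
pose gc i y : R[i] := (g i y)%:C.
have bg i := cube_continuous_bmeas (cg i).
apply: le_trans (ereal_inf_lbound _) _.
  exists x => //; exists gc; last by [].
  move=> i; split.
  - by have [] := bg i.
  - exact: measurable_cst.
  - rewrite L2_normE ?ltry//; first exact: bg.
    exact: bmeas_cst.
apply: ge_ereal_sup => _ [f Hf <-].
have [[cf _ _] _] := Hf.
pose u x := complex.Re (f x); pose v x := complex.Im (f x).
have cu : cube_continuous u := Re_cube_continuous cf.
have cv : cube_continuous v := Im_cube_continuous cf.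
have ReE y : complex.Re (f y - \sum_(i < N) f (x i) * gc i y) = u y - \sum_i u (x i) * g i y.
  have -> (z w : R[i]) : complex.Re (z - w) = complex.Re z - complex.Re w by case: z w => ? ? [].
  congr (_ - _); rewrite raddf_sum/=; apply: eq_bigr => i _.
  by rewrite /u; case: (f (x i)) => a b /=; ring.
have ImE y : complex.Im (f y - \sum_(i < N) f (x i) * gc i y) = v y - \sum_i v (x i) * g i y.
  have -> (z w : R[i]) : complex.Im (z - w) = complex.Im z - complex.Im w by case: z w => ? ? [].
  congr (_ - _); rewrite raddf_sum/=; apply: eq_bigr => i _.
  by rewrite /v; case: (f (x i)) => a b /=; ring.
have b1 (h : 'rV[R]_d -> R) : cube_continuous h ->
    bmeas (fun t : d.-tuple R => h (row_of t) - \sum_i h (x i) * g i (row_of t)).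
  move=> ch; apply: bmeasB; first exact: cube_continuous_bmeas.
  by apply: bmeas_sum => i; apply: bmeasZ; exact: bg.
rewrite L2_normE.
- rewrite lee_fin ler_sqrt; last by rewrite divr_ge0 ?ler0n ?(ltW T0).
  under eq_fun do rewrite ReE.
  under [X in _ + cint X <= _]eq_fun do rewrite ImE.
  have h1 := H u 2 cu (fun J uJ => (H_ball_hcoef Hf uJ).1).
  have h2 := H v 2 cv (fun J uJ => (H_ball_hcoef Hf uJ).2).
  apply: le_trans (lerD h1 h2) _; rewrite le_eqVlt; apply/orP; left; apply/eqP; field.
  by rewrite gt_eqF.
- by under eq_fun do rewrite ReE; exact: b1.
- by under eq_fun do rewrite ImE; exact: b1.
Qed.

End ball.
End Hball.

(** * Quadrature from recovery *)

Section integration_below_recovery.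
Context {R : realType} {d : nat}.
Implicit Types (x y : 'rV[R]_d) (f g : 'rV[R]_d -> R[i]).
Let mu := lebesgue_tuple (R := R) d.

Definition cube_integrable f :=
  mu.-integrable (cube d) (EFin \o (fun t => complex.Re (f (row_of t)))) /\
  mu.-integrable (cube d) (EFin \o (fun t => complex.Im (f (row_of t)))).

Let mcube := @measurable_cube R d.

Let measurable_of_integrable (h : d.-tuple R -> R) :
  mu.-integrable (cube d) (EFin \o h) -> measurable_fun (cube d) h.
Proof. by move=> /integrableP[/measurable_EFinP]. Qed.

Let integrableZ (c : R) (h : d.-tuple R -> R) : mu.-integrable (cube d) (EFin \o h) ->
  mu.-integrable (cube d) (EFin \o (fun t => c * h t)).
Proof. by move=> ih; exact: (integrableZl mcube c ih). Qed.

Let integrableD2 (h g : d.-tuple R -> R) : mu.-integrable (cube d) (EFin \o h) ->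
  mu.-integrable (cube d) (EFin \o g) ->
  mu.-integrable (cube d) (EFin \o (fun t => h t + g t)).
Proof. by move=> ih ig; exact: (integrableD mcube ih ig). Qed.

(** On a set of finite measure both parts are dominated by the integrable function 1 + |f|^2. *)
Lemma L2_cube_integrable f :
  measurable_fun (cube d) (fun t => complex.Re (f (row_of t))) ->
  measurable_fun (cube d) (fun t => complex.Im (f (row_of t))) ->
  (L2_norm f < +oo)%E ->
  [/\ cube_integrable f &
      mu.-integrable (cube d) (EFin \o (fun t => normc (f (row_of t)) ^+ 2))].
Proof.
move=> mu' mv; rewrite /L2_norm => /lty_poweRy.
rewrite invr_eq0 pnatr_eq0 => /(_ isT) fin.
have mn : measurable_fun (cube d) (fun t => normc (f (row_of t)) ^+ 2).
  under eq_fun do rewrite sqr_normc.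
  by apply: measurable_funD; exact: measurable_funX.
have int2 : mu.-integrable (cube d) (EFin \o (fun t => normc (f (row_of t)) ^+ 2)).
  apply/integrableP; split; first exact/measurable_EFinP.
  under eq_integral do rewrite /= ger0_norm ?sqr_ge0//.
  exact: fin.
have int1 : mu.-integrable (cube d) (EFin \o (fun t => 1 + normc (f (row_of t)) ^+ 2)).
  apply: integrableD2 => //; exact: (bmeas_integrable (bmeas_cst d 1)).
have le1 (a b : R) : `|a| <= b -> `|a| <= `|1 + b ^+ 2|.
  move=> ab; apply: (le_trans ab); apply: le_trans (ler_norm _).
  by have := sqr_ge0 (b - 1); nra.
split=> //; split.
- apply: (le_integrable mcube _ _ int1); first exact/measurable_EFinP.
  by move=> t _ /=; rewrite lee_fin le1// normr_Re_le.
- apply: (le_integrable mcube _ _ int1); first exact/measurable_EFinP.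
  by move=> t _ /=; rewrite lee_fin le1// normr_Im_le.
Qed.

(** With a + i b the integral of [f], integrating 2 (a Re f + b Im f) <= a^2 + b^2 + |f|^2 over the
    cube of measure one leaves a^2 + b^2 on the left. If the norm is infinite there is nothing to
    prove. *)
Lemma normc_cube_integral_le f :
  measurable_fun (cube d) (fun t => complex.Re (f (row_of t))) ->
  measurable_fun (cube d) (fun t => complex.Im (f (row_of t))) ->
  ((normc (cube_integral f))%:E <= L2_norm f)%E.
Proof.
move=> mu' mv; have [fin|] := ltP (L2_norm f) +oo%E; last first.
  by rewrite leye_eq => /eqP ->; rewrite leey.
have [[iu iv] i2] := L2_cube_integrable mu' mv fin.
rewrite /L2_norm.
have -> : (\int[mu]_(t in cube d) (normc (f (row_of t)) ^+ 2)%:E)%E =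
    (\int[mu]_(t in cube d) (normc (f (row_of t)) ^+ 2))%:E.
  by rewrite /Rintegral fineK//; exact: integrable_fin_num.
rewrite cube_integralE.
set a := cint _; set b := cint _.
rewrite poweR_EFin powR12_sqrt; last by apply: Rintegral_ge0 => t _; exact: sqr_ge0.
rewrite lee_fin /= ler_sqrt; last by apply: Rintegral_ge0 => t _; exact: sqr_ge0.
have ic : mu.-integrable (cube d) (EFin \o (fun=> a ^+ 2 + b ^+ 2)).
  exact: (bmeas_integrable (bmeas_cst d _)).
have au := integrableZ a iu; have bv := integrableZ b iv.
have ab := integrableD2 au bv; have ab2 := integrableZ 2 ab.
have : \int[mu]_(t in cube d) (2 * (a * complex.Re (f (row_of t)) + b * complex.Im (f (row_of t)))) <=
   \int[mu]_(t in cube d) ((a ^+ 2 + b ^+ 2) + normc (f (row_of t)) ^+ 2).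
  apply: le_Rintegral => //; first exact: integrableD2.
  move=> t _; rewrite sqr_normc.
  have := sqr_ge0 (a - complex.Re (f (row_of t))).
  have := sqr_ge0 (b - complex.Im (f (row_of t))).
  nra.
rewrite RintegralZl// RintegralD// !RintegralZl// RintegralD//.
rewrite -[\int[mu]_(t in cube d) complex.Re _]/a -[\int[mu]_(t in cube d) complex.Im _]/b.
rewrite -[\int[mu]_(t in cube d) (a ^+ 2 + _)]/(cint (fun t : d.-tuple R => a ^+ 2 + b ^+ 2)) cint_cst.
by rewrite -!expr2; lra.
Qed.

Lemma cube_integralD f g : cube_integrable f -> cube_integrable g ->
  cube_integral (fun x => f x + g x) = cube_integral f + cube_integral g.
Proof.
move=> [fu fv] [gu gv]; rewrite !cube_integralE; apply: complex_ext; rewrite /=.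
  rewrite -RintegralD//; congr Rintegral; apply/funext => t.
  by case: (f _) (g _) => ? ? [].
rewrite -RintegralD//; congr Rintegral; apply/funext => t.
by case: (f _) (g _) => ? ? [].
Qed.

Lemma cube_integrableD f g : cube_integrable f -> cube_integrable g ->
  cube_integrable (fun x => f x + g x).
Proof.
move=> [fu fv] [gu gv]; split.
  rewrite (_ : (fun _ => _) = fun t => complex.Re (f (row_of t)) + complex.Re (g (row_of t))).
    exact: integrableD2.
  by apply/funext => t; case: (f _) (g _) => ? ? [].
rewrite (_ : (fun _ => _) = fun t => complex.Im (f (row_of t)) + complex.Im (g (row_of t))).
  exact: integrableD2.
by apply/funext => t; case: (f _) (g _) => ? ? [].
Qed.

Lemma cube_integrableZ (c : R[i]) f : cube_integrable f -> cube_integrable (fun x => c * f x).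
Proof.
case: c => a b [fu fv]; split.
  rewrite (_ : (fun _ => _) = fun t => a * complex.Re (f (row_of t)) + - b * complex.Im (f (row_of t))).
    by apply: integrableD2; exact: integrableZ.
  by apply/funext => t; case: (f _) => ? ? /=; ring.
rewrite (_ : (fun _ => _) = fun t => a * complex.Im (f (row_of t)) + b * complex.Re (f (row_of t))).
  by apply: integrableD2; exact: integrableZ.
by apply/funext => t; case: (f _) => ? ? /=; ring.
Qed.

Lemma cube_integralZ (c : R[i]) f : cube_integrable f ->
  cube_integral (fun x => c * f x) = c * cube_integral f.
Proof.
case: c => a b [fu fv]; rewrite !cube_integralE; apply: complex_ext; rewrite /=.
  rewrite (_ : (fun _ => _) = fun t => a * complex.Re (f (row_of t)) + - b * complex.Im (f (row_of t))).
    rewrite /cint RintegralD ?RintegralZl//; try exact: integrableZ.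
    by rewrite mulNr.
  by apply/funext => t; case: (f _) => ? ? /=; ring.
rewrite (_ : (fun _ => _) = fun t => a * complex.Im (f (row_of t)) + b * complex.Re (f (row_of t))).
  by rewrite /cint RintegralD ?RintegralZl//; exact: integrableZ.
by apply/funext => t; case: (f _) => ? ? /=; ring.
Qed.

Lemma cube_integral0 : cube_integral (fun _ : 'rV[R]_d => 0) = 0.
Proof. by rewrite cube_integralE /= !cint_cst. Qed.

Lemma cube_integrable_sum (I : Type) (s : seq I) (c : I -> R[i]) (F : I -> 'rV[R]_d -> R[i]) :
  (forall i, cube_integrable (F i)) ->
  cube_integrable (fun x => \sum_(i <- s) c i * F i x) /\
  cube_integral (fun x => \sum_(i <- s) c i * F i x) = \sum_(i <- s) c i * cube_integral (F i).
Proof.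
move=> iF; elim: s => [|i s [IH1 IH2]].
  under eq_fun do rewrite big_nil; rewrite big_nil cube_integral0; split=> //.
  by split; exact: (bmeas_integrable (bmeas_cst d 0)).
have iZ := cube_integrableZ (c i) (iF i).
under eq_fun do rewrite big_cons; rewrite big_cons; split.
  exact: cube_integrableD.
by rewrite cube_integralD// IH2 cube_integralZ.
Qed.

Lemma continuous_cube_integrable f :
  {within unit_cube, continuous (f : 'rV[R]_d -> R[i]^o)} -> cube_integrable f.
Proof.
move=> cf; split; apply: bmeas_integrable.
  exact: (cube_continuous_bmeas (Re_cube_continuous cf)).
exact: (cube_continuous_bmeas (Im_cube_continuous cf)).
Qed.

Theorem e_n_le_g_n (lambda : ell1_weight R d) n : (e_n lambda n <= g_n lambda n)%E.
Proof.
apply: le_ereal_inf_tmp => _ [x cx] [g L2g] <-.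
pose a i := cube_integral (g i).
apply: le_trans (ereal_inf_lbound _) _.
  by exists x => //; exists a.
apply: ge_ereal_sup => _ [f Hf <-].
have [[cf _ _] _] := Hf.
apply: le_trans (ereal_sup_ubound _); last by exists f.
have iF := continuous_cube_integrable cf.
have ig i : cube_integrable (g i).
  by have [mu' mv fin] := L2g i; have [] := L2_cube_integrable mu' mv fin.
have [isum sE] := cube_integrable_sum (index_enum 'I_n) (fun i => - f (x i)) ig.
have FE : (fun y => f y - \sum_(i < n) f (x i) * g i y) =
   (fun y => f y + \sum_(i < n) - f (x i) * g i y).
  apply/funext => y; rewrite -sumrN; congr (_ + _).
  by apply: eq_bigr => i _; rewrite mulNr.
have [iu iv] := cube_integrableD iF isum.
have := normc_cube_integral_le (f := fun y => f y + \sum_(i < n) - f (x i) * g i y)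
  (measurable_of_integrable iu) (measurable_of_integrable iv).
rewrite -FE; apply: le_trans.
rewrite FE cube_integralD// sE lee_fin -normcN opprB.
rewrite le_eqVlt; apply/orP; left; apply/eqP; congr normc; congr (_ + _).
by rewrite -sumrN; apply: eq_bigr => i _; rewrite /a mulrC mulNr.
Qed.

End integration_below_recovery.

(** * The fooling function *)

(** Gram-Schmidt: a new vector adds the rank-one projection onto its component orthogonal to the
    present range, which raises the trace by one, or nothing if that component vanishes. *)
Lemma exists_projection (R : realFieldType) m (s : seq 'cV[R]_m) :
  exists P : 'M[R]_m, [/\ P^T = P, P *m P = P, forall v, v \in s -> P *m v = v &
    \tr P <= (size s)%:R].
Proof.
elim: s => [|v s [P [sP PP Ps trP]]].
  by exists 0; rewrite linear0 mul0mx mxtrace0; split.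
pose r := v - P *m v.
have Pr : P *m r = 0 by rewrite /r mulmxBr mulmxA PP subrr.
have rP : r^T *m P = 0 by rewrite -[LHS]trmxK trmx_mul trmxK sP Pr linear0.
have [r0|rn0] := eqVneq r 0.
  exists P; split=> //.
    move=> w; rewrite inE => /predU1P[->|/Ps//].
    by have /eqP := r0; rewrite subr_eq0 => /eqP.
  by apply: (le_trans trP); rewrite ler_nat.
pose n := bform 1%:M r r.
have n0 : 0 < n := bform1_gt0 rn0.
have rr : r^T *m r = n%:M.
  by rewrite [LHS]mx11_scalar /n /bform mulmx1.
exists (P + n^-1 *: (r *m r^T)); split.
- by rewrite linearD linearZ/= trmx_mul trmxK sP.
- rewrite mulmxDl !mulmxDr PP -!scalemxAr -!scalemxAl (mulmxA P) Pr mul0mx scaler0 addr0.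
  rewrite -(mulmxA r r^T P) rP mulmx0 scaler0 add0r -mulmxA (mulmxA r^T) rr.
  by rewrite mul_scalar_mx -scalemxAr !scalerA mulfVK// gt_eqF.
- move=> w; rewrite inE mulmxDl -scalemxAl -mulmxA => /predU1P[->|ws].
    have -> : r^T *m v = n%:M.
      by rewrite -rr /r mulmxBr (mulmxA _ P) -/r rP mul0mx subr0.
    rewrite mul_mx_scalar scalerA mulVf ?gt_eqF// scale1r /r addrC subrK//.
  have -> : r^T *m w = 0 by rewrite -(Ps w ws) mulmxA rP mul0mx.
  by rewrite mulmx0 scaler0 addr0 Ps.
- rewrite linearD linearZ/= mxtrace_mulC rr mxtrace_scalar mulr1n mulVf ?gt_eqF//.
  by rewrite -natr1 lerD.
Qed.

Section fooling.
Context {R : realType} {d : nat}.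
Implicit Types (h : 'rV[int]_d) (x y : 'rV[R]_d).

Lemma expR1_le4 : expR 1 <= 4 :> R.
Proof.
have h : 2^-1 <= expR (- 2^-1) :> R by have := @expR_ge1Dx R (- 2^-1); lra.
have p : expR 2^-1 <= 2 :> R.
  by rewrite -[leLHS]invrK -expRN -[leRHS]invrK lef_pV2// ?posrE ?expR_gt0// invr_gt0.
have -> : expR 1 = expR 2^-1 * expR 2^-1 :> R by rewrite -expRD; congr expR; field.
apply: (@le_trans _ _ (2 * 2)); last by lra.
by apply: ler_pM => //; exact: expR_ge0.
Qed.

Definition cospoly (I : finType) (c : I -> R) (p : I -> 'rV[int]_d) x : R :=
  \sum_i c i * cos (phase (p i) x).

Lemma continuous_cospoly (I : finType) (c : I -> R) (p : I -> 'rV[int]_d) :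
  continuous (cospoly c p).
Proof.
apply: continuous_sum_seq => i x; apply: continuousM; first exact: cst_continuous.
by apply: continuous_comp; [exact: continuous_phase|exact: continuous_cos].
Qed.

Lemma fourier_coef_cospoly (I : finType) (c : I -> R) (p : I -> 'rV[int]_d) h :
  fourier_coef (fun x => (cospoly c p x)%:C) h =
  (\sum_i c i * (((p i == h)%:R + (p i == - h)%:R) / 2))%:C.
Proof.
rewrite fourier_coefE /=.
have bc0 (k : 'rV[int]_d) (phi : R) : bmeas (fun t : d.-tuple R => cos (phi + phase k (row_of t))) := bmeas_cos phi k.
congr (_ +i* _).
  transitivity (cint (fun t : d.-tuple R => \sum_(i <- index_enum I)
     (c i / 2) * (cos (0 + phase (p i - h) (row_of t)) + cos (0 + phase (p i + h) (row_of t))))).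
    congr cint; apply/funext => t; rewrite mul0r addr0 mulr_suml; apply: eq_bigr => i _.
    by rewrite !add0r phaseB phaseD cosB cosD; field.
  rewrite cint_sum; last by move=> i; apply: bmeasZ; apply: bmeasD.
  apply: eq_bigr => i _; rewrite cintZ; last exact: bmeasD.
  rewrite cintD// !cint_cos cos0 subr_eq0 addr_eq0.
  by rewrite -mulrA; congr (_ * _); rewrite mulrC; case: eqP; case: eqP.
transitivity (cint (fun t : d.-tuple R => \sum_(i <- index_enum I)
   (c i / 2) * (cos (pi / 2 + phase (p i + h) (row_of t)) +
                - cos (pi / 2 + phase (p i - h) (row_of t))))).
  congr cint; apply/funext => t; rewrite mul0r add0r mulr_suml -sumrN; apply: eq_bigr => i _.
  by rewrite ![pi / 2 + _]addrC !cosDpihalf phaseB phaseD sinB sinD; field.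
rewrite cint_sum; last first.
  by move=> i; apply: bmeasZ; apply: bmeasD => //; exact: bmeasN.
rewrite big1// => i _; rewrite cintZ; last by apply: bmeasD => //; exact: bmeasN.
rewrite cintD//; last exact: bmeasN.
by rewrite cintN// !cint_cos cos_pihalf !if_same oppr0 addr0 mulr0.
Qed.

Lemma within_continuous_cospoly (I : finType) (c : I -> R) (p : I -> 'rV[int]_d) :
  {within unit_cube, continuous ((fun x => (cospoly c p x)%:C) : 'rV[R]_d -> R[i]^o)}.
Proof.
apply/within_continuous_normc => x cx e e0.
have /cube_continuousP H : {within unit_cube, continuous (cospoly c p)}.
  exact/continuous_subspaceT/continuous_cospoly.
have [r r0 Hr] := H x cx e e0; exists r => // y cy xy.
rewrite /normc/= oppr0 addr0 expr0n/= addr0 sqrtr_sqr; exact: Hr.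
Qed.

End fooling.

Section fooling_function.
Context {R : realType} {d : nat} (beta : R) (hb : 2^-1 < beta) (j0 : 'I_d).
Implicit Types (h : 'rV[int]_d) (x y : 'rV[R]_d).

(** On one coordinate axis the product weight reduces to its one-dimensional factor, since the
    factor at 0 equals 1. *)
Definition axis (z : int) : 'rV[int]_d := \row_j (if j == j0 then z else 0).

Lemma axis_inj : injective axis.
Proof. by move=> a b /rowP/(_ j0); rewrite !mxE eqxx. Qed.

Lemma axisN z : axis (- z) = - axis z.
Proof. by apply/rowP => j; rewrite !mxE; case: eqP => // _; rewrite oppr0. Qed.

Lemma axis0 : axis 0 = 0.
Proof. by apply/rowP => j; rewrite !mxE if_same. Qed.

Lemma phase_axis z x : phase (axis z) x = 2 * pi * (z%:~R * x ord0 j0).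
Proof.
rewrite /phase (bigD1 j0)//= mxE eqxx big1 ?addr0// => j /negbTE jj.
by rewrite mxE jj mul0r.
Qed.

Lemma log_weight_axis z : log_weight hb d (axis z) = log_weight1 beta `|z|%N.
Proof.
rewrite log_weightE (bigD1 j0)//= mxE eqxx big1 ?mulr1// => j /negbTE jj.
by rewrite mxE jj log_weight1_0.
Qed.

Variable n : nat.
Hypothesis n4 : (4 <= n)%N.
(** Up to n^2 the reciprocals still sum to about ln n although each is below 1 / n, and every
    frequency difference has logarithm of order ln n. *)
Let m := (n ^ 2 - n)%N.
Let kap (i : 'I_m) : nat := (n + i.+1)%N.
Let mu (i : 'I_m) : R := (kap i)%:R^-1.
Let S : R := \sum_i mu i.
Let L : R := ln n%:R.
Let freq (q : 'I_m * 'I_m) : 'rV[int]_d := axis ((kap q.1)%:Z - (kap q.2)%:Z).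

Let mu_gt0 i : 0 < mu i.
Proof. by rewrite invr_gt0 ltr0n /kap addnS. Qed.

Let S_ge0 : 0 <= S. Proof. by apply: sumr_ge0 => i _; exact: ltW. Qed.

Let kap_inj : injective kap.
Proof. by move=> i j; rewrite /kap => /addnI [] /val_inj. Qed.

Let freq_swap q : freq (q.2, q.1) = - freq q.
Proof. by rewrite /freq /= -axisN opprB. Qed.

Let freq0 q : (freq q == 0) = (q.1 == q.2).
Proof.
rewrite /freq -axis0 (inj_eq axis_inj) subr_eq0 eqz_nat.
by rewrite (inj_eq kap_inj).
Qed.

Let count1 (h : 'rV[int]_d) k : \sum_l (freq (k, l) == h)%:R <= 1 :> R.
Proof.
have [[l0 /eqP hl]|no] := pselect (exists l, freq (k, l) == h).
  rewrite (bigD1 l0)//= -hl eqxx big1 ?addr0// => l ll.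
  rewrite /freq (inj_eq axis_inj) /= (inj_eq (addrI _)) eqr_opp eqz_nat (inj_eq kap_inj).
  by rewrite (negbTE ll).
rewrite big1 ?ler01// => l _; case: eqP => // hl; exfalso; apply: no.
by exists l; apply/eqP.
Qed.

Let count2 (h : 'rV[int]_d) l : \sum_k (freq (k, l) == h)%:R <= 1 :> R.
Proof.
have := count1 (- h) l; apply: le_trans; apply: ler_sum => k _.
by have -> : freq (l, k) = - freq (k, l) := freq_swap (k, l); rewrite eqr_opp.
Qed.

(** Multiply by |z|, the distance of the two indices and hence at most their sum: the product of two
    reciprocals becomes the sum of the reciprocals, and each index is first, or second, in at most
    one pair of difference [z]. *)
Let nu_le (z : int) : z != 0 ->
  \sum_q (freq q == axis z)%:R * (mu q.1 * mu q.2) <= 2 * S / `|z|%:~R.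
Proof.
move=> z0; have z1 : 0 < `|z|%:~R :> R by rewrite ltr0z normr_gt0.
rewrite ler_pdivlMr// mulr_suml.
apply: (@le_trans _ _ (\sum_q ((freq q == axis z)%:R * mu q.1 + (freq q == axis z)%:R * mu q.2))).
  apply: ler_sum => q _; case: eqP => [/axis_inj qz|_]; last by rewrite !mul0r addr0.
  rewrite !mul1r -qz.
  have k1 : 0 < (kap q.1)%:R :> R by rewrite ltr0n /kap addnS.
  have k2 : 0 < (kap q.2)%:R :> R by rewrite ltr0n /kap addnS.
  rewrite /mu.
  have -> : (kap q.1)%:R^-1 + (kap q.2)%:R^-1 =
     (kap q.1)%:R^-1 * (kap q.2)%:R^-1 * ((kap q.1)%:R + (kap q.2)%:R) :> R.
    by field; rewrite !gt_eqF.
  rewrite ler_wpM2l ?mulr_ge0 ?invr_ge0//.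
  rewrite intr_norm rmorphB/= -!pmulrn; apply: le_trans (ler_normB _ _) _.
  by rewrite !ger0_norm.
rewrite big_split/= mulr2n mulrDl mul1r; apply: lerD.
  rewrite -(pair_bigA _ (fun k l => (freq (k, l) == axis z)%:R * mu k))/=.
  by apply: ler_sum => k _; rewrite -mulr_suml ler_piMl ?(ltW (mu_gt0 k)) ?count1.
rewrite -(pair_bigA _ (fun k l => (freq (k, l) == axis z)%:R * mu l))/= exchange_big/=.
by apply: ler_sum => l _; rewrite -mulr_suml ler_piMl ?(ltW (mu_gt0 l)) ?count2.
Qed.

Let L_ge1 : 1 <= L.
Proof.
have np : 0 < n%:R :> R by rewrite ltr0n; lia.
rewrite /L -[leLHS](@expRK R) ler_ln ?posrE ?expR_gt0//.
by apply: le_trans (@expR1_le4 R) _; rewrite ler_nat.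
Qed.

(** 1 + |z| <= 2 |z|, and e + n^2 <= n^3 once n >= 4. *)
Let inv_weight_le (z : int) : z != 0 -> (`|z| <= n ^ 2)%N ->
  (log_weight1 beta `|z|%N)^-1 <= 2 * `|z|%:~R * (3 * L) `^ (2 * beta).
Proof.
move=> z0 zn; set a := `|z|%N.
have -> : `|z|%:~R = a%:R :> R by rewrite natr_absz.
have a1 : 1 <= a%:R :> R by rewrite ler1n absz_gt0.
have e3 := @expR1_le4 R; have e2 := @expR1_ge2 R.
have n3' : 4 <= n%:R :> R by rewrite ler_nat.
have lnb : ln (expR 1 + a%:R) <= 3 * L :> R.
  have np : 0 < n%:R :> R by lra.
  have ea : 0 < expR 1 + a%:R :> R by lra.
  rewrite mulr_natl -lnXn// ler_ln ?posrE ?exprn_gt0//.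
  have : a%:R <= n%:R ^+ 2 :> R by rewrite -natrX ler_nat.
  move: n3'; set N := n%:R => n3' aN; rewrite exprS.
  have := ler_wpM2r (sqr_ge0 N) n3'; have : 16 <= N ^+ 2 by nra.
  lra.
have L1 : 1 <= ln (expR 1 + a%:R) :> R := ln_expR1D_ge1 a.
rewrite /log_weight1 invfM invrK mulNr powRN invrK.
apply: ler_pM => //; rewrite ?addr_ge0 ?powR_ge0//; first by lra.
by apply: ge0_ler_powR; rewrite ?nnegrE; move: hb L_ge1; lra.
Qed.

(** Off the diagonal [Q] is -P, and the squared entries of [P] sum to its trace, at most 2 n.
    Cauchy-Schwarz at each nonzero frequency separates these entries from the products of
    reciprocals, whose factor 1 / |z| cancels the growth of the inverse weight. *)
Theorem fooling_coefficients (xs : 'I_n -> 'rV[R]_d) :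
  exists (c : 'I_m * 'I_m -> R), [/\
    forall i, cospoly c freq (xs i) = 0,
    S - 2 <= \sum_q c q * (freq q == 0)%:R <= S,
    forall h, \sum_q c q * (((freq q == h)%:R + (freq q == - h)%:R) / 2) =
              \sum_q c q * (freq q == h)%:R &
    forall J, uniq J ->
      \sum_(h <- J | h != 0) (\sum_q c q * (freq q == h)%:R) ^+ 2 / log_weight hb d h <=
      8 * n%:R * S * (3 * L) `^ (2 * beta)].
Proof.
pose U i : 'cV[R]_m := \col_k (Num.sqrt (mu k) * cos (2 * pi * ((kap k)%:R * xs i ord0 j0))).
pose V i : 'cV[R]_m := \col_k (Num.sqrt (mu k) * sin (2 * pi * ((kap k)%:R * xs i ord0 j0))).
have [P [sP PP Pv trP]] := exists_projection ([seq U i | i <- enum 'I_n] ++ [seq V i | i <- enum 'I_n]).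
rewrite size_cat (size_map (fun i => U i)) (size_map (fun i => V i)) size_enum_ord in trP.
have PU i : P *m U i = U i by apply: Pv; rewrite mem_cat map_f ?mem_enum.
have PV i : P *m V i = V i by apply: Pv; rewrite mem_cat map_f ?mem_enum ?orbT.
pose Q := 1%:M - P.
have QU i : Q *m U i = 0 by rewrite mulmxBl mul1mx PU subrr.
have QV i : Q *m V i = 0 by rewrite mulmxBl mul1mx PV subrr.
have PkE k l : P k l = P l k by rewrite -{1}sP mxE.
have Pkk k : P k k = \sum_l P k l ^+ 2.
  by rewrite -{1}PP mxE; apply: eq_bigr => l _; rewrite (PkE l k) expr2.
have P0 k : 0 <= P k k by rewrite Pkk sumr_ge0// => l _; exact: sqr_ge0.
pose c (q : 'I_m * 'I_m) := Num.sqrt (mu q.1) * Num.sqrt (mu q.2) * Q q.1 q.2.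
have csym k l : c (k, l) = c (l, k).
  rewrite /c /= !mxE (PkE k l) eq_sym; ring.
have smu k : Num.sqrt (mu k) * Num.sqrt (mu k) = mu k by rewrite -expr2 sqr_sqrtr ?ltW.
exists c; split.
(* The addition theorem splits cos(2 pi (k - l) x) into a cosine and a sine product, and [Q]
   annihilates both vectors. *)
- move=> i; transitivity (bform Q (U i) (U i) + bform Q (V i) (V i)).
    rewrite !bformE -big_split/= /cospoly.
    rewrite -(pair_bigA _ (fun k l => c (k, l) * cos (phase (freq (k, l)) (xs i))))/=.
    apply: eq_bigr => k _; rewrite -big_split/=; apply: eq_bigr => l _.
    rewrite /freq phase_axis /= rmorphB/= -!pmulrn mulrBl mulrBr cosB /c /U /V !mxE /=; ring.
  by rewrite /bform -!mulmxA QU QV !mulmx0 !mxE addr0.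
- have -> : \sum_q c q * (freq q == 0)%:R = S - \sum_k mu k * P k k.
    rewrite -(pair_bigA _ (fun k l => c (k, l) * (freq (k, l) == 0)%:R))/= -sumrB.
    apply: eq_bigr => k _; rewrite (bigD1 k)//= freq0 eqxx mulr1 big1 ?addr0.
      by rewrite /c /= smu /Q !mxE eqxx /= mulr1n; ring.
    by move=> l lk; rewrite freq0 /= eq_sym (negbTE lk) mulr0.
  have h0 : 0 <= \sum_k mu k * P k k.
    by apply: sumr_ge0 => k _; rewrite mulr_ge0 ?P0// ltW.
  have n0 : 0 < n%:R :> R by rewrite ltr0n; lia.
  have h2 : \sum_k mu k * P k k <= 2.
    apply: (@le_trans _ _ (\sum_k n%:R^-1 * P k k)).
      apply: ler_sum => k _; rewrite ler_wpM2r// lef_pV2 ?posrE//.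
        by rewrite ler_nat /kap leq_addr.
      by rewrite ltr0n /kap addnS.
    by rewrite -mulr_sumr ler_pdivrMl// mulr_natr mulr2n -natrD.
  by apply/andP; split; lra.
(* Swapping the pair preserves the coefficient and negates the frequency, so the sums at h and -h
   agree. *)
- move=> h.
  have E : \sum_q c q * (freq q == - h)%:R = \sum_q c q * (freq q == h)%:R.
    rewrite -(pair_bigA _ (fun k l => c (k, l) * (freq (k, l) == - h)%:R))/=.
    rewrite exchange_big/= pair_bigA/=; apply: eq_bigr => -[k l] _ /=.
    have -> : freq (l, k) = - freq (k, l) := freq_swap (k, l).
    by rewrite eqr_opp csym.
  have -> : \sum_q c q * (((freq q == h)%:R + (freq q == - h)%:R) / 2) =
      (\sum_q c q * (freq q == h)%:R + \sum_q c q * (freq q == - h)%:R) / 2.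
    by rewrite -big_split/= mulr_suml; apply: eq_bigr => q _; ring.
  by rewrite E; field.
- move=> J uJ.
  have pi2 : \sum_(h <- J) \sum_q (freq q == h)%:R * P q.1 q.2 ^+ 2 <= 2 * n%:R.
    rewrite exchange_big/=; apply: (@le_trans _ _ (\sum_q P q.1 q.2 ^+ 2)).
      apply: ler_sum => q _; rewrite -mulr_suml ler_piMl ?sqr_ge0//.
      have [qJ|qJ] := boolP (freq q \in J).
        rewrite (big_rem (freq q))//= eqxx big_seq big1 ?addr0// => h.
        by rewrite mem_rem_uniq// inE eq_sym => /andP[/negbTE ->].
      rewrite big_seq big1 ?ler01// => h hJ; case: eqP => // qh.
      by rewrite qh hJ in qJ.
    rewrite -(pair_bigA _ (fun k l => P k l ^+ 2))/=.
    under eq_bigr do rewrite -Pkk.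
    by apply: (le_trans trP); rewrite natrD mulr2n mulrDl mul1r.
  have bound h : h != 0 -> (\sum_q c q * (freq q == h)%:R) ^+ 2 / log_weight hb d h <=
      4 * S * (3 * L) `^ (2 * beta) * \sum_q (freq q == h)%:R * P q.1 q.2 ^+ 2.
    move=> h0.
    have pi0 : 0 <= \sum_q (freq q == h)%:R * P q.1 q.2 ^+ 2.
      by apply: sumr_ge0 => q _; rewrite mulr_ge0 ?sqr_ge0.
    have K0 : 0 <= 4 * S * (3 * L) `^ (2 * beta) by rewrite !mulr_ge0 ?powR_ge0.
    have [[q /eqP qh]|no] := pselect (exists q, freq q == h); last first.
      rewrite big1 => [|q _]; first by rewrite expr0n/= mul0r (mulr_ge0 K0 pi0).
      by case: eqP => [qh|_]; [exfalso; apply: no; exists q; apply/eqP|rewrite mulr0].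
    pose z := (kap q.1)%:Z - (kap q.2)%:Z.
    have hz : h = axis z by rewrite -qh.
    have z0 : z != 0 by apply: contra h0 => /eqP z0; rewrite hz z0 axis0.
    have zn : (`|z| <= n ^ 2)%N.
      have b1 : (q.1 < n ^ 2 - n)%N := ltn_ord q.1.
      have b2 : (q.2 < n ^ 2 - n)%N := ltn_ord q.2.
      rewrite /z /kap; move: (nat_of_ord q.1) (nat_of_ord q.2) b1 b2 => a b.
      by set N := (n ^ 2)%N; lia.
    have z1 : 0 < `|z|%:~R :> R by rewrite ltr0z normr_gt0.
    have CS := sum_CS (index_enum _)
      (fun q : 'I_m * 'I_m => (freq q == h)%:R * (Num.sqrt (mu q.1) * Num.sqrt (mu q.2)))
      (fun q => (freq q == h)%:R * P q.1 q.2).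
    rewrite [X in X ^+ 2 <= _](_ : _ = - \sum_q c q * (freq q == h)%:R) in CS; last first.
      rewrite -sumrN; apply: eq_bigr => q' _; case: eqP => [qh'|_]; last by rewrite !mul0r mulr0 oppr0.
      have : q'.1 != q'.2 by rewrite -freq0 qh'.
      by rewrite /c /Q !mxE => /negbTE ->; rewrite /= mulr0n mulr1n; ring.
    rewrite sqrrN in CS.
    rewrite [X in _ <= X * _](_ : _ = \sum_q (freq q == h)%:R * (mu q.1 * mu q.2)) in CS; last first.
      apply: eq_bigr => q' _; case: eqP => _; last by rewrite !mul0r expr0n.
      by rewrite !mul1r exprMn !sqr_sqrtr ?(ltW (mu_gt0 _)).
    rewrite [X in _ <= _ * X](_ : _ = \sum_q (freq q == h)%:R * P q.1 q.2 ^+ 2) in CS; last first.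
      by apply: eq_bigr => q' _; case: eqP => _; rewrite ?mul1r// !mul0r expr0n.
    set pih := \sum_q (freq q == h)%:R * P q.1 q.2 ^+ 2 in CS pi0 *.
    have nu := nu_le z0; rewrite -hz in nu.
    have wl : (log_weight hb d h)^-1 <= 2 * `|z|%:~R * (3 * L) `^ (2 * beta).
      by rewrite hz log_weight_axis; exact: inv_weight_le.
    have wg : 0 <= (log_weight hb d h)^-1 by rewrite invr_ge0 ltW ?log_weight_gt0.
    apply: (@le_trans _ _ ((2 * S / `|z|%:~R * pih) * (2 * `|z|%:~R * (3 * L) `^ (2 * beta)))).
      apply: ler_pM => //; first exact: sqr_ge0.
      by apply: (le_trans CS); rewrite ler_wpM2r.
    by rewrite le_eqVlt; apply/orP; left; apply/eqP; field; rewrite gt_eqF.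
  apply: (@le_trans _ _ (\sum_(h <- J | h != 0) 4 * S * (3 * L) `^ (2 * beta) *
     \sum_q (freq q == h)%:R * P q.1 q.2 ^+ 2)).
    by apply: ler_sum => h h0; exact: bound.
  have K0 : 0 <= 4 * S * (3 * L) `^ (2 * beta) by rewrite !mulr_ge0 ?powR_ge0.
  rewrite -mulr_sumr; apply: le_trans (ler_wpM2l K0 (le_trans _ pi2)) _.
    rewrite [leRHS](bigID (fun h => h != 0))/= lerDl sumr_ge0// => h _.
    by apply: sumr_ge0 => q _; rewrite mulr_ge0 ?sqr_ge0.
  by rewrite le_eqVlt; apply/orP; left; apply/eqP; ring.
Qed.

End fooling_function.

(** * Rates *)

(** Telescoping with 1 / (i + 1) <= ln(i + 1) - ln i <= 1 / i. The loss of 1 in the lower bound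
    covers ln(n + 1) - ln n. *)
Lemma harmonic_bounds (R : realType) (n : nat) : (0 < n)%N ->
  ln n%:R - 1 <= \sum_(i < n ^ 2 - n) ((n + i.+1)%N%:R : R)^-1 <= ln n%:R.
Proof.
move=> n0; have np : 0 < n%:R :> R by rewrite ltr0n.
have n2 : (n <= n ^ 2)%N by rewrite -{1}[n]expn1 leq_pexp2l.
have lnn2 : ln (n ^ 2)%:R = 2 * ln n%:R :> R by rewrite natrX lnXn// mulr_natl.
have tele (F : nat -> R) m : \sum_(i < m) (F i.+1 - F i) = F m - F 0.
  by rewrite -(big_mkord xpredT (fun i => F i.+1 - F i)) telescope_sumr.
have step (i : nat) : (0 < i)%N -> ln i.+1%:R - ln i%:R <= i%:R^-1 :> R /\
    i.+1%:R^-1 <= ln i.+1%:R - ln i%:R :> R.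
  move=> i0; have ip : 0 < i%:R :> R by rewrite ltr0n.
  have ip1 : 0 < i.+1%:R :> R by rewrite ltr0n.
  have iE : i.+1%:R = i%:R + 1 :> R by rewrite natr1.
  split.
    rewrite -ln_div ?posrE// (_ : i.+1%:R / i%:R = 1 + i%:R^-1).
      by apply: le_ln1Dx; rewrite (lt_trans _ (_ : 0 < _)) ?invr_gt0.
    by rewrite iE; field; rewrite gt_eqF.
  have := @le_ln1Dx R (i%:R / i.+1%:R - 1); rewrite (addrC 1) subrK.
  rewrite ltrBrDl subrr divr_gt0// => /(_ isT).
  rewrite ln_div ?posrE//.
  have -> : i%:R / i.+1%:R - 1 = - i.+1%:R^-1 :> R.
    by rewrite iE; field; rewrite -iE gt_eqF.
  by move: (i.+1%:R^-1) (ln i.+1%:R) (ln i%:R) => z u v; lra.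
apply/andP; split.
  apply: (@le_trans _ _ (\sum_(i < n ^ 2 - n) (ln (n + i.+2)%N%:R - ln (n + i.+1)%N%:R))).
    rewrite (tele (fun i => ln (n + i.+1)%N%:R)) addn1.
    have h1 : ln (n ^ 2)%:R <= ln (n + (n ^ 2 - n).+1)%N%:R :> R.
      by rewrite ler_ln ?posrE ?ltr0n ?expn_gt0 ?n0 ?addnS// ler_nat; lia.
    have h2 : ln n.+1%:R <= ln n%:R + 1 :> R.
      have [_ _] := step n n0; have [h _] := step n n0.
      apply: (@le_trans _ _ (ln n%:R + n%:R^-1)); first by lra.
      by rewrite lerD2l invf_le1// ler1n.
    by move: h1; rewrite lnn2; lra.
  apply: ler_sum => i _; rewrite addnS.
  by have [] := step (n + i.+1)%N; rewrite ?addnS.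
apply: (@le_trans _ _ (\sum_(i < n ^ 2 - n) (ln (n + i.+1)%N%:R - ln (n + i)%N%:R))).
  apply: ler_sum => i _; rewrite addnS.
  by have [] := step (n + i)%N; rewrite // addn_gt0 n0.
rewrite (tele (fun i => ln (n + i)%N%:R)) addn0 subnKC//.
by rewrite lnn2; lra.
Qed.

Section rate.
Context {R : realType} {d : nat} (beta : R) (hb : 2^-1 < beta).
Hypothesis d_gt0 : (0 < d)%N.
Let lambda := log_weight hb d.
Definition rate (n : nat) : R := n%:R `^ (- 2^-1) * ln n%:R `^ (- beta + 2^-1).

Lemma rate_ge0 n : 0 <= rate n.
Proof. by rewrite mulr_ge0 ?powR_ge0. Qed.

Lemma ln_nat_ge (M : R) : exists n0, forall n, (n0 <= n)%N -> M <= ln n%:R.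
Proof.
exists (Num.truncn (expR M)).+1 => n n0n.
have h : expR M <= n%:R.
  apply: (@le_trans _ _ (Num.truncn (expR M)).+1%:R); last by rewrite ler_nat.
  by rewrite ltW// truncnS_gt.
by rewrite -[leLHS](@expRK R) ler_ln ?posrE ?expR_gt0// (lt_le_trans _ h) ?expR_gt0.
Qed.

Theorem g_n_le_rate : exists2 C : R, 0 < C &
  exists n0, forall n, (n0 <= n)%N -> (g_n lambda n <= (C * rate n)%:E)%E.
Proof.
have [c c0 [N0 count]] := log_weight_count hb d_gt0.
have [N1 L1] := ln_nat_ge 1.
have [K K544 K0] : exists2 K : R, K = 544 & 0 < K by exists 544; rewrite ?ltr0n.
exists (Num.sqrt (K / c)); first by rewrite sqrtr_gt0 divr_gt0.
(* The last threshold ensures c n >= 1, hence T lambda 0 >= 1. *)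
exists (maxn (maxn N0 N1) (Num.truncn c^-1).+1) => n.
rewrite !geq_max => /andP[/andP[nN0 nN1] nc].
have L_ge1 := L1 n nN1; set L : R := ln n%:R in L_ge1 *.
have Lp : 0 < L by lra.
have np : 0 < n%:R :> R by rewrite ltr0n (leq_trans _ nc).
set T := c * n%:R * L `^ (2 * beta - 1).
have T0 : 0 < T by rewrite /T !mulr_gt0 ?powR_gt0.
have T1 : 1 <= T * lambda 0.
  rewrite /lambda log_weight0 mulr1 /T.
  have h1 : 1 <= c * n%:R.
    rewrite mulrC -ler_pdivrMr// div1r.
    apply: (@le_trans _ _ (Num.truncn c^-1).+1%:R); last by rewrite ler_nat.
    by rewrite ltW// truncnS_gt.
  have h2 : 1 <= L `^ (2 * beta - 1).
    apply: (@le_trans _ _ (1 `^ (2 * beta - 1))); first by rewrite powR1.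
    by apply: ge0_ler_powR; rewrite ?nnegrE; move: hb; lra.
  by apply: (le_trans h1); rewrite ler_peMr// ltW// mulr_gt0.
have := g_n_le (lambda := lambda) (@log_weight_gt0 R beta hb d) (@log_weightN R beta hb d) d_gt0 T0 T1 (count n nN0) (@log_weight_small_tail R beta hb d).
move=> /le_trans; apply; rewrite lee_fin.
rewrite -K544; have -> : K / T = K / c * (rate n) ^+ 2.
  rewrite /rate -/L exprMn /T.
  have -> : (n%:R `^ (- 2^-1)) ^+ 2 = n%:R^-1 :> R.
    by rewrite -powR_mulrn ?powR_ge0// -powRrM mulNr mulVf// powR_inv1// ltW.
  have -> : (L `^ (- beta + 2^-1)) ^+ 2 = (L `^ (2 * beta - 1))^-1.
    rewrite -powR_mulrn ?powR_ge0// -powRrM -powRN; congr powR.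
    by field.
  by field; rewrite !gt_eqF ?powR_gt0.
by rewrite sqrtrM ?divr_ge0 ?(ltW c0) ?(ltW K0)// sqrtr_sqr ger0_norm ?rate_ge0.
Qed.

Lemma cube_integral_fourier0 (f : 'rV[R]_d -> R[i]) : cube_integral f = fourier_coef f 0.
Proof.
rewrite fourier_coefE cube_integralE; congr (_ +i* _); congr cint; apply/funext => t.
  by rewrite phase0 cos0 sin0 mulr1 mulr0 addr0.
by rewrite phase0 cos0 sin0 mulr1 mulr0 subr0.
Qed.

Lemma cospolyZ (I : finType) (a : R) (c : I -> R) (p : I -> 'rV[int]_d) x :
  cospoly (fun i => a * c i) p x = a * cospoly c p x.
Proof. by rewrite /cospoly mulr_sumr; apply: eq_bigr => i _; rewrite mulrA. Qed.

Theorem rate_le_e_n : exists2 c : R, 0 < c &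
  exists n0, forall n, (n0 <= n)%N -> ((c * rate n)%:E <= e_n lambda n)%E.
Proof.
pose j0 := Ordinal d_gt0.
(* Once ln n >= 6, the lower bound ln n - 3 for the mean is at least ln n / 2. *)
have [N0 L6] := ln_nat_ge 6.
have b3 : 0 < 3 `^ beta :> R by rewrite powR_gt0.
(* Chosen so that this constant times [rate n] times the norm bound [B] equals ln n / 2. *)
exists (6 * 3 `^ beta)^-1; first by rewrite invr_gt0 mulr_gt0.
exists (maxn N0 4) => n; rewrite geq_max => /andP[nN0 n4].
apply: le_ereal_inf_tmp => _ [x cx] [a _] <-.
have [c [c0 cint0 csym cnorm]] := fooling_coefficients hb j0 n4 x.
have n0 : (0 < n)%N by lia.
have np : 0 < n%:R :> R by rewrite ltr0n.
have := harmonic_bounds R n0.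
set S : R := \sum_(i < n ^ 2 - n) _ in cint0 cnorm * => /andP[SL1 SL2].
have L_ge6 := L6 n nN0; set L : R := ln n%:R in SL1 SL2 L_ge6 cnorm *.
set p := (fun q : 'I_(n ^ 2 - n) * 'I_(n ^ 2 - n) => _) in c0 csym cnorm cint0.
pose A h := \sum_q c q * (p q == h)%:R.
have Lp : 0 < L by lra.
have Sp : 0 < S by lra.
have L3 : 0 < (3 * L) `^ (2 * beta) by rewrite powR_gt0// mulr_gt0.
(* Bounds the norm before scaling: of the 9 parts in B^2 = 9 n L (3 L)^(2 beta), 8 cover the
   nonconstant frequencies and one the constant term, as S^2 <= L^2 <= n L. *)
pose B := 3 * n%:R `^ 2^-1 * L `^ 2^-1 * (3 * L) `^ beta.
have Bp : 0 < B by rewrite /B !mulr_gt0 ?powR_gt0// mulr_gt0.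
have B2 : B ^+ 2 = 9 * n%:R * L * (3 * L) `^ (2 * beta).
  have half (z : R) : 0 <= z -> (z `^ 2^-1) ^+ 2 = z.
    by move=> z0; rewrite -powR_mulrn ?powR_ge0// -powRrM mulVf// powRr1.
  rewrite /B !exprMn !half ?(ltW np) ?(ltW Lp)//.
  have -> : ((3 * L) `^ beta) ^+ 2 = (3 * L) `^ (2 * beta).
    by rewrite -powR_mulrn ?powR_ge0 // -powRrM [beta * _]mulrC.
  by ring.
have Ln : L <= n%:R.
  have := @le_ln1Dx R (n%:R - 1); rewrite (addrC 1) subrK ltrBrDl subrr => /(_ np).
  by rewrite -/L; lra.
have key : S ^+ 2 + 8 * n%:R * S * (3 * L) `^ (2 * beta) <= B ^+ 2.
  have pw1 : 1 <= (3 * L) `^ (2 * beta).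
    apply: (@le_trans _ _ (1 `^ (2 * beta))); first by rewrite powR1.
    by apply: ge0_ler_powR; rewrite ?nnegrE; move: hb; lra.
  rewrite B2; set X := (3 * L) `^ (2 * beta) in pw1 *.
  have h1 : S ^+ 2 <= n%:R * L * X.
    apply: (@le_trans _ _ (n%:R * L)); last by rewrite ler_peMr ?mulr_ge0 ?(ltW Lp).
    by rewrite expr2; apply: ler_pM; rewrite ?(ltW Sp)//; lra.
  have h2 : 8 * n%:R * S * X <= 8 * n%:R * L * X.
    by rewrite ler_wpM2r ?(ltW L3)// ler_wpM2l// mulr_ge0.
  lra.
have A0 : 0 <= A 0 by case/andP: cint0 => ? ?; rewrite /A; lra.
pose f y : R[i] := (cospoly (fun q => B^-1 * c q) p y)%:C.
have fE h : fourier_coef f h = (A h / B)%:C.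
  rewrite fourier_coef_cospoly; congr (_%:C); rewrite /A -csym mulr_suml.
  by apply: eq_bigr => q _; ring.
have nf : (H_norm lambda f <= 1%:E)%E.
  apply: (H_norm_le (lambda := lambda) (@log_weight_gt0 R beta hb d) f ler01).1.
  move=> J uJ; rewrite expr1n.
  have E h : normc (fourier_coef f h) ^+ 2 / lambda h = (A h ^+ 2 / lambda h) / B ^+ 2.
    by rewrite fE sqr_normc /= expr0n addr0 expr_div_n mulrAC.
  under eq_bigr do rewrite E.
  rewrite -mulr_suml ler_pdivrMr ?exprn_gt0// mul1r; apply: le_trans key.
  rewrite (bigID (fun h => h == 0))/=; apply: lerD; last exact: cnorm.
  have [J0|J0] := boolP (0 \in J); last first.
    rewrite big_seq_cond big1 ?sqr_ge0// => h /andP[hJ /eqP h0].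
    by rewrite -h0 hJ in J0.
  rewrite big_mkcond (big_rem 0)//= eqxx big_seq big1 ?addr0; last first.
    by move=> h; rewrite mem_rem_uniq// inE => /andP[/negbTE ->].
  rewrite [X in _ / X](_ : _ = 1) ?divr1; last exact: (log_weight0 hb d).
  rewrite lerXn2r ?nnegrE ?(ltW Sp)//.
  by case/andP: cint0.
apply: le_trans (ereal_sup_ubound _); last first.
  exists f; last by [].
  split; last exact: nf.
  split; first exact: within_continuous_cospoly.
    by move=> k /eqP; rewrite gt_eqF// log_weight_gt0.
  by apply: (le_lt_trans nf); rewrite ltry.
rewrite big1 => [|i _]; last by rewrite /f cospolyZ c0 mulr0 mulr0.
rewrite sub0r normcN cube_integral_fourier0 fE lee_fin.
have -> : normc (A 0 / B)%:C = A 0 / B.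
  by rewrite /normc /= expr0n/= addr0 sqrtr_sqr ger0_norm// divr_ge0// ltW.
rewrite ler_pdivlMr//.
have -> : (6 * 3 `^ beta)^-1 * rate n * B = L / 2.
  have e1 : n%:R `^ (- 2^-1) * n%:R `^ 2^-1 = 1 :> R.
    by rewrite powRN mulVf// gt_eqF// powR_gt0.
  have e2 : L `^ (- beta + 2^-1) * L `^ 2^-1 * L `^ beta = L.
    rewrite -!powRD ?(gt_eqF Lp) ?implybT//.
    by rewrite (_ : - beta + 2^-1 + 2^-1 + beta = 1) ?powRr1 ?(ltW Lp)//; field.
  rewrite /rate -/L /B powRM ?(ltW Lp)//.
  transitivity ((6 * 3 `^ beta)^-1 * 3 * 3 `^ beta * (n%:R `^ (- 2^-1) * n%:R `^ 2^-1) *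
     (L `^ (- beta + 2^-1) * L `^ 2^-1 * L `^ beta)); first by ring.
  by rewrite e1 e2; field; rewrite gt_eqF.
case/andP: cint0 => h1 _; apply: le_trans h1; lra.
Qed.
End rate.

Theorem theorem6 (R : realType) (d : nat) (beta : R)
    (d_gt0 : (0 < d)%N) (beta_gt : 2^-1 < beta) :
  asymp (g_n (log_weight beta_gt d)) (e_n (log_weight beta_gt d)) /\
  asymp (e_n (log_weight beta_gt d))
    (fun n => (n%:R `^ (- 2^-1) * ln n%:R `^ (- beta + 2^-1))%:E).
Proof.
have [C C0 [n1 gC]] := g_n_le_rate beta_gt d_gt0.
have [c c0 [n2 ce]] := rate_le_e_n beta_gt d_gt0.
have near_ge (P : nat -> Prop) n0 : (forall n, (n0 <= n)%N -> P n) -> \forall n \near \oo, P n.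
  by move=> H; exists n0 => // n; exact: H.
split; split.
- exists (C / c); first exact: divr_gt0.
  apply: (near_ge _ (maxn n1 n2)) => n; rewrite geq_max => /andP[/gC h1 /ce h2].
  apply: (le_trans h1); rewrite (_ : C * rate beta n = C / c * (c * rate beta n)).
    by rewrite EFinM lee_wpmul2l// lee_fin divr_ge0// ltW.
  by field; rewrite gt_eqF.
- exists 1 => //; apply: (near_ge _ 0%N) => n _; rewrite mul1e; exact: e_n_le_g_n.
- exists C => //; apply: (near_ge _ n1) => n /gC h; rewrite -EFinM.
  exact: le_trans (e_n_le_g_n _ _) h.
- exists c^-1; first by rewrite invr_gt0.
  apply: (near_ge _ n2) => n /ce h.
  rewrite -[X in (X%:E <= _)%E](mulKf (lt0r_neq0 c0)) EFinM lee_wpmul2l//.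
  by rewrite lee_fin invr_ge0 ltW.
Qed.
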